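(* Assume that $X$ is of Pareto-type with index $\alpha=1$, i.e. $1-F(x)\sim x^{-1}\ell(x)$ as $x\to\infty$ with $\ell$ slowly varying, that $\mu_1=\infty$, and that the counting process $\{N(t);\,t\geq 0\}$ $\mathcal{D}$-averages in time to the random variable $\Lambda$. Define $(a_t)_{t>0}$ by $\lim_{t\to\infty}t\,a_t^{-1}\ell(a_t)=1$ and $(a^\prime_t)_{t>0}$ by $\lim_{t\to\infty}t\,(a^{\prime}_t)^{-1}\tilde\ell(a^\prime_t)=1$, with $\tilde\ell(x)=\int_0^x\frac{\ell(u)}{u}\,du\in\mathrm{RV}_0$. Then $$\frac{a^\prime_t}{a_t}\,\frac{\widehat{\mathrm{CoVar}(X)}}{\sqrt{N(t)}}\stackrel{\mathcal{D}}{\longrightarrow}\frac{\sqrt{U_1}}{\Lambda}\quad\text{as } t\rightarrow\infty,$$ where the joint distribution of the random vector $(U_1,\Lambda)^\prime$ is determined by $$\mathbb{E}\left\{e^{-rU_1-s\Lambda}\right\}=\mathbb{E}\left\{e^{-\sqrt{r\pi}\,\Lambda}\right\},\quad r>0,\ s\geq 0.$$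
   Context: $X$ is a positive random variable with distribution function $F$ and $\mu_\beta:=\mathbb{E}X^\beta\le\infty$; $X_1,X_2,\ldots$ are i.i.d. copies of $X$; $\{N(t);\,t\geq 0\}$ is a counting process (nonnegative integer-valued, nondecreasing in $t$) independent of the $X_i$'s. The sample coefficient of variation based on $X_1,\ldots,X_{N(t)}$ is $\widehat{\mathrm{CoVar}(X)}:=S/\overline X$, where $\overline X:=\frac{1}{N(t)}\sum_{i=1}^{N(t)}X_i$ and $S\ge0$ with $S^2:=\frac{1}{N(t)}\sum_{i=1}^{N(t)}(X_i-\overline X)^2$; on $\{N(t)=0\}$ it, and its quotient by $\sqrt{N(t)}$, are set to $0$. $X$ (or $F$) is of Pareto-type with index $\alpha>0$ if $1-F(x)\sim x^{-\alpha}\ell(x)$ as $x\to\infty$ for a slowly varying function $\ell$. $\mathrm{RV}_0$ is the class of slowly varying functions. The counting process $\mathcal{D}$-averages in time to $\Lambda$ if $N(t)/t\stackrel{\mathcal{D}}{\longrightarrow}\Lambda$ (convergence in distribution) as $t\to\infty$, where $\mathbb{P}[\Lambda>0]=1$.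
   Formalization: The right side of the joint Laplace transform is corrected to E exp(-(s+√(rπ))Λ), since the printed one forces Λ=0 a.s. as r→0; a_t and a'_t are required to tend to infinity, and ℓ(u)/u to be integrable on (0,x] so that the integral ℓ̃ is defined. *)

(* Defs.v *)
From HB Require Import structures.
From mathcomp Require Import all_boot all_order all_algebra finmap.
From mathcomp Require Import all_classical all_reals all_analysis.

Set Implicit Arguments.
Unset Strict Implicit.
Unset Printing Implicit Defensive.

Import Order.TTheory GRing.Theory Num.Theory.
Import numFieldNormedType.Exports.

Local Open Scope classical_set_scope.
Local Open Scope ring_scope.

(* Positivity is only required eventually. *)
Definition slowly_varying (R : realType) (l : R -> R) : Prop :=
  [/\ measurable_fun (`]0, +oo[ : set R) l,
      (\forall x \near +oo, 0 < l x) &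
      forall c : R, 0 < c -> l (c * x) / l x @[x --> +oo] --> (1 : R)].

Definition pareto_type d (T : measurableType d) (R : realType)
    (P : probability T R) (X : {RV P >-> R}) (alpha : R) (l : R -> R) : Prop :=
  slowly_varying l /\
  (1 - fine (cdf X x)) / (x `^ (- alpha) * l x) @[x --> +oo] --> (1 : R).

(* Rintegral is also defined when l u / u is not integrable on ]0, x], where it
   has no meaning: integrability has to be required alongside. *)
Definition l_tilde (R : realType) (l : R -> R) (x : R) : R :=
  Rintegral lebesgue_measure `]0, x] (fun u => l u / u).

Definition identically_distributed d1 (T1 : measurableType d1)
    d2 (T2 : measurableType d2) (R : realType)
    (P1 : probability T1 R) (P2 : probability T2 R)
    (X : {RV P1 >-> R}) (Y : {RV P2 >-> R}) : Prop :=
  forall A : set R, measurable A -> distribution P1 X A = distribution P2 Y A.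

Definition mutually_independent d (T : measurableType d) (R : realType)
    (P : probability T R) (X : nat -> {RV P >-> R}) : Prop :=
  forall (J : {fset nat}) (A : nat -> set R), (forall j, measurable (A j)) ->
    P (\bigcap_(j in [set` J]) X j @^-1` A j) =
    (\prod_(j <- J) P (X j @^-1` A j))%E.

Definition iid d (T : measurableType d) (R : realType)
    (P : probability T R) (X : nat -> {RV P >-> R}) : Prop :=
  mutually_independent X /\ forall i, identically_distributed (X i) (X 0%N).

Definition sigma_generated d (T : measurableType d) d' (T' : measurableType d')
    (I : Type) (D : set I) (Y : I -> T -> T') : set (set T) :=
  <<s \bigcup_(i in D) preimage_set_system setT (Y i) measurable >>.

(* Time is indexed by all of R, but only t >= 0 is ever constrained. *)
Definition counting_process d (T : measurableType d) (R : realType)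
    (P : probability T R) (N : R -> {RV P >-> nat}) : Prop :=
  forall (w : T) (s t : R), 0 <= s -> s <= t -> (N s w <= N t w)%N.

Definition process_independent d (T : measurableType d) (R : realType)
    (P : probability T R) (N : R -> {RV P >-> nat}) (X : nat -> {RV P >-> R}) :
    Prop :=
  forall A B : set T,
    sigma_generated [set t : R | 0 <= t] (fun t w => N t w) A ->
    sigma_generated [set: nat] (fun i w => X i w) B ->
    P (A `&` B) = (P A * P B)%E.

(* Y_t --D--> Z as t --> +oo: convergence of distribution functions at the
   continuity points of the limit; Y and Z may live on different spaces. *)
Definition cvg_in_distribution d (T : measurableType d)
    d' (T' : measurableType d') (R : realType) (P : probability T R)
    (Y : R -> T -> R) (P' : probability T' R) (Z : T' -> R) : Prop :=
  forall x : R,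
    P' [set w | Z w <= y] @[y --> x] --> P' [set w | Z w <= x] ->
    P [set w | Y t w <= x] @[t --> +oo] --> P' [set w | Z w <= x].

Definition D_averages_in_time d (T : measurableType d)
    d' (T' : measurableType d') (R : realType) (P : probability T R)
    (N : R -> {RV P >-> nat}) (P' : probability T' R)
    (Lambda : {RV P' >-> R}) : Prop :=
  P' [set w | 0 < Lambda w] = 1%E /\
  cvg_in_distribution P (fun t w => (N t w)%:R / t) P' Lambda.

Definition sample_mean (R : realType) (n : nat) (x : nat -> R) : R :=
  n%:R^-1 * \sum_(i < n) x i.

Definition sample_std (R : realType) (n : nat) (x : nat -> R) : R :=
  Num.sqrt (n%:R^-1 * \sum_(i < n) (x i - sample_mean n x) ^+ 2).

(* Since 0^-1 = 0, this and its quotient by sqrt n are 0 for n = 0. *)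
Definition sample_covar (R : realType) (n : nat) (x : nat -> R) : R :=
  sample_std n x / sample_mean n x.

(* (U1, L) is a version of the limiting random vector (U_1, Lambda): U1 >= 0,
   L is a copy of Lambda, and the joint Laplace transform is the prescribed
   one. The exponent on the right must contain the term s L: without it the
   identity would force L = 0 almost surely (let r tend to 0). *)
Definition limit_vector d (T : measurableType d) d' (T' : measurableType d')
    (R : realType) (P : probability T R) (P' : probability T' R)
    (Lambda : {RV P >-> R}) (U1 L : {RV P' >-> R}) : Prop :=
  [/\ P' [set w | 0 <= U1 w] = 1%E,
      identically_distributed L Lambda &
      forall r s : R, 0 < r -> 0 <= s ->
        ('E_P'[fun w => expR (- r * U1 w - s * L w)] =
         'E_P'[fun w => expR (- (s + Num.sqrt (r * pi)) * L w)])%E].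

(* Main.v *)
Require Import Defs.
From HB Require Import structures.
From mathcomp Require Import all_boot all_order all_algebra finmap.
From mathcomp Require Import all_classical all_reals all_analysis measurable_realfun.
From mathcomp Require Import ring lra zify.

Set Implicit Arguments.
Unset Strict Implicit.
Unset Printing Implicit Defensive.

Import Order.TTheory GRing.Theory Num.Theory.
Import numFieldNormedType.Exports.

Local Open Scope classical_set_scope.
Local Open Scope ring_scope.

(* Put b(x) = P(X > x) and G(x) = int_0^x b = E min(X, x), so that G ~ l_tilde. Along
   counts n with n b(alpha) -> 1 and n G(beta) / beta -> 1, the sums satisfy
   sum_(i < n) X_i / beta -> 1 in probability (relative stability) and
   sum_(i < n) (X_i / alpha)^2 -> V in law, E e^(-r V) = e^(-sqrt (pi r)); both follow
   from Laplace transforms of one summand. The squared coefficient of variation times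
   (beta / alpha)^2 / n is the quotient of the second sum by the square of the first, up
   to (beta / alpha)^2 / n -> 0, hence tends to V. For n of order t one may take
   alpha = a_t n / t and beta = a'_t n / t, and then beta / alpha = a'_t / a_t does not
   depend on n: as N(t) / t is tight and N is independent of X, the random sample size
   does not change the limit sqrt V. On the other side the Laplace identity says that
   U_1 = Lambda^2 V with V independent of Lambda, so sqrt U_1 / Lambda = sqrt V. *)

(** The method uses Laplace transforms only, so variables must be nonnegative at every point.
    Positivity of X and of U_1 holds almost surely; the proof therefore works with |X_i| and |U_1|
    and returns through events of probability one. Intermediate comparisons of laws bound P(Y <= x)
    by P(V <= x') and P(V <= x) by P(Y <= x'), with a gap x < x' and a small error. This form
    survives squaring, division by a sum close to 1 and mixing over N(t); the gap is closed only at
    the end, at a continuity point of the limit. V is realized as (pi / 2) / z^2 with z standard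
    normal, which supplies both the existence of the law and its transform. Weak one-sided Potter
    bounds, obtained by repeated doubling, are enough: (beta / alpha)^2 / n is 1 / n up to slowly
    varying factors, so a small loss in the exponents is harmless. The infinite mean enters through
    G(x) -> +oo: near 0 nothing relates l to the tail of X, and only the divergence of G makes the
    integral of l(u) / u forget this region. *)

(** * Real-valued probabilities and expectations of bounded variables *)

Section bounded_expectation.
Context {R : realType} {d : measure_display} {T : measurableType d}.
Variable P : probability T R.
Implicit Types (f g : T -> R) (A : set T).

(** Transforms e^(-s Y), polynomials in them, indicators and truncations min(Z, x) are all bounded.
    For such functions integrability is automatic and [mean] can take real values. *)
Definition bounded_rv f :=
  measurable_fun [set: T] f /\ exists M, forall w, `|f w| <= M.

Definition prob A : R := fine (P A).

Definition mean f : R := \int[P]_w f w.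

Lemma probE A : measurable A -> P A = (prob A)%:E.
Proof. by move=> mA; rewrite /prob fineK// fin_num_measure. Qed.

Lemma prob_ge0 A : 0 <= prob A. Proof. exact: fine_ge0. Qed.

Lemma prob_le1 A : measurable A -> prob A <= 1.
Proof. by move=> mA; rewrite -lee_fin -probE// probability_le1. Qed.

Lemma le_prob A B : measurable A -> measurable B -> A `<=` B -> prob A <= prob B.
Proof.
by move=> mA mB AB; rewrite -lee_fin -!probE// le_measure ?inE.
Qed.

Lemma probC A : measurable A -> prob (~` A) = 1 - prob A.
Proof.
move=> mA; apply: EFin_inj; rewrite -probE; last exact: measurableC.
by rewrite probability_setC// probE// EFinB.
Qed.

Lemma probU A B : measurable A -> measurable B -> prob (A `|` B) <= prob A + prob B.
Proof.
move=> mA mB; rewrite -lee_fin EFinD -!probE//; last exact: measurableU.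
by apply: measureU2.
Qed.

Lemma bounded_rv_integrable f : bounded_rv f -> P.-integrable [set: T] (EFin \o f).
Proof.
move=> [mf [M fM]]; apply: measurable_bounded_integrable => //.
  by rewrite (le_lt_trans (probability_le1 _ _)) ?ltry.
exists M; split; first exact: num_real.
by move=> x Mx w _; apply: le_trans (fM w) (ltW Mx).
Qed.

Lemma bounded_rv_cst (c : R) : bounded_rv (fun=> c).
Proof. by split; [exact: measurable_cst|exists `|c|]. Qed.

Lemma bounded_rv_indic A : measurable A -> bounded_rv \1_A.
Proof.
move=> mA; split; first exact/measurable_indicP.
by exists 1 => w; rewrite indicE; case: (_ \in _); rewrite ?normr1 ?normr0.
Qed.

Lemma bounded_rvD f g : bounded_rv f -> bounded_rv g -> bounded_rv (fun w => f w + g w).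
Proof.
move=> [mf [M fM]] [mg [N gN]]; split; first exact: measurable_funD.
by exists (M + N) => w; apply: le_trans (ler_normD _ _) (lerD _ _).
Qed.

Lemma bounded_rvN f : bounded_rv f -> bounded_rv (fun w => - f w).
Proof.
move=> [mf [M fM]]; split; first exact: measurableT_comp.
by exists M => w; rewrite normrN.
Qed.

Lemma bounded_rvB f g : bounded_rv f -> bounded_rv g -> bounded_rv (fun w => f w - g w).
Proof. by move=> bf bg; apply: bounded_rvD => //; exact: bounded_rvN. Qed.

Lemma bounded_rvM f g : bounded_rv f -> bounded_rv g -> bounded_rv (fun w => f w * g w).
Proof.
move=> [mf [M fM]] [mg [N gN]]; split; first exact: measurable_funM.
by exists (M * N) => w; rewrite normrM ler_pM.
Qed.

Lemma bounded_rv_sum (I : Type) (s : seq I) (F : I -> T -> R) :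
  (forall i, bounded_rv (F i)) -> bounded_rv (fun w => \sum_(i <- s) F i w).
Proof.
move=> bF; elim: s => [|i s ih].
  by under eq_fun do rewrite big_nil; exact: bounded_rv_cst.
by under eq_fun do rewrite big_cons; exact: bounded_rvD.
Qed.

Lemma bounded_rv_prod (I : Type) (s : seq I) (F : I -> T -> R) :
  (forall i, bounded_rv (F i)) -> bounded_rv (fun w => \prod_(i <- s) F i w).
Proof.
move=> bF; elim: s => [|i s ih].
  by under eq_fun do rewrite big_nil; exact: bounded_rv_cst.
by under eq_fun do rewrite big_cons; exact: bounded_rvM.
Qed.

Lemma bounded_rv01 f : measurable_fun [set: T] f -> (forall w, 0 <= f w <= 1) ->
  bounded_rv f.
Proof.
by move=> mf f01; split => //; exists 1 => w; rewrite ger0_norm; case/andP: (f01 w).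
Qed.

Lemma meanD f g : bounded_rv f -> bounded_rv g ->
  mean (fun w => f w + g w) = mean f + mean g.
Proof. by move=> bf bg; rewrite /mean RintegralD//; exact: bounded_rv_integrable. Qed.

Lemma meanB f g : bounded_rv f -> bounded_rv g ->
  mean (fun w => f w - g w) = mean f - mean g.
Proof. by move=> bf bg; rewrite /mean RintegralB//; exact: bounded_rv_integrable. Qed.

Lemma meanZ (c : R) f : bounded_rv f -> mean (fun w => c * f w) = c * mean f.
Proof. by move=> bf; rewrite /mean RintegralZl//; exact: bounded_rv_integrable. Qed.

Lemma mean_cst (c : R) : mean (fun=> c) = c.
Proof. by rewrite /mean Rintegral_cst//= probability_setT mulr1. Qed.

Lemma mean_indic A : measurable A -> mean \1_A = prob A.
Proof. by move=> mA; rewrite /mean /Rintegral integral_indic// setIT. Qed.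

Lemma mean_sum (I : Type) (s : seq I) (F : I -> T -> R) :
  (forall i, bounded_rv (F i)) ->
  mean (fun w => \sum_(i <- s) F i w) = \sum_(i <- s) mean (F i).
Proof.
move=> bF; elim: s => [|i s ih].
  by under eq_fun do rewrite big_nil; rewrite mean_cst big_nil.
under eq_fun do rewrite big_cons.
by rewrite big_cons meanD ?ih//; exact: bounded_rv_sum.
Qed.

Lemma eq_mean f g : f =1 g -> mean f = mean g.
Proof. by move=> /funext ->. Qed.

Lemma le_mean f g : bounded_rv f -> bounded_rv g -> (forall w, f w <= g w) ->
  mean f <= mean g.
Proof.
by move=> bf bg fg; apply: le_Rintegral => //; exact: bounded_rv_integrable.
Qed.

Lemma mean_dist f g (c : R) : bounded_rv f -> bounded_rv g ->
  (forall w, `|f w - g w| <= c) -> `|mean f - mean g| <= c.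
Proof.
move=> bf bg fgc; rewrite -meanB// ler_norml.
have bc := bounded_rv_cst; have bfg := bounded_rvB bf bg.
rewrite -{1}(mean_cst (- c)) -{2}(mean_cst c); apply/andP; split;
  by apply: le_mean => // w; have := fgc w; rewrite ler_norml => /andP[].
Qed.

Lemma mean_ge0 f : (forall w, 0 <= f w) -> 0 <= mean f.
Proof. by move=> f0; exact: Rintegral_ge0. Qed.

Lemma expectation_mean f : bounded_rv f -> ('E_P[f] = (mean f)%:E)%E.
Proof.
move=> bf; rewrite unlock /mean /Rintegral fineK//.
exact/integrable_fin_num/bounded_rv_integrable.
Qed.

Lemma markov_mean f A (c : R) : bounded_rv f -> measurable A ->
  (forall w, 0 <= f w) -> (forall w, A w -> c <= f w) -> c * prob A <= mean f.
Proof.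
move=> bf mA f0 fc; rewrite -mean_indic// -meanZ; last exact: bounded_rv_indic.
apply: le_mean => //.
  by apply: bounded_rvM; [exact: bounded_rv_cst|exact: bounded_rv_indic].
move=> w; rewrite indicE; case: (boolP (w \in A)) => [|_]; rewrite ?mulr0// mulr1.
by rewrite inE; exact: fc.
Qed.

End bounded_expectation.

(** * Events of probability one and equality in law *)

Section almost_sure.
Context {R : realType} {d : measure_display} {T : measurableType d}.
Variable P : probability T R.

(** The complement of D is null, so only the traces on D count. With D the event that a variable is
    positive, this is the passage between a variable and its absolute value. *)
Lemma prob_ae_iff (A B D : set T) : measurable A -> measurable B -> measurable D ->
  P D = 1%E -> (forall w, D w -> (A w <-> B w)) -> P A = P B.
Proof.
move=> mA mB mD PD AB.
have e1 (C : set T) : measurable C -> P C = P (C `&` D).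
  move=> mC; rewrite -[in LHS](setIT C) -(setUv D) setIUr measureU.
  - rewrite [X in (_ + X)%E](_ : _ = 0%E) ?adde0//.
    apply/eqP; rewrite eq_le measure_ge0 andbT.
    have := probability_setC P mD; rewrite PD subee// => <-.
    by apply: le_measure; rewrite ?inE//; [apply: measurableI => //|]; exact: measurableC.
  - exact: measurableI.
  - by apply: measurableI => //; exact: measurableC.
  - by rewrite setIACA setICr setI0.
rewrite e1// [RHS]e1//; congr (P _); apply/seteqP; split => w [/= h1 h2]; split => //;
  by apply/(AB w h2).
Qed.

Lemma prob_setI1 (A B : set T) : measurable A -> measurable B ->
  P A = 1%E -> P B = 1%E -> P (A `&` B) = 1%E.
Proof.
move=> mA mB PA PB; rewrite -PB; apply: (prob_ae_iff _ _ mA PA) => //.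
  exact: measurableI.
by move=> w Aw; split => [[]|].
Qed.

Lemma identically_distributed_mean d' (T' : measurableType d') (P' : probability T' R)
  (X : {RV P >-> R}) (Y : {RV P' >-> R}) (f : R -> R) :
  identically_distributed X Y -> measurable_fun [set: R] f -> (forall x, 0 <= f x) ->
  mean P (fun w => f (X w)) = mean P' (fun w => f (Y w)).
Proof.
move=> XY mf f0; rewrite /mean /Rintegral; congr fine.
have mEf : measurable_fun [set: R] (EFin \o f) by exact/measurable_EFinP.
have f0' y : (0 <= (EFin \o f) y)%E by rewrite lee_fin.
rewrite -[X in X = _](ge0_integral_distribution X mEf f0').
rewrite -[X in _ = X](ge0_integral_distribution Y mEf f0').
by apply: eq_measure_integral => A mA _; exact: XY.
Qed.

End almost_sure.

(** * From independence of events to products of expectations *)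

Section independence.
Context {R : realType} {d : measure_display} {T : measurableType d}.
Variable P : probability T R.
Implicit Types (f g : T -> R).

Lemma sum_nat_ltn (m k : nat) : (\sum_(j < m) (j < k) = minn m k)%N.
Proof.
elim: m => [|m ih]; first by rewrite big_ord0 min0n.
rewrite big_ord_recr/= ih; case: ltnP => h /=; lia.
Qed.

(** The number of j in 1, ..., n + 1 with j <= (n + 1) y is the integer part of (n + 1) y, so the
    average of the indicators is y rounded down to a multiple of 1 / (n + 1). *)
Lemma floor_approx (n : nat) (y : R) : 0 <= y <= 1 ->
  `|y - n.+1%:R^-1 * \sum_(j < n.+1) (j.+1%:R <= n.+1%:R * y)%R%:R|
    <= n.+1%:R^-1.
Proof.
move=> /andP[y0 y1]; set z := n.+1%:R * y.
have n0 : 0 < n.+1%:R :> R by [].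
have z0 : 0 <= z by rewrite mulr_ge0// ltW.
have /andP[tz zt] := truncn_itv z0.
have tn : (Num.trunc z <= n.+1)%N.
  rewrite -(ler_nat R); apply: le_trans tz _.
  by rewrite /z -[leRHS]mulr1 ler_wpM2l.
have -> : \sum_(j < n.+1) (j.+1%:R <= z)%R%:R = (Num.trunc z)%:R :> R.
  under eq_bigr do rewrite -truncn_gt_nat.
  by rewrite -natr_sum sum_nat_ltn (minn_idPr tn).
have -> : y = n.+1%:R^-1 * z by rewrite /z mulrA mulVf ?mul1r// gt_eqF.
rewrite -mulrBr normrM gtr0_norm ?invr_gt0// -[leRHS]mulr1 ler_wpM2l ?invr_ge0 ?ltW//.
rewrite ger0_norm ?subr_ge0//.
by rewrite -natr1 in zt; lra.
Qed.

Lemma le0_of_natV (x C : R) : (forall n : nat, x <= C * n.+1%:R^-1) -> x <= 0.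
Proof.
move=> h; rewrite leNgt; apply/negP => x0.
have C0 : 0 < C.
  by have := h 0%N; rewrite invr1 mulr1; exact: lt_le_trans.
have := h (Num.trunc (C / x)); apply/negP; rewrite -ltNge.
by rewrite ltr_pdivrMr// mulrC -ltr_pdivrMr// truncnS_gt.
Qed.

(* f is uniformly approximated by averages of indicators of its superlevel sets. *)
Lemma mean_mul_indep (G : T -> R) (Z : {RV P >-> R}) (f : R -> R) :
  measurable_fun [set: T] G -> (forall w, 0 <= G w <= 1) ->
  measurable_fun [set: R] f -> (forall x, 0 <= f x <= 1) ->
  (forall B, measurable B ->
    mean P (fun w => G w * \1_(Z @^-1` B) w) = mean P G * prob P (Z @^-1` B)) ->
  mean P (fun w => G w * f (Z w)) = mean P G * mean P (fun w => f (Z w)).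
Proof.
move=> mG G01 mf f01 GB.
have bG := bounded_rv01 mG G01.
have mfZ : measurable_fun [set: T] (fun w => f (Z w)) by apply: measurableT_comp.
have bf : bounded_rv (fun w => f (Z w)) by apply: bounded_rv01.
pose A (n : nat) (j : 'I_n.+1) := [set x | j.+1%:R <= n.+1%:R * f x].
have mA n j : measurable (A n j).
  rewrite -[A n j]setTI.
  have := @measurable_fun_le _ _ R setT (fun=> j.+1%:R) (fun x => n.+1%:R * f x).
  by apply => //; exact: measurable_funM.
have mZA n j : measurable (Z @^-1` A n j).
  exact: measurable_funPTI.
pose s n w : R := n.+1%:R^-1 * \sum_(j < n.+1) \1_(Z @^-1` A n j) w.
have bI n j : bounded_rv (\1_(Z @^-1` A n j) : T -> R) by exact: bounded_rv_indic.
have bS n : bounded_rv (fun w => \sum_(j < n.+1) \1_(Z @^-1` A n j) w : R).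
  exact: bounded_rv_sum.
have bs n : bounded_rv (s n) by apply: bounded_rvM => //; exact: bounded_rv_cst.
have fs n w : `|f (Z w) - s n w| <= n.+1%:R^-1.
  have := floor_approx n (f01 (Z w)); rewrite /s.
  suff -> : \sum_(j < n.+1) \1_(Z @^-1` A n j) w =
    \sum_(j < n.+1) (j.+1%:R <= n.+1%:R * f (Z w))%R%:R :> R by [].
  by apply: eq_bigr => j _; rewrite indicE; congr (nat_of_bool _)%:R; apply/idP/idP; rewrite inE.
have ms n : mean P (fun w => G w * s n w) = mean P G * mean P (s n).
  have -> : (fun w => G w * s n w) =
      (fun w => n.+1%:R^-1 * \sum_(j < n.+1) (G w * \1_(Z @^-1` A n j) w)).
    by apply/funext => w; rewrite /s mulrCA mulr_sumr.
  rewrite meanZ; last by apply: bounded_rv_sum => j; exact: bounded_rvM.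
  rewrite mean_sum; last by move=> j; exact: bounded_rvM.
  rewrite meanZ// mean_sum// mulrCA [in RHS]mulr_sumr; congr (_ * _).
  by apply: eq_bigr => j _; rewrite GB// mean_indic.
have mG01 : 0 <= mean P G <= 1.
  rewrite mean_ge0 => [|w]; last by case/andP: (G01 w).
  rewrite -(mean_cst P 1); apply: le_mean => // [|w]; first exact: bounded_rv_cst.
  by case/andP: (G01 w).
have close (H : T -> R) n : bounded_rv H -> (forall w, 0 <= H w <= 1) ->
  `|mean P (fun w => H w * f (Z w)) - mean P (fun w => H w * s n w)| <= n.+1%:R^-1.
  move=> bH H01.
  have bHf : bounded_rv (fun w => H w * f (Z w)) by exact: bounded_rvM.
  have bHs : bounded_rv (fun w => H w * s n w) by exact: bounded_rvM.
  have key w : `|H w * f (Z w) - H w * s n w| <= n.+1%:R^-1.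
    rewrite -mulrBr normrM; apply: le_trans (fs n w).
    by rewrite ler_piMl// ger0_norm; case/andP: (H01 w).
  exact: mean_dist.
(* The constant 2 counts two approximations, of f(Z) weighted by G and of f(Z) alone, each costing 1
   / (n + 1). *)
apply/eqP; rewrite -subr_eq0 -normr_le0; apply: (@le0_of_natV _ 2) => n.
have := close G n bG G01; rewrite ms.
have := close (fun=> 1) n (bounded_rv_cst 1).
have mul1 (h : T -> R) : (fun w => 1 * h w) = h by apply/funext => w; rewrite mul1r.
rewrite !mul1 => /(_ _)/wrap[|h2 h1]; first by move=> _; rewrite ler01 lexx.
have h3 : `|mean P G * mean P (fun w => f (Z w)) - mean P G * mean P (s n)| <= n.+1%:R^-1.
  rewrite -mulrBr normrM; apply: le_trans h2.
  by rewrite ler_piMl// ger0_norm; case/andP: mG01.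
rewrite mulrDl mul1r; apply: le_trans (lerD h1 h3).
rewrite [X in _ <= _ + X]distrC; exact: ler_distD.
Qed.

(** Mutual independence speaks of events only, so the factors f(Z_i) are brought in one at a time.
    The claim proved by induction on k mixes k such factors with indicators of Z_j in A_j, for j in
    a finite set J of indices at least k; J empty is the lemma. *)
Lemma iid_mean_prod (Z : nat -> {RV P >-> R}) (f : R -> R) (n : nat) :
  iid Z -> measurable_fun [set: R] f -> (forall x, 0 <= f x <= 1) ->
  mean P (fun w => \prod_(i < n) f (Z i w)) = mean P (fun w => f (Z 0%N w)) ^+ n.
Proof.
move=> [indZ idZ] mf f01.
have mfZ i : measurable_fun [set: T] (fun w => f (Z i w)) by apply: measurableT_comp.
have bf i : bounded_rv (fun w => f (Z i w)) by apply: bounded_rv01.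
have mZ i B : measurable B -> measurable (Z i @^-1` B).
  exact: measurable_funPTI.
have mean_f i : mean P (fun w => f (Z i w)) = mean P (fun w => f (Z 0%N w)).
  rewrite /mean /Rintegral; congr fine.
  have mEf : measurable_fun [set: R] (EFin \o f) by exact/measurable_EFinP.
  have f0 y : (0 <= (EFin \o f) y)%E by rewrite lee_fin; case/andP: (f01 y).
  rewrite -[X in X = _](ge0_integral_distribution (Z i) mEf f0).
  rewrite -[X in _ = X](ge0_integral_distribution (Z 0%N) mEf f0).
  apply: eq_measure_integral => A mA _; exact: idZ.
have bfp k : bounded_rv (fun w => \prod_(i < k) f (Z i w)) by exact: bounded_rv_prod.
pose I (J : {fset nat}) (A : nat -> set R) := \bigcap_(j in [set` J]) Z j @^-1` A j.
have mI J A : (forall j, measurable (A j)) -> measurable (I J A).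
  move=> mA; apply: fin_bigcap_measurable => // j _; exact: mZ.
suff claim k : forall (J : {fset nat}) (A : nat -> set R),
    (forall j, j \in J -> (k <= j)%N) -> (forall j, measurable (A j)) ->
    mean P (fun w => (\prod_(i < k) f (Z i w)) * \1_(I J A) w) =
    mean P (fun w => f (Z 0%N w)) ^+ k * \prod_(j <- J) prob P (Z j @^-1` A j).
  have := claim n fset0 (fun=> setT); rewrite big_nil mulr1 => <- //.
  apply: eq_mean => w; rewrite indicE mem_set ?mulr1//.
elim: k => [|k ih] J A kJ mA.
  under eq_fun do rewrite big_ord0 mul1r.
  rewrite mean_indic; last exact: mI.
  rewrite expr0 mul1r; apply: EFin_inj; rewrite -probE; last exact: mI.
  rewrite indZ// -prodEFin; apply: eq_bigr => j _.
  exact/probE/mZ.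
(* An indicator of Z_k in B is absorbed by adding k to J with A_k = B. All indices are then still at
   least k, so the induction hypothesis applies; [mean_mul_indep] afterwards replaces the indicator
   by f(Z_k). *)
have GE B : measurable B ->
   mean P (fun w => (\prod_(i < k) f (Z i w) * \1_(I J A) w) * \1_(Z k @^-1` B) w) =
   mean P (fun w => f (Z 0%N w)) ^+ k * \prod_(j <- J) prob P (Z j @^-1` A j)
     * prob P (Z k @^-1` B).
  move=> mB; pose A' j := if j == k then B else A j.
  have kNJ : k \notin J by apply/negP => /kJ; rewrite ltnn.
  have := ih (k |` J)%fset A'.
  rewrite big_fsetU1//= [A' k]/A' eqxx => /(_ _)/wrap[|].
    by move=> j; rewrite in_fset1U => /predU1P[->//|/kJ/ltnW].
  move=> /(_ _)/wrap[|h]; first by move=> j; rewrite /A'; case: ifP => // _; exact: mA.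
  rewrite -mulrA [X in _ = _ * X]mulrC.
  have -> : \prod_(j <- J) prob P (Z j @^-1` A j) = \prod_(j <- J) prob P (Z j @^-1` A' j).
    rewrite !big_seq; apply: eq_bigr => j jJ; rewrite /A'; case: eqP => // jk.
    by move: kNJ; rewrite -jk jJ.
  rewrite -h; apply: eq_mean => w; rewrite -mulrA; congr (_ * _).
  rewrite !indicE -natrM mulnb; congr (nat_of_bool _)%:R.
  apply/idP/idP.
    move=> /andP[]; rewrite !inE => h1 h2 j /=; rewrite in_fset1U => /predU1P[->|jJ].
      by rewrite /A' eqxx.
    by rewrite /A'; case: eqP => [jk|_]; [move: kNJ; rewrite -jk jJ|exact: h1].
  rewrite !inE => h1; apply/andP; split; rewrite inE.
    move=> j /= jJ; have := h1 j; rewrite /= in_fset1U jJ orbT => /(_ isT).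
    by rewrite /A'; case: eqP => // jk; move: kNJ; rewrite -jk jJ.
  by have := h1 k; rewrite /= in_fset1U eqxx => /(_ isT); rewrite /A' eqxx.
pose G w := \prod_(i < k) f (Z i w) * \1_(I J A) w.
have mJ := mI J A mA.
have bG : bounded_rv G by apply: bounded_rvM => //; exact: bounded_rv_indic.
have GT : mean P G = mean P (fun w => f (Z 0%N w)) ^+ k * \prod_(j <- J) prob P (Z j @^-1` A j).
  by rewrite /G ih// => j /kJ/ltnW.
have -> : (fun w => \prod_(i < k.+1) f (Z i w) * \1_(I J A) w) = (fun w => G w * f (Z k w)).
  by apply/funext => w; rewrite big_ord_recr/= /G mulrAC.
rewrite mean_mul_indep//.
- by rewrite GT mean_f exprSr mulrAC.
- by case: bG.
- move=> w; rewrite /G indicE; apply/andP; split.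
    by rewrite mulr_ge0// prodr_ge0// => i _; case/andP: (f01 (Z i w)).
  rewrite mulr_ile1//; last by case: (_ \in _); rewrite ?lexx ?ler01.
    by rewrite prodr_ge0// => i _; case/andP: (f01 (Z i w)).
  by apply: prodr_ile1 => i _; exact: f01.
- by move=> B mB; rewrite GE// GT.
Qed.

End independence.

(** * Indicators of half-lines approximated by polynomials in e^(-y) *)

Section laplace_step.
Context {R : realType}.

(* A polynomial in e^(-y) close to the indicator of y <= c when m = e^(kc). *)
Definition laplace_step (k m : nat) (y : R) : R := 1 - (1 - expR (- (k%:R * y))) ^+ m.

Lemma bernoulli_ineq (u : R) (m : nat) : 0 <= u <= 1 -> 1 - m%:R * u <= (1 - u) ^+ m.
Proof.
move=> /andP[u0 u1]; elim: m => [|m ih]; first by rewrite mul0r subr0 expr0.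
rewrite exprS; apply: (@le_trans _ _ ((1 - u) * (1 - m%:R * u))).
  have m0 : 0 <= m%:R :> R by [].
  have : 0 <= m%:R * (u * u) by rewrite !mulr_ge0.
  by rewrite -natr1; lra.
by rewrite ler_wpM2l// subr_ge0.
Qed.

(** (1 - u)^m <= e^(-m u) and z e^(-z) <= 1. It serves as the bound 1 / (m u) on (1 - u)^m when m u
    is large. *)
Lemma pow_onem_le (u : R) (m : nat) : 0 <= u <= 1 -> m%:R * u * (1 - u) ^+ m <= 1.
Proof.
move=> /andP[u0 u1].
have h : (1 - u) ^+ m <= expR (- (m%:R * u)).
  rewrite -mulrN expRM_natl.
  by rewrite lerXn2r ?nnegrE ?expR_ge0 ?subr_ge0// expR_ge1Dx.
have z0 : 0 <= m%:R * u by rewrite mulr_ge0.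
apply: (@le_trans _ _ (m%:R * u * expR (- (m%:R * u)))); first by rewrite ler_wpM2l.
rewrite expRN ler_pdivrMr ?expR_gt0// mul1r.
by apply: le_trans (expR_ge1Dx _); rewrite lerDr.
Qed.

Lemma expR_Nmul01 (k : nat) (y : R) : 0 <= y -> 0 <= expR (- (k%:R * y)) <= 1.
Proof. by move=> y0; rewrite expR_ge0 -expR0 ler_expR oppr_le0 mulr_ge0. Qed.

Lemma laplace_step01 (k m : nat) (y : R) : 0 <= y -> 0 <= laplace_step k m y <= 1.
Proof.
move=> y0; have /andP[u0 u1] := expR_Nmul01 k y0.
rewrite /laplace_step; set u := expR _ in u0 u1 *.
have v0 : 0 <= 1 - u by rewrite subr_ge0.
have p0 : 0 <= (1 - u) ^+ m by rewrite exprn_ge0.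
have p1 : (1 - u) ^+ m <= 1 by rewrite exprn_ile1//; lra.
by apply/andP; split; lra.
Qed.

(** Put u = e^(-k y) and m about e^(k c), so that m u is about e^(k (c - y)). For y <= c - delta it
    is at least e^(k delta) and (1 - u)^m <= 1 / (m u) is small; for y >= c + delta it is at most 2
    e^(-k delta), and Bernoulli's inequality gives 1 - (1 - u)^m <= m u. *)
Lemma laplace_stepP (c delta eps : R) : 0 <= c -> 0 < delta -> 0 < eps ->
  exists k m : nat, forall y, 0 <= y ->
    (y <= c - delta -> 1 - eps <= laplace_step k m y) /\
    (c + delta <= y -> laplace_step k m y <= eps).
Proof.
move=> c0 d0 e0.
(* k delta >= 2 / eps and e^z >= z give 2 e^(-k delta) <= eps. The factor 2 pays for rounding: m <=
   e^(k c) + 1 <= 2 e^(k c). *)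
pose k := (Num.trunc (2 / (eps * delta))).+1.
have ked : 2 * expR (- (k%:R * delta)) <= eps.
  rewrite expRN ler_pdivrMr ?expR_gt0//.
  have h1 : 2 <= eps * (k%:R * delta).
    have := truncnS_gt (2 / (eps * delta)); rewrite -/k ltr_pdivrMr ?mulr_gt0// => h.
    by apply: le_trans (ltW h) _; rewrite mulrCA.
  by apply: le_trans h1 _; rewrite ler_wpM2l ?(ltW e0)//; apply: le_trans (expR_ge1Dx _); rewrite lerDr.
pose m := (Num.trunc (expR (k%:R * c))).+1.
exists k, m => y y0.
have u01 := expR_Nmul01 k y0.
have /andP[u0 u1] := u01.
have mgt : expR (k%:R * c) <= m%:R by exact/ltW/truncnS_gt.
have mle : m%:R <= expR (k%:R * c) + 1.
  by rewrite -natr1 lerD2r truncn_le expR_ge0.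
split=> yc; rewrite /laplace_step.
  rewrite lerD2l lerN2; apply: le_trans ked.
  have := pow_onem_le m u01; set p := (1 - _) ^+ m => hp.
  have p0 : 0 <= p by rewrite exprn_ge0// subr_ge0.
  have mu : expR (k%:R * delta) <= m%:R * expR (- (k%:R * y)).
    apply: (@le_trans _ _ (expR (k%:R * c) * expR (- (k%:R * y)))).
      rewrite -expRD ler_expR -mulrN -mulrDr ler_wpM2l//; lra.
    by rewrite ler_wpM2r.
  have : p <= expR (- (k%:R * delta)).
    rewrite expRN -[leRHS]mul1r ler_pdivlMr ?expR_gt0// mulrC.
    by apply: le_trans hp; rewrite ler_wpM2r.
  by have := expR_gt0 (- (k%:R * delta)); lra.
apply: le_trans ked.
have := bernoulli_ineq m u01; rewrite lerBlDr -lerBlDl => h; apply: le_trans h _.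
have e1 : 1 <= expR (k%:R * c) by rewrite -expR0 ler_expR mulr_ge0.
apply: (@le_trans _ _ (2 * expR (k%:R * c) * expR (- (k%:R * y)))).
  by rewrite ler_wpM2r//; lra.
rewrite -mulrA -expRD ler_wpM2l// ler_expR -mulrN -mulrDr -mulrN ler_wpM2l//; lra.
Qed.

(** The binomial expansion turns the mean of a step into a finite combination of Laplace transforms
    at integer points. *)
Lemma laplace_stepE (k m : nat) (y : R) : laplace_step k m y =
  1 - \sum_(i < m.+1) (((-1) ^+ i *+ 'C(m, i)) * expR (- ((k * i)%N%:R * y))).
Proof.
rewrite /laplace_step exprDn; congr (1 - _); apply: eq_bigr => i _.
rewrite expr1n mul1r [in LHS]exprNn -mulrnAl; congr (_ * _).
by rewrite -expRM_natl natrM; congr expR; ring.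
Qed.

Lemma measurable_laplace_step d (T : measurableType d) (Y : T -> R) k m :
  measurable_fun [set: T] Y -> measurable_fun [set: T] (fun w => laplace_step k m (Y w)).
Proof.
move=> mY; apply: measurable_funB => //; apply: measurable_funX.
apply: measurable_funB => //; apply: measurableT_comp => //.
by apply: measurableT_comp => //; exact: measurable_funM.
Qed.

Lemma bounded_laplace_step d (T : measurableType d) (Y : T -> R) k m :
  measurable_fun [set: T] Y -> (forall w, 0 <= Y w) ->
  bounded_rv (fun w => laplace_step k m (Y w)).
Proof.
move=> mY Y0; apply: bounded_rv01; first exact: measurable_laplace_step.
by move=> w; exact: laplace_step01.
Qed.

Lemma bounded_rv_expRN d (T : measurableType d) (Y : T -> R) (s : R) :
  measurable_fun [set: T] Y -> (forall w, 0 <= Y w) -> 0 <= s ->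
  bounded_rv (fun w => expR (- (s * Y w))).
Proof.
move=> mY Y0 s0; apply: bounded_rv01.
  apply: measurableT_comp => //; apply: measurableT_comp => //; exact: measurable_funM.
by move=> w; rewrite expR_ge0 -expR0 ler_expR oppr_le0 mulr_ge0.
Qed.

Lemma mean_laplace_step d (T : measurableType d) (P : probability T R) (Y : T -> R) k m :
  measurable_fun [set: T] Y -> (forall w, 0 <= Y w) ->
  mean P (fun w => laplace_step k m (Y w)) =
  1 - \sum_(i < m.+1) (((-1) ^+ i *+ 'C(m, i)) *
        mean P (fun w => expR (- ((k * i)%N%:R * Y w)))).
Proof.
move=> mY Y0; under eq_mean do rewrite laplace_stepE.
have be (i : 'I_m.+1) : bounded_rv (fun w => expR (- ((k * i)%N%:R * Y w))).
  exact: bounded_rv_expRN.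
have bce (i : 'I_m.+1) : bounded_rv (fun w => ((-1) ^+ i *+ 'C(m, i)) *
    expR (- ((k * i)%N%:R * Y w))).
  by apply: bounded_rvM => //; exact: bounded_rv_cst.
rewrite meanB; [|exact: bounded_rv_cst|exact: bounded_rv_sum].
rewrite mean_cst mean_sum//; congr (_ - _); apply: eq_bigr => i _.
by rewrite meanZ.
Qed.

End laplace_step.

(** * Continuity theorem for Laplace transforms *)

Section laplace_continuity.
Context {R : realType} {d d' : measure_display} {T : measurableType d}
  {T' : measurableType d'}.
Variables (P : probability T R) (P' : probability T' R).

Lemma measurable_le_cst d0 (T0 : measurableType d0) (Y : T0 -> R) (x : R) :
  measurable_fun [set: T0] Y -> measurable [set w | Y w <= x].
Proof.
move=> mY; rewrite -[X in measurable X]setTI.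
by apply: measurable_fun_le => //; exact: measurable_cst.
Qed.

Lemma le_mean_indic d0 (T0 : measurableType d0) (Q : probability T0 R)
  (f : T0 -> R) (A : set T0) (e : R) : bounded_rv f -> measurable A ->
  (forall w, f w <= \1_A w + e) -> mean Q f <= prob Q A + e.
Proof.
move=> bf mA fA; have bA := bounded_rv_indic mA.
rewrite -mean_indic// -(mean_cst Q e) -meanD//; last exact: bounded_rv_cst.
by apply: le_mean => //; apply: bounded_rvD => //; exact: bounded_rv_cst.
Qed.

Lemma mean_indic_le d0 (T0 : measurableType d0) (Q : probability T0 R)
  (f : T0 -> R) (A : set T0) (e : R) : bounded_rv f -> measurable A ->
  (forall w, \1_A w <= f w + e) -> prob Q A <= mean Q f + e.
Proof.
move=> bf mA fA; have bA := bounded_rv_indic mA.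
rewrite -mean_indic// -(mean_cst Q e) -meanD//; last exact: bounded_rv_cst.
by apply: le_mean => //; apply: bounded_rvD => //; exact: bounded_rv_cst.
Qed.

Lemma cvg_sum_seq (I J : Type) (F : set_system I) (r : seq J) (f : J -> I -> R) (l : J -> R) :
  Filter F -> (forall j, f j i @[i --> F] --> l j) ->
  \sum_(j <- r) f j i @[i --> F] --> \sum_(j <- r) l j.
Proof.
move=> FF fl; elim: r => [|j r ih].
  by under eq_fun do rewrite big_nil; rewrite big_nil; exact: cvg_cst.
by under eq_fun do rewrite big_cons; rewrite big_cons; exact: cvgD.
Qed.

(** A step centred at the midpoint of x and x', with half-width a quarter of the gap, lies up to eps
    / 3 between the indicators of y <= x and of y <= x'. Its mean converges because it is a
    combination of transforms. The gap x < x' makes continuity points of the law of V irrelevant,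
    and F is an arbitrary filter so that it can later carry uniformity in the counts. *)
Lemma laplace_continuity (I : Type) (F : set_system I) (Y : I -> T -> R) (V : T' -> R) :
  Filter F ->
  (forall i, measurable_fun [set: T] (Y i)) -> (forall i w, 0 <= Y i w) ->
  measurable_fun [set: T'] V -> (forall w, 0 <= V w) ->
  (forall s : R, 0 < s -> mean P (fun w => expR (- (s * Y i w))) @[i --> F] -->
     mean P' (fun w => expR (- (s * V w)))) ->
  forall x x' eps : R, 0 <= x -> x < x' -> 0 < eps ->
  \forall i \near F,
    prob P [set w | Y i w <= x] <= prob P' [set w | V w <= x'] + eps /\
    prob P' [set w | V w <= x] <= prob P [set w | Y i w <= x'] + eps.
Proof.
move=> FF mY Y0 mV V0 lap x x' eps x0 xx' e0.
have e3 : 0 < eps / 3 by rewrite divr_gt0.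
have c0 : 0 <= (x + x') / 2 by lra.
have dl0 : 0 < (x' - x) / 4 by lra.
have [k [m step]] := laplace_stepP c0 dl0 e3.
have mle i z := measurable_le_cst z (mY i).
have mleV z := measurable_le_cst z mV.
have bY i := bounded_laplace_step k m (mY i) (Y0 i).
have bV := bounded_laplace_step k m mV V0.
have cvg_step : mean P (fun w => laplace_step k m (Y i w)) @[i --> F] -->
    mean P' (fun w => laplace_step k m (V w)).
  under eq_fun do rewrite mean_laplace_step//.
  rewrite mean_laplace_step//; apply: cvgB; first exact: cvg_cst.
  apply: cvg_sum_seq => j; apply: cvgM; first exact: cvg_cst.
  (* The convergence assumed is for s > 0; at s = 0 both transforms are the constant 1. *)
  have [->|ki0] := eqVneq (k * j)%N 0%N.
    have e1 d0 (T0 : measurableType d0) (Q : probability T0 R) (W : T0 -> R) :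
        mean Q (fun w => expR (- (0%:R * W w))) = 1.
      by rewrite -[RHS](mean_cst Q); apply: eq_mean => w; rewrite mul0r oppr0 expR0.
    by under eq_fun do rewrite e1; rewrite e1; exact: cvg_cst.
  by apply: lap; rewrite ltr0n lt0n.
have lower d0 (T0 : measurableType d0) (Q : probability T0 R) (W : T0 -> R) :
    measurable_fun [set: T0] W -> (forall w, 0 <= W w) ->
    prob Q [set w | W w <= x] <= mean Q (fun w => laplace_step k m (W w)) + eps / 3.
  move=> mW W0; apply: mean_indic_le; [exact: bounded_laplace_step|exact: measurable_le_cst|].
  move=> w; rewrite indicE; case: (boolP (w \in _)) => [|_] /=.
    rewrite inE /= => Wx; have [h _] := step _ (W0 w).
    by rewrite -lerBlDr; apply: h; lra.
  by have /andP[h _] := laplace_step01 k m (W0 w); rewrite addr_ge0// ltW.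
have upper d0 (T0 : measurableType d0) (Q : probability T0 R) (W : T0 -> R) :
    measurable_fun [set: T0] W -> (forall w, 0 <= W w) ->
    mean Q (fun w => laplace_step k m (W w)) <= prob Q [set w | W w <= x'] + eps / 3.
  move=> mW W0; apply: le_mean_indic; [exact: bounded_laplace_step|exact: measurable_le_cst|].
  move=> w; rewrite indicE; case: (boolP (w \in _)) => [_|] /=.
    by have /andP[_ h] := laplace_step01 k m (W0 w); lra.
  rewrite notin_setE /= => /negP; rewrite -ltNge => Wx.
  have [_ h] := step _ (W0 w); rewrite add0r; apply: h; lra.
have near_step := cvgr_dist_lt _ _ cvg_step _ e3.
near=> i.
have : `|mean P' (fun w => laplace_step k m (V w)) -
    mean P (fun w => laplace_step k m (Y i w))| < eps / 3 by near: i; exact: near_step.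
rewrite ltr_norml => /andP[h1 h2].
have := lower _ _ P _ (mY i) (Y0 i); have := upper _ _ P _ (mY i) (Y0 i).
have := lower _ _ P' _ mV V0; have := upper _ _ P' _ mV V0.
by move=> *; split; lra.
Unshelve. all: by end_near. Qed.

End laplace_continuity.

Lemma measurable_set_lt {R : realType} d (T : measurableType d) (f g : T -> R) :
  measurable_fun [set: T] f -> measurable_fun [set: T] g ->
  measurable [set w | f w < g w].
Proof.
move=> mf mg; rewrite (_ : [set w | _] = ~` ([set: T] `&` [set w | g w <= f w])).
  by apply: measurableC; exact: measurable_fun_le.
by rewrite setTI; apply/seteqP; split => w /=; rewrite ltNge => /negP.
Qed.

(** * Layer-cake formula *)

Section layer_cake.
Context {R : realType} {d : measure_display} {T : measurableType d}.
Variable P : probability T R.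
Local Notation mu := (@lebesgue_measure R).

(** h(W) is the integral of k over [0, W[, so the expectation is a double integral of k(v) over 0 <=
    v < W(w), and Tonelli exchanges the two integrations. *)
Lemma layer_cake (W : T -> R) (k h : R -> R) :
  measurable_fun [set: T] W -> measurable_fun [set: R] k -> (forall v, 0 <= v -> 0 <= k v) ->
  (forall w, 0 <= W w) ->
  (forall z, 0 <= z -> (\int[mu]_(v in `[0%R, z[) (k v)%:E = (h z)%:E)%E) ->
  (\int[P]_w (h (W w))%:E =
   \int[mu]_(v in `[0%R, +oo[) (k v * prob P [set w | v < W w])%:E)%E.
Proof.
move=> mW mk k0 W0 kh.
pose GR := measurableTypeR R.
pose A := [set p : T * GR | 0 <= p.2 < W p.1].
pose f (p : T * GR) : \bar R := (k p.2 * \1_A p)%:E.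
have mWp : measurable_fun [set: T * GR] (fun p => W p.1).
  by apply: measurableT_comp => //; exact: measurable_fst.
have msnd : measurable_fun [set: T * GR] (fun p => p.2 : R) by exact: measurable_snd.
have mA : measurable A.
  rewrite (_ : A = ([set: T * GR] `&` [set p : T * GR | cst 0 p <= p.2]) `&`
     [set p : T * GR | p.2 < W p.1]); last first.
    apply/seteqP; split => [p /andP[? ?]|p [[_ /= h1] /= h2]] //.
    by rewrite /A /= h1.
  by apply: measurableI; [exact: measurable_fun_le|exact: measurable_set_lt].
have mf : measurable_fun [set: T * GR] f.
  apply/measurable_EFinP; apply: measurable_funM; last exact: measurable_indic.
  exact: measurableT_comp.
have f0 p : (0 <= f p)%E.
  rewrite lee_fin indicE; case: (boolP (p \in A)) => [|_]; last by rewrite mulr0.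
  by rewrite inE /A/= mulr1 => /andP[h1 _]; exact: k0.
transitivity (\int[P]_w \int[mu]_v f (w, v))%E.
  apply: eq_integral => w _; rewrite -kh// integral_mkcond.
  apply: eq_integral => v _; rewrite patchE /f indicE /=.
  have -> : (v \in `[0%R, W w[%classic) = ((w, v) \in A).
    by apply/idP/idP; rewrite !inE /A /= ?in_itv.
  by case: ifP => _; rewrite ?mulr1 ?mulr0.
rewrite (fubini_tonelli f mf f0).
rewrite [in RHS]integral_mkcond; apply: eq_integral => v _; rewrite patchE.
have mB : measurable [set w | v < W w] by exact: measurable_set_lt.
case: ifPn => [|]; last first.
  rewrite notin_setE /= in_itv/= andbT => v0; apply: integral0_eq => w _.
  by rewrite /f indicE memNset ?mulr0// /A /= => /andP[/v0].
move=> /set_mem /=; rewrite in_itv/= andbT => v0.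
rewrite EFinM -probE//.
transitivity (\int[P]_w ((k v)%:E * (\1_[set w | v < W w] w)%:E))%E.
  apply: eq_integral => w _; rewrite /f EFinM; congr (_ * (_)%:E)%E.
  rewrite !indicE; congr (nat_of_bool _)%:R.
  by apply/idP/idP; rewrite !inE /A /= v0.
rewrite ge0_integralZl//.
- by rewrite integral_indic// setIT.
- by apply/measurable_EFinP; exact: measurable_indic.
- by rewrite lee_fin; exact: k0.
Qed.

End layer_cake.

(** * Monotone tails regularly varying of index -1 and their integrals *)

Section regular_tail.
Context {R : realType}.
Local Notation mu := (@lebesgue_measure R).

Lemma cvg_near (I : Type) (F : set_system I) (f : I -> R) (a e : R) :
  Filter F -> f i @[i --> F] --> a -> 0 < e -> \forall i \near F, a - e < f i < a + e.
Proof.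
move=> FF fa e0; have h := cvgr_dist_lt _ _ fa _ e0; near=> i.
have : `|a - f i| < e by near: i; exact: h.
by rewrite distrC ltr_norml => /andP[? ?]; apply/andP; split; lra.
Unshelve. all: by end_near. Qed.

Lemma near_cvg (I : Type) (F : set_system I) (f : I -> R) (a : R) : Filter F ->
  (forall e, 0 < e -> \forall i \near F, a - e <= f i <= a + e) -> f i @[i --> F] --> a.
Proof.
move=> FF h; apply/cvgrPdist_le => e e0; have he := h _ e0; near=> i.
have /andP[? ?] : a - e <= f i <= a + e by near: i; exact: he.
by rewrite distrC ler_norml; apply/andP; split; lra.
Unshelve. all: by end_near. Qed.

Lemma cvg_near_eq (I : Type) (F : set_system I) (f g : I -> R) (a : R) : Filter F ->
  (\forall i \near F, f i = g i) -> f i @[i --> F] --> a -> g i @[i --> F] --> a.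
Proof.
move=> FF fg fa; apply: near_cvg => e e0; have h := cvg_near _ fa e0; near=> i.
have <- : f i = g i by near: i; exact: fg.
have /andP[? ?] : a - e < f i < a + e by near: i; exact: h.
by apply/andP; split; apply: ltW.
Unshelve. all: by end_near. Qed.

Variable b : R -> R.
Hypothesis b_gt0 : forall x, 0 < b x.
Hypothesis b_le1 : forall x, b x <= 1.
Hypothesis b_noninc : forall x y, x <= y -> b y <= b x.
Hypothesis b_rv : forall c, 0 < c -> b (c * x) / b x @[x --> +oo] --> c^-1.


Lemma powR_ltr (a p q : R) : 1 < a -> p < q -> a `^ p < a `^ q.
Proof.
move=> a1 pq; have a0 : a != 0 by rewrite gt_eqF//; lra.
by rewrite /powR (negbTE a0) ltr_expR ltr_pM2r// ln_gt0.
Qed.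

Lemma powR_le_base (p x y : R) : 0 <= p -> 0 <= x -> x <= y -> x `^ p <= y `^ p.
Proof.
by move=> p0 x0 xy; apply: ge0_ler_powR => //; rewrite nnegrE//; exact: le_trans xy.
Qed.

(** One side of Potter's bound. As b(2 v) / b(v) -> 1/2 > 2^(-p), v^p b(v) does not decrease under
    doubling once v >= x0. Doublings lead from u to within a factor 2 of x, and monotonicity of b
    covers the rest at the cost of t = 2^p. *)
Lemma tail_comparison (p : R) : 1 < p -> exists C : R, 0 < C /\ exists x0 : R, 0 < x0 /\
  forall u x, 0 < u -> u <= x -> x0 <= x -> u `^ p * b u <= C * (x `^ p * b x).
Proof.
move=> p1.
have p0 : 0 <= p by lra.
have pow_le (x y : R) : 0 <= x -> x <= y -> x `^ p <= y `^ p by exact: powR_le_base.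
set t := 2 `^ p.
have t2 : 2 < t by rewrite -[ltLHS]powRr1//; apply: powR_ltr => //; rewrite ltr1n.
have t0 : 0 < t by lra.
have [x0 [x00 dbl]] : exists x0 : R, 0 < x0 /\ forall v, x0 <= v ->
    v `^ p * b v <= (2 * v) `^ p * b (2 * v).
  have e0 : 0 < 2^-1 - t^-1 by rewrite subr_gt0 ltf_pV2 ?posrE.
  have [x1 [x1r h]] := cvg_near _ (b_rv (ltr0n _ 2)) e0.
  exists (Num.max (x1 + 1) 1); split; first by rewrite lt_max ltr01 orbT.
  move=> v; rewrite ge_max => /andP[v1 v2].
  have /h /andP[h1 _] : x1 < v by lra.
  have v0 : 0 <= v by lra.
  rewrite powRM// -/t -mulrA [leRHS]mulrCA ler_wpM2l ?powR_ge0//.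
  move: h1; rewrite opprB addrC subrK ltr_pdivlMr// ltr_pdivrMl// => h1.
  exact: ltW.
have big k : forall u x, x0 <= u -> u <= x -> x <= 2 ^+ k * u ->
    u `^ p * b u <= t * (x `^ p * b x).
  elim: k => [|k ih] u x u0 ux xk.
    have -> : u = x by apply/eqP; rewrite eq_le ux -[leRHS]mul1r.
    rewrite -[leLHS]mul1r ler_wpM2r ?mulr_ge0 ?powR_ge0 ?(ltW (b_gt0 _))//; lra.
  have up : 0 < u by lra.
  apply: le_trans (dbl u u0) _.
  have [x2|x2] := leP x (2 * u).
    have u1 := ltW up; have t1 := ltW t0; have x1 := ltW (lt_le_trans up ux).
    rewrite powRM// -/t -!mulrA ler_wpM2l//.
    by rewrite ler_pM ?powR_ge0 ?(ltW (b_gt0 _)) ?pow_le ?b_noninc.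
  by apply: ih; [lra|exact: ltW|rewrite mulrA -exprSr].
have dyad u x : x0 <= u -> u <= x -> u `^ p * b u <= t * (x `^ p * b x).
  move=> u0 ux; have up : 0 < u by lra.
  apply: (big (Num.trunc (x / u)).+1) => //.
  have h : x / u <= (Num.trunc (x / u)).+1%:R by exact/ltW/truncnS_gt.
  rewrite -ler_pdivrMr//; apply: le_trans h _.
  by rewrite -natrX ler_nat ltnW// ltn_expl.
have K0 : 0 < x0 `^ p * b x0 by rewrite mulr_gt0 ?powR_gt0.
(* The summand t / b(x0) is for u < x0, where b <= 1 gives u^p b(u) <= x0^p and x0 is then compared
   with x. *)
exists (t * (1 + (b x0)^-1)); split.
  by rewrite mulr_gt0// addr_gt0// invr_gt0.
exists x0; split => // u x u0 ux x0x.
have rhs0 : 0 <= x `^ p * b x by rewrite mulr_ge0 ?powR_ge0 ?(ltW (b_gt0 _)).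
have [xu|ux0] := leP x0 u.
  apply: le_trans (dyad _ _ xu ux) _; rewrite ler_wpM2r// -[leLHS]mulr1 ler_wpM2l ?(ltW t0)//.
  by rewrite lerDl invr_ge0 ltW.
apply: (@le_trans _ _ (x0 `^ p)).
  rewrite -[leRHS]mulr1 ler_pM ?powR_ge0 ?(ltW (b_gt0 _)) ?pow_le//; exact: ltW.
have h := dyad _ _ (lexx x0) x0x.
have : x0 `^ p <= t * (x `^ p * b x) / b x0 by rewrite ler_pdivlMr.
move=> /le_trans; apply; rewrite mulrAC ler_wpM2r// ler_wpM2l ?ltW//.
by rewrite ltrDr.
Qed.

(** Uniform convergence on compact sets of ratios: near a given c, monotonicity squeezes b(c' x)
    between b((c - h) x) and b((c + h) x), and compactness of [m, M] leaves finitely many such c. *)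
Lemma uniform_tail_ratio (m M eps : R) : 0 < m -> 0 < eps ->
  \forall x \near +oo, forall c, m <= c <= M -> 1 - eps <= c * (b (c * x) / b x) <= 1 + eps.
Proof.
move=> m0 e0.
suff : \forall x \near +oo, `[m, M] `<=`
    [set c | 1 - eps <= c * (b (c * x) / b x) <= 1 + eps].
  by apply: filterS => x h c mc; apply: h; rewrite /= in_itv.
have /compact_near_coveringP cov := @segment_compact R m M.
apply: cov => c /=; rewrite in_itv/= => /andP[mc cM].
have c0 : 0 < c by lra.
(* c'/(c-h) and c'/(c+h) are close to 1 for |c'-c| < h small *)
have [h [h0 [hc [hup hlo]]]] : exists h, 0 < h /\ h < c /\
    (c + h) * ((c - h)^-1 + h) <= 1 + eps /\ 1 - eps <= (c - h) * ((c + h)^-1 - h).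
  have cv1 : (c + h) * ((c - h)^-1 + h) @[h --> (0 : R)] --> (c + 0) * ((c - 0)^-1 + 0).
    apply: cvgM; first by apply: cvgD; [exact: cvg_cst|exact: cvg_id].
    apply: cvgD; last exact: cvg_id.
    apply: cvgV; first by rewrite subr0 gt_eqF.
    by apply: cvgB; [exact: cvg_cst|exact: cvg_id].
  have cv2 : (c - h) * ((c + h)^-1 - h) @[h --> (0 : R)] --> (c - 0) * ((c + 0)^-1 - 0).
    apply: cvgM; first by apply: cvgB; [exact: cvg_cst|exact: cvg_id].
    apply: cvgB; last exact: cvg_id.
    apply: cvgV; first by rewrite addr0 gt_eqF.
    by apply: cvgD; [exact: cvg_cst|exact: cvg_id].
  rewrite !(addr0, subr0) mulfV ?gt_eqF// in cv1 cv2.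
  near (0 : R)^'+ => h; exists h; split; first by near: h; exact: nbhs_right_gt.
  split; first by near: h; exact: nbhs_right_lt.
  have /andP[_ h1] : 1 - eps < (c + h) * ((c - h)^-1 + h) < 1 + eps.
    by near: h; apply: (cvg_near _ (cvg_at_right_filter cv1) e0).
  have /andP[h2 _] : 1 - eps < (c - h) * ((c + h)^-1 - h) < 1 + eps.
    by near: h; apply: (cvg_near _ (cvg_at_right_filter cv2) e0).
  by split; apply: ltW.
have cmh0 : 0 < c - h by lra.
have cph0 : 0 < c + h by lra.
have nlo := cvg_near _ (b_rv cmh0) h0.
have nhi := cvg_near _ (b_rv cph0) h0.
near=> c' x => /=.
have x0 : 0 < x by near: x; exact: nbhs_pinfty_gt.
have cc' : `|c - c'| < h by near: c'; apply: (cvgr_dist_lt _ _ (@cvg_id _ _)).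
have /andP[_ r1] : (c - h)^-1 - h < b ((c - h) * x) / b x < (c - h)^-1 + h by near: x; exact: nlo.
have /andP[r2 _] : (c + h)^-1 - h < b ((c + h) * x) / b x < (c + h)^-1 + h by near: x; exact: nhi.
move: cc'; rewrite ltr_norml => /andP[cc1 cc2].
have q0 : 0 < b (c' * x) / b x by rewrite divr_gt0.
have q1 : b (c' * x) / b x <= b ((c - h) * x) / b x.
  rewrite ler_wpM2r ?invr_ge0 ?(ltW (b_gt0 _))//; apply: b_noninc; rewrite ler_wpM2r ?(ltW x0)//; lra.
have q2 : b ((c + h) * x) / b x <= b (c' * x) / b x.
  rewrite ler_wpM2r ?invr_ge0 ?(ltW (b_gt0 _))//; apply: b_noninc; rewrite ler_wpM2r ?(ltW x0)//; lra.
apply/andP; split.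
  apply: le_trans hlo _.
  apply: (@le_trans _ _ ((c - h) * (b (c' * x) / b x))).
    by rewrite ler_wpM2l ?(ltW cmh0)//; lra.
  by rewrite ler_wpM2r ?(ltW q0)//; lra.
apply: le_trans hup; apply: ler_pM; lra.
Unshelve. all: by end_near. Qed.

Definition tail_integral (x : R) : R := \int[mu]_(u in `]0, x]) b u.
Local Notation G := tail_integral.

Lemma measurable_tail : measurable_fun [set: R] b.
Proof.
by apply: nonincreasing_measurable => // x y; exact: b_noninc.
Qed.

Lemma integrable_tail (x : R) : mu.-integrable `]0, x] (EFin \o b).
Proof.
apply: measurable_bounded_integrable => //.
- by rewrite /= lebesgue_measure_itv /=; case: ifP => _; rewrite -?EFinD ltry.
- by apply: measurable_funTS; exact: measurable_tail.
- exists 1; split; first exact: num_real.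
  by move=> M M1 u _; rewrite /= ger0_norm ?(ltW (b_gt0 _))//; apply: le_trans (b_le1 _) (ltW M1).
Qed.

Lemma tail_integral_diff (x y : R) : 0 <= x -> x <= y ->
  (y - x) * b y <= G y - G x <= (y - x) * b x.
Proof.
move=> x0 xy; have := @Rintegral_itvB R b (BRight 0) (BRight y) x (integrable_tail y).
rewrite !bnd_simp => /(_ x0 xy); rewrite -/(G y) -/(G x) => ->.
have len : fine (mu `]x, y]) = y - x.
  by rewrite lebesgue_measure_itv /= lte_fin; case: ltgtP xy => //= -> _; rewrite subrr.
have int : mu.-integrable `]x, y] (EFin \o b).
  by apply: integrableS (integrable_tail y) => //; apply: subset_itvr; rewrite bnd_simp.
have intc (c : R) : mu.-integrable `]x, y] (EFin \o cst c).
  apply: measurable_bounded_integrable => //.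
    by rewrite /= lebesgue_measure_itv /=; case: ifP => _; rewrite -?EFinD ltry.
  by exists `|c|; split; [exact: num_real|move=> M /ltW M1 u _].
rewrite mulrC -len -Rintegral_cst// [X in _ && (_ <= X)]mulrC -Rintegral_cst//.
have := intc (b x); have := intc (b y) => icy icx.
by apply/andP; split; apply: le_Rintegral => // u; rewrite /= in_itv/= => /andP[/ltW xu uy];
  exact: b_noninc.
Qed.

Lemma tail_integral0 : G 0 = 0.
Proof. by rewrite /tail_integral set_itvoc0 Rintegral_set0. Qed.

Lemma tail_integral_homo (x y : R) : 0 <= x -> x <= y -> G x <= G y.
Proof.
move=> x0 xy; have /andP[h _] := tail_integral_diff x0 xy.
rewrite -subr_ge0; apply: le_trans h; rewrite mulr_ge0 ?subr_ge0//; exact: ltW.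
Qed.

Lemma tail_integral_gt0 (x : R) : 0 < x -> 0 < G x.
Proof.
move=> x0; have /andP[h _] := tail_integral_diff (lexx 0) (ltW x0).
by move: h; rewrite tail_integral0 !subr0; apply: lt_le_trans; rewrite mulr_gt0.
Qed.

(* Each halving of x adds about x b(x) / 2 to the integral. *)
Lemma tail_negligible_pre (n : nat) :
  \forall x \near +oo, n%:R / 4 * (x * b x) <= G x.
Proof.
elim: n => [|n ih].
  near=> x; rewrite !mul0r; apply/ltW/tail_integral_gt0; near: x; exact: nbhs_pinfty_gt.
have half0 : 0 < 2^-1 :> R by rewrite invr_gt0.
(* With q = 1 / (4 (n + 1)), replacing b(x / 2) by (2 - 2 q) b(x) loses at most n q / 4 <= 1/16
   times x b(x). The last half contributes 1/2 where only 1/4 is asked. *)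
have e0 : 0 < 2 * (4 * (n%:R + 1))^-1 :> R.
  by rewrite mulr_gt0// invr_gt0 mulr_gt0// ltr_wpDl.
have nr := cvg_near _ (b_rv half0) e0; rewrite invrK in nr.
have ih2 : \forall x \near +oo, n%:R / 4 * (x / 2 * b (x / 2)) <= G (x / 2).
  have : x / 2 @[x --> +oo] --> (+oo : set_system R).
    by apply: gt0_cvgMly => //; exact: cvg_id.
  by move=> /(_ _ ih).
near=> x.
have x0 : 0 < x by near: x; exact: nbhs_pinfty_gt.
have /andP[r1 _] : 2 - 2 * (4 * (n%:R + 1))^-1 < b (2^-1 * x) / b x <
    2 + 2 * (4 * (n%:R + 1))^-1 by near: x; exact: nr.
have i2 : n%:R / 4 * (x / 2 * b (x / 2)) <= G (x / 2) by near: x; exact: ih2.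
have x20 : 0 <= x / 2 by rewrite divr_ge0// ltW.
have xx2 : x / 2 <= x by lra.
have /andP[i3 _] := tail_integral_diff x20 xx2.
move: r1; rewrite ltr_pdivlMr// [_^-1 * x]mulrC => r1.
set B := b (x / 2) in r1 i2 i3 *; set D := b x in r1 i3 *.
have D0 : 0 < D by exact: b_gt0.
set q := (4 * (n%:R + 1))^-1 in r1.
have q1 : n%:R * q <= 4^-1.
  rewrite /q invfM mulrCA ler_piMr ?invr_ge0// ler_pdivrMr ?mul1r ?lerDl// ltr_wpDl//.
have n0 : 0 <= n%:R :> R by [].
have h1 : n%:R / 4 * (x / 2 * ((2 - 2 * q) * D)) <= n%:R / 4 * (x / 2 * B).
  by rewrite !ler_wpM2l// ?divr_ge0// ltW.
have h2 : n%:R * q * (x * D) <= 4^-1 * (x * D) by rewrite ler_wpM2r// mulr_ge0 ?ltW.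
have xD : 0 <= x * D by rewrite mulr_ge0 ?ltW.
rewrite -natr1.
nra.
Unshelve. all: by end_near. Qed.


(** The factor n / 4 in the previous bound is arbitrarily large. This is Karamata's theorem at the
    critical index. *)
Lemma tail_negligible (eps : R) : 0 < eps -> \forall x \near +oo, x * b x <= eps * G x.
Proof.
move=> e0; pose n := (Num.trunc (4 / eps)).+1.
have hn : 4 / eps <= n%:R by exact/ltW/truncnS_gt.
near=> x.
have x0 : 0 < x by near: x; exact: nbhs_pinfty_gt.
have h : n%:R / 4 * (x * b x) <= G x by near: x; exact: tail_negligible_pre.
apply: le_trans (_ : eps * (n%:R / 4 * (x * b x)) <= _); last by rewrite ler_wpM2l// ltW.
rewrite mulrA ler_peMl ?mulr_ge0 ?(ltW x0) ?(ltW (b_gt0 _))//.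
by rewrite mulrA ler_pdivlMr// mul1r mulrC -ler_pdivrMr.
Unshelve. all: by end_near. Qed.

(** For k >= 1 the increment G(k x) - G(x) is at most (k - 1) x b(x), negligible against G(x). For c
    < 1 the ratio is the inverse of the one for 1 / c, taken at c x. *)
Lemma tail_integral_slow (c : R) : 0 < c -> G (c * x) / G x @[x --> +oo] --> (1 : R).
Proof.
have ge1 k : 1 <= k -> G (k * x) / G x @[x --> +oo] --> (1 : R).
  move=> k1; apply: near_cvg => e e0.
  have e1 : 0 < e / k by rewrite divr_gt0//; lra.
  near=> x.
  have x0 : 0 < x by near: x; exact: nbhs_pinfty_gt.
  have G0 := tail_integral_gt0 x0.
  have xkx : x <= k * x by rewrite ler_peMl// ltW.
  have h : x * b x <= e / k * G x by near: x; exact: tail_negligible.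
  have /andP[_ d2] := tail_integral_diff (ltW x0) xkx.
  have d1 := tail_integral_homo (ltW x0) xkx.
  have : k * (x * b x) <= e * G x.
    by move: h; rewrite mulrAC ler_pdivlMr ?(lt_le_trans ltr01)// mulrC.
  have xb0 : 0 < x * b x by rewrite mulr_gt0.
  move=> h2; rewrite ler_pdivlMr// ler_pdivrMr//; apply/andP; split; nra.
move=> c0; have [c1|c1] := leP 1 c; first exact: ge1.
have ci1 : 1 <= c^-1 by rewrite invf_ge1// ltW.
have h : (G (c^-1 * y) / G y)^-1 @[y --> +oo] --> (1 : R).
  by rewrite -[X in _ --> X]invr1; apply: cvgV => //; exact: ge1.
have hc : c * x @[x --> +oo] --> (+oo : set_system R).
  by apply: gt0_cvgMry => //; exact: cvg_id.
have := cvg_comp _ _ hc h.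
apply: cvg_trans; apply: near_eq_cvg; near=> x => /=.
by rewrite mulKf ?gt_eqF// invf_div.
Unshelve. all: by end_near. Qed.

(** Slow variation makes one doubling of x cost at most a factor 2^eta beyond x0, exactly the growth
    of x^eta; iterating the doublings gives the bound. *)
Lemma tail_integral_le_pow (eta : R) : 0 < eta ->
  exists C : R, 0 < C /\ \forall x \near +oo, G x <= C * x `^ eta.
Proof.
move=> eta0; set t := 2 `^ eta.
have t1 : 1 < t by rewrite -[ltLHS](powRr0 2); apply: powR_ltr => //; rewrite ltr1n.
have e0 : 0 < t - 1 by rewrite subr_gt0.
have [x1 [x1r h]] := cvg_near _ (tail_integral_slow (ltr0n _ 2)) e0.
pose x0 := Num.max (x1 + 1) 1.
have x01 : 1 <= x0 by rewrite le_max lexx orbT.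
have x0x : x1 + 1 <= x0 by rewrite le_max lexx.
have x00 : 0 < x0 by lra.
have dbl v : x0 <= v -> G (2 * v) <= t * G v.
  move=> vx; have /h /andP[_] : x1 < v by lra.
  have v0 : 0 < v by lra.
  rewrite addrC subrK ltr_pdivrMr ?tail_integral_gt0// => hh; exact: ltW.
pose C := G (2 * x0) / x0 `^ eta.
have C0 : 0 < C by rewrite divr_gt0 ?powR_gt0 ?tail_integral_gt0// mulr_gt0.
have pow_le (x y : R) : 0 <= x -> x <= y -> x `^ eta <= y `^ eta.
  exact/powR_le_base/ltW.
have big k : forall x, x0 <= x -> x <= 2 ^+ k * (2 * x0) -> G x <= C * x `^ eta.
  elim: k => [|k ih] x xx0 xk.
    apply: (@le_trans _ _ (G (2 * x0))).
      apply: tail_integral_homo; first by lra.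
      by rewrite expr0 mul1r in xk.
    rewrite -[leLHS](divfK (_ : x0 `^ eta != 0)) ?gt_eqF ?powR_gt0// -/C.
    by rewrite ler_wpM2l ?(ltW C0)// pow_le// ltW.
  have [x2|x2] := leP x (2 * x0); first (apply: (ih x) => //;
    by apply: le_trans x2 _; rewrite ler_peMl ?exprn_ege1 ?ler1n// mulr_ge0 ?(ltW x00)).
  have xe : x = 2 * (x / 2) by lra.
  rewrite [in G x]xe; apply: le_trans (dbl _ _) _; first by lra.
  have -> : C * x `^ eta = t * (C * (x / 2) `^ eta).
    by rewrite {1}xe powRM//; [rewrite mulrCA|lra].
  rewrite ler_wpM2l ?(ltW (lt_trans ltr01 t1))//; apply: ih; first by lra.
  by move: xk; rewrite exprS; lra.
exists C; split => //; near=> x.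
have xx : x0 <= x by near: x; apply: nbhs_pinfty_ge; exact: num_real.
apply: (big (Num.trunc (x / (2 * x0))).+1) => //.
have h2 : x / (2 * x0) <= (Num.trunc (x / (2 * x0))).+1%:R by exact/ltW/truncnS_gt.
rewrite -ler_pdivrMr ?mulr_gt0//; apply: le_trans h2 _.
by rewrite -natrX ler_nat ltnW// ltn_expl.
Unshelve. all: by end_near. Qed.

(* With n ~ 1/b(alpha) and beta ~ n G(beta), the bounds alpha^(6/5) >= c n and
   beta^(4/5) <= C n give (beta / alpha)^2 / n = O(n^(-1/6)). *)
Lemma normalization_ratio (I : Type) (F : set_system I) (n alpha beta : I -> R) :
  Filter F -> (forall i, 0 <= n i) ->
  n i @[i --> F] --> +oo -> alpha i @[i --> F] --> +oo -> beta i @[i --> F] --> +oo ->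
  n i * b (alpha i) @[i --> F] --> (1 : R) ->
  n i * G (beta i) / beta i @[i --> F] --> (1 : R) ->
  (beta i / alpha i) ^+ 2 / n i @[i --> F] --> (0 : R).
Proof.
move=> FF n0 noo aoo boo nb nG.
have p65 : 1 < 6 / 5 :> R by lra.
have [C1 [C10 [x0 [x00 hC1]]]] := tail_comparison p65.
have e15 : 0 < 1 / 5 :> R by lra.
have [C2 [C20 hC2]] := tail_integral_le_pow e15.
have e12 : 0 < 2^-1 :> R by lra.
have hnb := cvg_near _ nb e12; have hnG := cvg_near _ nG e12.
pose K0 := x0 `^ (6 / 5) * b x0.
have K00 : 0 < K0 by rewrite mulr_gt0 ?powR_gt0.
pose ca := K0 / (2 * C1); have ca0 : 0 < ca by rewrite divr_gt0// mulr_gt0.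
(* Below, alpha^2 >= ca^(5/3) n^(5/3) and beta^2 <= (2 C2)^(5/2) n^(5/2), hence (beta / alpha)^2 / n
   <= K n^(-1/6), which is at most e once n exceeds (K / e)^6. *)
pose K := (2 * C2) `^ (5 / 2) / ca `^ (5 / 3).
have K1 : 0 < K by rewrite divr_gt0 ?powR_gt0// mulr_gt0.
have bC2 : \forall i \near F, G (beta i) <= C2 * beta i `^ (1 / 5) by exact: (boo _ hC2).
have ngt x : \forall i \near F, x < n i by apply: (noo [set y | x < y]); apply: nbhs_pinfty_gt; exact: num_real.
have agt x : \forall i \near F, x < alpha i by apply: (aoo [set y | x < y]); apply: nbhs_pinfty_gt; exact: num_real.
have bgt x : \forall i \near F, x < beta i by apply: (boo [set y | x < y]); apply: nbhs_pinfty_gt; exact: num_real.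
apply: near_cvg => e e0.
near=> i.
have ni : (K / e) `^ 6 < n i by near: i; exact: ngt.
have ni0 : 0 < n i by near: i; exact: ngt.
have ai : x0 < alpha i by near: i; exact: agt.
have bi : 0 < beta i by near: i; exact: bgt.
have ai0 : 0 < alpha i by lra.
have /andP[_ h1] : 1 - 2^-1 < n i * b (alpha i) < 1 + 2^-1 by near: i; exact: hnb.
have /andP[h2 _] : 1 - 2^-1 < n i * G (beta i) / beta i < 1 + 2^-1 by near: i; exact: hnG.
have h3 : G (beta i) <= C2 * beta i `^ (1 / 5) by near: i; exact: bC2.
(* Taking u = x0 turns the comparison into a lower bound of alpha^(6/5) b(alpha); together with n
   b(alpha) <= 2 it bounds alpha^(6/5) below by a multiple of n. *)
have h4 := hC1 x0 (alpha i) x00 (ltW ai) (ltW ai).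
have pow_le := powR_le_base.
have A1 : ca * n i <= alpha i `^ (6 / 5).
  have : n i * K0 <= C1 * (alpha i `^ (6 / 5) * 2).
    apply: le_trans (_ : n i * (C1 * (alpha i `^ (6 / 5) * b (alpha i))) <= _).
      by rewrite ler_wpM2l// ltW.
    rewrite mulrCA ler_wpM2l ?(ltW C10)// mulrCA ler_wpM2l ?powR_ge0//; lra.
  rewrite /ca mulrAC ler_pdivrMr ?mulr_gt0//; lra.
have B1 : beta i `^ (4 / 5) <= 2 * C2 * n i.
  have eb : beta i = beta i `^ (4 / 5) * beta i `^ (1 / 5).
    rewrite -powRD; last by rewrite gt_eqF ?implybT// gt_eqF.
    by rewrite -[LHS]powRr1 ?(ltW bi)//; congr (_ `^ _); lra.
  have q0 : 0 < beta i `^ (1 / 5) by rewrite powR_gt0.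
  rewrite -(ler_pM2r q0) -eb.
  have : beta i <= 2 * (n i * G (beta i)) by move: h2; rewrite ltr_pdivlMr//; lra.
  move=> /le_trans; apply; rewrite -!mulrA ler_wpM2l// mulrCA ler_wpM2l// ltW//.
have A2 : ca `^ (5 / 3) * n i `^ (5 / 3) <= alpha i ^+ 2.
  have -> : alpha i ^+ 2 = (alpha i `^ (6 / 5)) `^ (5 / 3).
    by rewrite -powRrM -powR_mulrn ?(ltW ai0)//; congr (_ `^ _); lra.
  rewrite -powRM ?(ltW ca0) ?(ltW ni0)//; apply: pow_le => //.
  by rewrite mulr_ge0 ?(ltW ca0) ?(ltW ni0).
have B2 : beta i ^+ 2 <= (2 * C2) `^ (5 / 2) * n i `^ (5 / 2).
  have -> : beta i ^+ 2 = (beta i `^ (4 / 5)) `^ (5 / 2).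
    by rewrite -powRrM -powR_mulrn ?(ltW bi)//; congr (_ `^ _); lra.
  rewrite -powRM ?(ltW ni0) ?mulr_ge0 ?(ltW C20)//; apply: pow_le => //.
  exact: powR_ge0.
have N1 : n i `^ (5 / 2) * n i `^ (1 / 6) = n i `^ (5 / 3) * n i.
  rewrite -[X in _ = _ * X]powRr1 ?(ltW ni0)// -!powRD ?(gt_eqF ni0) ?implybT//.
  by congr (_ `^ _); lra.
have N2 : K / e <= n i `^ (1 / 6).
  have -> : K / e = ((K / e) `^ 6) `^ (1 / 6).
    rewrite -powRrM (_ : 6 * (1 / 6) = 1); last by lra.
    by rewrite powRr1// divr_ge0 ?(ltW K1)// ltW.
  by apply: pow_le; [|exact: powR_ge0|exact: ltW].
have pos2 : 0 <= (beta i / alpha i) ^+ 2 / n i by rewrite divr_ge0// sqr_ge0.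
apply/andP; split; first by lra.
rewrite add0r expr_div_n ler_pdivrMr// ler_pdivrMr ?exprn_gt0//.
apply: le_trans B2 _.
have N3 : 0 < n i `^ (5 / 2) by rewrite powR_gt0.
have ca2 : 0 < ca `^ (5 / 3) by rewrite powR_gt0.
apply: (@le_trans _ _ (e * n i * (ca `^ (5 / 3) * n i `^ (5 / 3)))); last first.
  by rewrite ler_wpM2l// mulr_ge0// ltW.
have -> : e * n i * (ca `^ (5 / 3) * n i `^ (5 / 3)) =
    e * n i `^ (1 / 6) * ca `^ (5 / 3) * n i `^ (5 / 2).
  have -> : e * n i * (ca `^ (5 / 3) * n i `^ (5 / 3)) =
      e * ca `^ (5 / 3) * (n i `^ (5 / 3) * n i) by ring.
  by rewrite -N1; ring.
rewrite ler_wpM2r ?(ltW N3)//.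
have -> : (2 * C2) `^ (5 / 2) = K * ca `^ (5 / 3) by rewrite /K divfK ?gt_eqF.
by rewrite ler_wpM2r ?(ltW ca2)// mulrC -ler_pdivrMr.
Unshelve. all: by end_near. Qed.

End regular_tail.

(** * The Gaussian distribution function and an integral with a quartic exponent *)

Section gaussian.
Context {R : realType}.
Local Notation mu := (@lebesgue_measure R).
Local Notation phi := (@normal_pdf R 0 1).

Definition gauss_cdf (x : R) : R := \int[mu]_(t in `]-oo, x]) phi t.
Local Notation Phi := gauss_cdf.

Lemma std_normal_pdfE (x : R) : phi x = normal_peak 1 * expR (- (x ^+ 2 / 2)).
Proof.
rewrite /normal_pdf (negbTE (oner_neq0 _)) /normal_fun subr0 expr1n.
by rewrite mulNr.
Qed.

Lemma continuous_std_normal_pdf : continuous phi.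
Proof. by apply: continuous_normal_pdf; rewrite oner_eq0. Qed.

Lemma is_derive_gauss_cdf (x : R) : is_derive x 1 Phi (phi x).
Proof.
have int : mu.-integrable [set` Interval -oo%O (BRight (x + 1))] (EFin \o phi).
  by apply: integrableS (integrable_normal_pdf 0 1).
have xx : x < x + 1 by rewrite ltrDl.
have [D1 D2] := @continuous_FTC1 R phi -oo%O x (x + 1) xx int (ltNyr x)
  (@continuous_std_normal_pdf x).
by apply: (DeriveDef D1); rewrite -derive1E.
Qed.

Lemma gauss_cdfE (x : R) : normal_prob 0 1 `]-oo, x] = (Phi x)%:E.
Proof.
rewrite /normal_prob /gauss_cdf /Rintegral fineK//.
by apply: integrable_fin_num => //; apply: integrableS (integrable_normal_pdf 0 1).
Qed.

(** The identity as a random variable under the normal law: its [cdf] is [gauss_cdf], so the limits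
    of distribution functions at both infinities apply. *)
Let idTR : measurableTypeR R -> R := idfun.
#[local] HB.instance Definition _ :=
  @isMeasurableFun.Build _ _ _ _ idTR (@measurable_id _ _ setT).

Lemma gauss_cdf_cvgy : Phi x @[x --> +oo] --> (1 : R).
Proof.
have := @cvg_cdfy1 _ _ R (normal_prob 0 1) (idTR : {RV (normal_prob 0 1) >-> R}).
have -> : cdf (idTR : {RV (normal_prob 0 1) >-> R}) = EFin \o Phi.
  by apply/funext => x /=; rewrite -gauss_cdfE.
by move=> /fine_cvgP[].
Qed.

Lemma gauss_cdf_cvgNy : Phi x @[x --> -oo] --> (0 : R).
Proof.
have := @cvg_cdfNy0 _ _ R (normal_prob 0 1) (idTR : {RV (normal_prob 0 1) >-> R}).
have -> : cdf (idTR : {RV (normal_prob 0 1) >-> R}) = EFin \o Phi.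
  by apply/funext => x /=; rewrite -gauss_cdfE.
by move=> /fine_cvgP[].
Qed.

Lemma gauss_cdf0 : Phi 0 = 2^-1.
Proof.
have h : (\int[mu]_x (phi x)%:E = 2%:E * \int[mu]_(x in [set x | (0 <= x)%R]) (phi x)%:E)%E.
  apply: ge0_symfun_integralT.
  - by move=> x; exact: normal_pdf_ge0.
  - exact: continuous_std_normal_pdf.
  - by move=> x; rewrite /= !std_normal_pdfE sqrrN.
have h2 := probability_setC (normal_prob 0 1) (measurable_itv `]-oo, (0:R)]).
move: h2; rewrite setCitvl /= gauss_cdfE /normal_prob.
rewrite integral_itv_obnd_cbnd; last first.
  by apply/measurable_EFinP; apply: measurable_funTS; exact: measurable_normal_pdf.
move: h; rewrite integral_normal_pdf (_ : [set x | 0 <= x] = `[0, +oo[%classic); last first.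
  by apply/seteqP; split => x/=; rewrite in_itv/= andbT.
set J := (\int[_]_(_ in _) _)%E => h1 h2.
move: h1; rewrite h2 -EFinB -EFinM => -[]; lra.
Qed.

(* Substituting s = v^2 in int_0^oo 2 r e^(-r s^2) ds = sqrt(pi r). *)
Lemma integral_quartic_gauss (r : R) : 0 < r ->
  (\int[mu]_(v in `[0%R, +oo[) (4 * r * v * expR (- (r * v ^+ 4)))%:E =
   (Num.sqrt (r * pi))%:E)%E.
Proof.
move=> r0.
(* The primitive is F(v) = c Phi(k v^2): k^2 = 2 r makes the Gaussian exponent equal to r v^4, and c
   adjusts the constant of the density. As v runs from 0 to infinity, F runs from c / 2 to c. *)
pose c : R := 2 * Num.sqrt (r * pi).
pose k : R := Num.sqrt (2 * r).
pose F (v : R) := c * Phi (k * v ^+ 2).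
have k0 : 0 < k by rewrite sqrtr_gt0 mulr_gt0.
have dF (v : R) : is_derive v 1 F (4 * r * v * expR (- (r * v ^+ 4))).
  have d1 : is_derive v (1 : R) (fun v : R => k * v ^+ 2) (k * (2 * v)).
    apply: is_derive_eq; change (k * (v * 1 + v * 1) = k * (2 * v)); ring.
  have d2 : is_derive v (1 : R) (fun v : R => Phi (k * v ^+ 2)) (phi (k * v ^+ 2) * (k * (2 * v))).
    have := @is_derive1_comp R Phi (fun v : R => k * v ^+ 2) v _ _ (is_derive_gauss_cdf _) d1.
    by [].
  have d3 : is_derive v (1 : R) F (c * (phi (k * v ^+ 2) * (k * (2 * v)))).
    by apply: is_deriveZ.
  apply: (is_derive_eq d3); rewrite std_normal_pdfE exprMn sqr_sqrtr; last by rewrite mulr_ge0// ltW.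
  rewrite -exprM (_ : 2 * r * v ^+ (2 * 2) / 2 = r * v ^+ 4); last by field.
  rewrite /normal_peak expr1n mul1r.
  have -> : c * ((Num.sqrt (pi *+ 2))^-1 * expR (- (r * v ^+ 4)) * (k * (2 * v))) =
    (2 * 2 * (Num.sqrt (r * pi) * k / Num.sqrt (pi *+ 2))) * v * expR (- (r * v ^+ 4)).
    by rewrite /c; ring.
  congr (_ * _ * _).
  rewrite /k -sqrtrM ?mulr_ge0 ?(ltW r0) ?pi_ge0//.
  have -> : r * pi * (2 * r) = r ^+ 2 * (pi *+ 2) by ring.
  rewrite sqrtrM ?sqr_ge0// sqrtr_sqr gtr0_norm// mulfK; first by ring.
  by rewrite gt_eqF// sqrtr_gt0 mulrn_wgt0// pi_gt0.
have Fl : F v @[v --> +oo] --> c.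
  rewrite -[X in _ --> X]mulr1; apply: cvgM; first exact: cvg_cst.
  have h : k * v ^+ 2 @[v --> +oo] --> (+oo : set_system R).
    by apply: gt0_cvgMry => //; exact: cvgr_expr2.
  exact: (cvg_comp _ _ h gauss_cdf_cvgy).
have cF (v0 : R) : {for v0, continuous F}.
  by apply: differentiable_continuous; apply/derivable1_diffP; case: (dF v0).
rewrite (@ge0_continuous_FTC2y R _ F 0 c).
- rewrite /F expr0n /= mulr0 gauss_cdf0 -EFinB; congr EFin; rewrite /c; lra.
- by move=> v v0; rewrite !mulr_ge0 ?(ltW r0) ?expR_ge0.
- apply: continuous_subspaceT => v; apply: cvgM.
    by apply: cvgM; [exact: cvg_cst|exact: cvg_id].
  apply: (@continuous_comp _ _ _ (fun v : R => - (r * v ^+ 4)) expR); last exact: continuous_expR.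
  by apply: cvgN; apply: cvgM; [exact: cvg_cst|exact: exprn_continuous].
- exact: Fl.
- by move=> v _; case: (dF v).
- exact: cvg_at_right_filter (cF 0).
- by move=> v _; rewrite derive1E; case: (dF v).
Qed.

End gaussian.

(** * Laplace transforms of one summand and of its square *)

Section tail_laplace.
Context {R : realType} {d : measure_display} {T : measurableType d}.
Variables (P : probability T R) (Z : T -> R).
Hypothesis mZ : measurable_fun [set: T] Z.
Hypothesis Z0 : forall w, 0 <= Z w.
Local Notation mu := (@lebesgue_measure R).

Definition tail (x : R) : R := prob P [set w | x < Z w].
Local Notation b := tail.
Local Notation G := (tail_integral b).

Lemma measurable_gt_cst (x : R) : measurable [set w | x < Z w].
Proof. exact: measurable_set_lt. Qed.

Lemma tail_le1 (x : R) : b x <= 1.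
Proof. exact/prob_le1/measurable_gt_cst. Qed.

Lemma tail_ge0 (x : R) : 0 <= b x. Proof. exact: prob_ge0. Qed.

Lemma tail_noninc (x y : R) : x <= y -> b y <= b x.
Proof.
move=> xy; apply: le_prob; [exact: measurable_gt_cst|exact: measurable_gt_cst|].
by move=> w /=; exact: le_lt_trans.
Qed.

Lemma integral_indic_ray (x z : R) : 0 <= z -> 0 <= x ->
  (\int[mu]_(v in `[0%R, z[) (\1_(`]-oo, x[%classic : set R) v)%:E = (Num.min z x)%:E)%E.
Proof.
move=> z0 x0; rewrite integral_indic//.
have -> : `]-oo, x[%classic `&` `[0, z[%classic = `[0, Num.min z x[%classic :> set R.
  apply/seteqP; split => v /=; rewrite !in_itv/= lt_min.
    by move=> [-> /andP[-> ->]].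
  by move=> /and3P[-> -> ->].
rewrite /= lebesgue_measure_itv/= lte_fin; case: ltP => [_|h].
  by rewrite sube0.
by congr EFin; apply/eqP; rewrite eq_le h le_min z0 x0.
Qed.

Hypothesis b_gt0 : forall x, 0 < b x.

(** Layer cake with the kernel 1 on v < x, whose primitive is min(z, x). *)
Lemma mean_min (x : R) : 0 < x -> mean P (fun w => Num.min (Z w) x) = G x.
Proof.
move=> x0.
have h := @layer_cake R d T P Z (\1_(`]-oo, x[%classic : set R)) (fun z => Num.min z x)
  mZ (@measurable_indic _ _ _ _ _ (measurable_itv _)) (fun v _ => ler0n _ _) Z0
  (fun z z0 => integral_indic_ray z0 (ltW x0)).
have mb := measurable_tail (fun x y => @tail_noninc x y).
have int := integrable_tail b_gt0 tail_le1 (fun x y => @tail_noninc x y) x.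
have into : mu.-integrable `]0, x[ (EFin \o b).
  by apply: integrableS int => //; apply: subset_itvl; rewrite bnd_simp.
rewrite /mean /tail_integral -Rintegral_itv_bndo_bndc//.
rewrite Rintegral_itv_obnd_cbnd// /Rintegral h.
rewrite (_ : `[0, x[%classic = `[0, +oo[%classic `&` `]-oo, x[%classic :> set R); last first.
  apply/seteqP; split => v /=; rewrite !in_itv/= ?andbT; first by move=> /andP[].
  by move=> [-> ->].
rewrite integral_mkcondr; congr fine; apply: eq_integral => v _.
by rewrite patchE indicE; case: ifP => _; rewrite ?mul1r ?mul0r.
Qed.

Hypothesis b_rv : forall c, 0 < c -> b (c * x) / b x @[x --> +oo] --> c^-1.

Lemma onem_expRN_ge (y : R) : 0 <= y -> y * (1 - y) <= 1 - expR (- y).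
Proof.
move=> y0; rewrite lerBrDl -lerBrDr expRN -[leLHS]mul1r ler_pdivrMr ?expR_gt0//.
have h := expR_ge1Dx y.
have [y1|y1] := leP y 1.
  apply: (@le_trans _ _ ((1 - y * (1 - y)) * (1 + y))); first nra.
  by rewrite ler_wpM2l//; nra.
apply: (@le_trans _ _ ((1 - y * (1 - y)) * 1)); first nra.
by rewrite ler_wpM2l//; nra.
Qed.

Lemma bounded_rv_min (x : R) : 0 <= x -> bounded_rv (fun w => Num.min (Z w) x).
Proof.
move=> x0; split; first exact: measurable_minr.
by exists x => w; rewrite ger0_norm ?le_min ?Z0// ge_min lexx orbT.
Qed.

Lemma bounded_rv_expR_div (s x : R) : 0 <= s -> 0 <= x ->
  bounded_rv (fun w => expR (- (s * (Z w / x)))).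
Proof.
move=> s0 x0; apply: bounded_rv_expRN => //.
  by apply: measurable_funM => //; exact: measurable_cst.
by move=> w; rewrite divr_ge0.
Qed.

(** 1 - e^(-y) lies between y (1 - y) and y. From above, truncation at beta gives (s / beta) G(beta)
    + b(beta), and b(beta) is negligible against G(beta) / beta. From below, truncation at the
    smaller level de * beta makes the quadratic loss at most a fraction s de, while slow variation
    keeps G(de * beta) equivalent to G(beta). *)
Lemma laplace_relative_stability (I : Type) (F : set_system I) (n beta : I -> R) (s : R) :
  Filter F -> (forall i, 0 <= n i) -> 0 < s ->
  beta i @[i --> F] --> +oo ->
  n i * G (beta i) / beta i @[i --> F] --> (1 : R) ->
  n i * (1 - mean P (fun w => expR (- (s * (Z w / beta i))))) @[i --> F] --> s.
Proof.
move=> FF n0 s0 boo nG; apply: near_cvg => e e0.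
have bgt x : \forall i \near F, x < beta i.
  by apply: (boo [set y | x < y]); apply: nbhs_pinfty_gt; exact: num_real.
(* Chosen so that s^2 de = e / 2: the lower bound then tends to s - e / 2. *)
pose de := e / (2 * s ^+ 2).
have de0 : 0 < de by rewrite divr_gt0// mulr_gt0// exprn_gt0.
have nGd : n i * G (de * beta i) / beta i @[i --> F] --> (1 : R).
  have c1 : G (de * beta i) / G (beta i) @[i --> F] --> (1 : R).
    have := tail_integral_slow b_gt0 tail_le1 (fun x y => @tail_noninc x y) b_rv de0.
    exact: cvg_comp.
  have nc := @cvgM _ _ F FF _ _ _ _ nG c1; rewrite mulr1 in nc; apply: (cvg_near_eq FF _ nc).
  near=> i.
  have bi : 0 < beta i by near: i; exact: bgt.
  have g0 : G (beta i) != 0.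
    by rewrite gt_eqF//; apply: (tail_integral_gt0 b_gt0 tail_le1 (fun x y => @tail_noninc x y)).
  by rewrite /GRing.mul_fun /=; field; rewrite g0 gt_eqF.
have low : (s - s ^+ 2 * de) * (n i * G (de * beta i) / beta i) @[i --> F] --> s - e / 2.
  have -> : s - e / 2 = (s - s ^+ 2 * de) * 1.
    by rewrite mulr1 /de; field; rewrite gt_eqF.
  by apply: cvgM => //; exact: cvg_cst.
have e2 : 0 < e / 2 by rewrite divr_gt0.
have nlow := cvg_near _ low e2.
have up : s * (n i * G (beta i) / beta i) @[i --> F] --> s * 1.
  by apply: cvgM => //; exact: cvg_cst.
rewrite mulr1 in up.
have nup := cvg_near _ up e2.
have e4 : 0 < e / 4 by rewrite divr_gt0.
have neg : \forall i \near F, beta i * b (beta i) <= e / 4 * G (beta i).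
  exact: (boo _ (tail_negligible b_gt0 tail_le1 (fun x y => @tail_noninc x y) b_rv e4)).
have n1 := cvg_near _ nG (@ltr01 R).
near=> i.
have bi : 0 < beta i by near: i; exact: bgt.
have /andP[l1 _] : s - e / 2 - e / 2 < (s - s ^+ 2 * de) * (n i * G (de * beta i) / beta i)
   < s - e / 2 + e / 2 by near: i; exact: nlow.
have /andP[_ u1] : s - e / 2 < s * (n i * G (beta i) / beta i) < s + e / 2.
  by near: i; exact: nup.
have ng : beta i * b (beta i) <= e / 4 * G (beta i) by near: i; exact: neg.
have /andP[_ n2] : 1 - 1 < n i * G (beta i) / beta i < 1 + 1 by near: i; exact: n1.
have bE := bounded_rv_expR_div (ltW s0) (ltW bi).
have bE1 : bounded_rv (fun w => 1 - expR (- (s * (Z w / beta i)))).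
  by apply: bounded_rvB => //; exact: bounded_rv_cst.
have -> : 1 - mean P (fun w => expR (- (s * (Z w / beta i)))) =
    mean P (fun w => 1 - expR (- (s * (Z w / beta i)))).
  by rewrite meanB ?mean_cst//; exact: bounded_rv_cst.
have db0 : 0 < de * beta i by rewrite mulr_gt0.
apply/andP; split.
  have : (s - s ^+ 2 * de) / beta i * G (de * beta i) <=
      mean P (fun w => 1 - expR (- (s * (Z w / beta i)))).
    rewrite -mean_min// -meanZ; last by apply: bounded_rv_min; exact: ltW.
    apply: le_mean => //.
      by apply: bounded_rvM; [exact: bounded_rv_cst|apply: bounded_rv_min; exact: ltW].
    move=> w; set m := Num.min (Z w) (de * beta i).
    have m0 : 0 <= m by rewrite le_min Z0 ltW.
    have mz : m <= Z w by rewrite ge_min lexx.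
    have mb : m <= de * beta i by rewrite ge_min lexx orbT.
    have y0 : 0 <= s * (m / beta i) by rewrite mulr_ge0 ?divr_ge0 ?(ltW bi) ?(ltW s0).
    apply: (@le_trans _ _ (1 - expR (- (s * (m / beta i))))); last first.
      rewrite lerD2l lerN2 ler_expR lerN2 ler_wpM2l ?(ltW s0)//.
      by rewrite ler_wpM2r ?invr_ge0 ?(ltW bi).
    apply: le_trans (onem_expRN_ge y0).
    have q : m / beta i <= de by rewrite ler_pdivrMr.
    have -> : (s - s ^+ 2 * de) / beta i * m = s * (m / beta i) * (1 - s * de) by ring.
    by rewrite ler_wpM2l// lerD2l lerN2 ler_wpM2l ?(ltW s0).
  move=> /(ler_wpM2l (n0 i)); apply: le_trans.
  rewrite (_ : n i * _ = (s - s ^+ 2 * de) * (n i * G (de * beta i) / beta i)); last by ring.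
  lra.
have : mean P (fun w => 1 - expR (- (s * (Z w / beta i)))) <=
    s / beta i * G (beta i) + b (beta i).
  rewrite -mean_min// -meanZ; last by apply: bounded_rv_min; exact: ltW.
  rewrite /tail -mean_indic; last exact: measurable_gt_cst.
  have bm : bounded_rv (fun w => s / beta i * Num.min (Z w) (beta i)).
    by apply: bounded_rvM; [exact: bounded_rv_cst|apply: bounded_rv_min; exact: ltW].
  have bi1 : bounded_rv (\1_[set w | beta i < Z w] : T -> R).
    exact/bounded_rv_indic/measurable_gt_cst.
  rewrite -meanD//; apply: le_mean => //; first exact: bounded_rvD.
  move=> w; rewrite indicE; case: (boolP (w \in _)) => [_|].
    have h1 : 0 <= s / beta i * Num.min (Z w) (beta i).
      by rewrite mulr_ge0 ?divr_ge0 ?(ltW bi) ?(ltW s0)// le_min Z0 ltW.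
    have h2 := expR_ge0 (- (s * (Z w / beta i))).
    rewrite /= in h1 h2 *; lra.
  rewrite notin_setE /= => /negP; rewrite -leNgt => zb.
  rewrite (min_idPl zb) addr0.
  have := expR_ge1Dx (- (s * (Z w / beta i))).
  have -> : s / beta i * Z w = s * (Z w / beta i) by ring.
  lra.
move=> /(ler_wpM2l (n0 i)) /le_trans; apply.
have h1 : n i * b (beta i) <= e / 4 * (n i * G (beta i) / beta i).
  have : b (beta i) <= e / 4 * G (beta i) / beta i by rewrite ler_pdivlMr// mulrC.
  move=> /(ler_wpM2l (n0 i)) /le_trans; apply.
  by rewrite le_eqVlt; apply/orP; left; apply/eqP; ring.
have h2 : e / 4 * (n i * G (beta i) / beta i) <= e / 4 * 2.
  by rewrite ler_wpM2l ?(ltW e4)//; lra.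
have -> : n i * (s / beta i * G (beta i) + b (beta i)) =
   s * (n i * G (beta i) / beta i) + n i * b (beta i) by ring.
lra.
Unshelve. all: by end_near. Qed.


(** The derivative of 1 - e^(-r v^4). Applying the layer cake to sqrt(Z / x) instead of Z / x yields
    the factor v^3, which keeps the integrand bounded near 0 when the tail ratio b(x v^2) / b(x) is
    bounded by C v^(-3). *)
Let quartic_kernel (r v : R) : R := 4 * r * v ^+ 3 * expR (- (r * v ^+ 4)).

Let continuous_quartic_kernel (r : R) : continuous (quartic_kernel r).
Proof.
move=> v; apply: cvgM.
  by apply: cvgM; [exact: cvg_cst|exact: exprn_continuous].
apply: (@continuous_comp _ _ _ (fun v : R => - (r * v ^+ 4)) expR); last exact: continuous_expR.
by apply: cvgN; apply: cvgM; [exact: cvg_cst|exact: exprn_continuous].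
Qed.

Let is_derive_quartic (r v : R) :
  is_derive v (1 : R) (fun v : R => - expR (- (r * v ^+ 4))) (quartic_kernel r v).
Proof.
have d1 : is_derive v (1 : R) (fun v : R => - (r * v ^+ 4)) (- (r * (4 * v ^+ 3))).
  apply: is_derive_eq; rewrite /GRing.scale /=; ring.
have d2 : is_derive v (1 : R) (fun v : R => expR (- (r * v ^+ 4)))
    (expR (- (r * v ^+ 4)) * - (r * (4 * v ^+ 3))).
  exact: (@is_derive1_comp R expR (fun v : R => - (r * v ^+ 4)) v _ _ (is_derive_expR _) d1).
have d3 := is_deriveN d2.
by apply: (is_derive_eq d3); rewrite /quartic_kernel; ring.
Qed.

Let integral_quartic_kernel (r z : R) : 0 <= z ->
  (\int[mu]_(v in `[0%R, z[) (quartic_kernel r v)%:E = (1 - expR (- (r * z ^+ 4)))%:E)%E.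
Proof.
rewrite le_eqVlt => /predU1P[<-|z0].
  by rewrite set_itvco0 integral_set0 expr0n /= mulr0 oppr0 expR0 subrr.
have mk : measurable_fun `[0, z[ (EFin \o quartic_kernel r).
  apply/measurable_EFinP; apply: measurable_funTS.
  by apply: continuous_measurable_fun; exact: continuous_quartic_kernel.
rewrite integral_itv_bndo_bndc//.
rewrite (@continuous_FTC2 R _ (fun v : R => - expR (- (r * v ^+ 4))))//.
- by rewrite -EFinB expr0n /= mulr0 oppr0 expR0 opprK addrC.
- apply: continuous_subspaceT; exact: continuous_quartic_kernel.
- have cF (v0 : R) : {for v0, continuous (fun v : R => - expR (- (r * v ^+ 4)))}.
    apply: differentiable_continuous; apply/derivable1_diffP.
    by case: (is_derive_quartic r v0).
  split.
  + by move=> v _; case: (is_derive_quartic r v).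
  + exact: cvg_at_right_filter (cF 0).
  + exact: cvg_at_left_filter (cF z).
- by move=> v _; rewrite derive1E; case: (is_derive_quartic r v).
Qed.

(** The quotient is the integral of the quartic kernel times b(x v^2) / b(x). The second factor
    tends to v^(-2), so the integrand tends to 4 r v e^(-r v^4), whose integral is sqrt(pi r);
    dominated convergence concludes. *)
Lemma laplace_square_tail (r : R) : 0 < r ->
  (1 - mean P (fun w => expR (- (r * (Z w / x) ^+ 2)))) / b x @[x --> +oo] -->
  Num.sqrt (r * pi).
Proof.
move=> r0.
have noninc := fun x y => @tail_noninc x y.
have p32 : 1 < 3 / 2 :> R by lra.
have [C [C0 [x0 [x00 hC]]]] := tail_comparison b_gt0 tail_le1 noninc b_rv p32.
have k0 v : 0 <= v -> 0 <= quartic_kernel r v.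
  by move=> v0; rewrite !mulr_ge0 ?exprn_ge0 ?(ltW r0) ?expR_ge0.
have mk : measurable_fun [set: R] (quartic_kernel r).
  by apply: continuous_measurable_fun; exact: continuous_quartic_kernel.
have mb := measurable_tail noninc.
(* with W = sqrt (Z / x), the exponent r (Z/x)^2 is r W^4 *)
have cake x : 0 < x ->
  ((1 - mean P (fun w => expR (- (r * (Z w / x) ^+ 2))))%:E =
   \int[mu]_(v in `[0%R, +oo[) (quartic_kernel r v * b (x * v ^+ 2))%:E)%E.
  move=> xp; pose W w := Num.sqrt (Z w / x).
  have mW : measurable_fun [set: T] W.
    apply: measurableT_comp; first by apply: continuous_measurable_fun; exact: sqrt_continuous.
    by apply: measurable_funM => //; exact: measurable_cst.
  have W0 w : 0 <= W w by exact: sqrtr_ge0.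
  have W2 w : W w ^+ 2 = Z w / x by rewrite sqr_sqrtr// divr_ge0// ltW.
  have := layer_cake P mW mk k0 W0 (@integral_quartic_kernel r).
  have -> : (\int[mu]_(v in `[0%R, +oo[) (quartic_kernel r v * b (x * v ^+ 2))%:E =
      \int[mu]_(v in `[0%R, +oo[) (quartic_kernel r v * prob P [set w | v < W w])%:E)%E.
    apply: eq_integral => v; rewrite inE /= in_itv/= andbT => v0.
    congr (_ * prob P _)%:E; apply/seteqP; split => w /= h.
      rewrite -(ltr_pXn2r (n := 2)) ?nnegrE// W2 ltr_pdivlMr// mulrC//.
    by move: h; rewrite -(ltr_pXn2r (n := 2)) ?nnegrE// W2 ltr_pdivlMr// mulrC.
  move=> <-.
  have bE : bounded_rv (fun w => expR (- (r * (Z w / x) ^+ 2))).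
    apply: bounded_rv_expRN; last exact: ltW.
      by apply: measurable_funX; apply: measurable_funM => //; exact: measurable_cst.
    by move=> w; exact: sqr_ge0.
  have bE1 : bounded_rv (fun w => 1 - expR (- (r * (Z w / x) ^+ 2))).
    by apply: bounded_rvB => //; exact: bounded_rv_cst.
  have -> : 1 - mean P (fun w => expR (- (r * (Z w / x) ^+ 2))) =
      mean P (fun w => 1 - expR (- (r * (Z w / x) ^+ 2))).
    by rewrite meanB ?mean_cst//; exact: bounded_rv_cst.
  rewrite /mean /Rintegral fineK; last exact/integrable_fin_num/bounded_rv_integrable.
  by apply: eq_integral => w _; rewrite -[4%N]/(2 * 2)%N exprM W2.
apply/cvg_pinftyP => u uoo.
(* Dominated convergence is about sequences and asks for domination at every index; cutting u at x0
   makes the tail comparison valid for all n without changing u eventually. *)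
pose u' n := Num.max (u n) x0.
have u'x n : x0 <= u' n by rewrite le_max lexx orbT.
have u'0 n : 0 < u' n by exact: lt_le_trans (u'x n).
have u'oo : u' n @[n --> \oo] --> +oo.
  by apply: ger_cvgy uoo; near=> n; rewrite le_max lexx.
pose f n (v : R) := quartic_kernel r v * (b (u' n * v ^+ 2) / b (u' n)).
pose f0 (v : R) := 4 * r * v * expR (- (r * v ^+ 4)).
(* For v <= 1 the comparison with p = 3/2 gives v^3 b(u v^2) <= C b(u); for v > 1 the tail ratio is
   at most 1 and the kernel itself dominates. *)
pose g (v : R) := 4 * r * C * \1_(`[0, 1]%classic : set R) v + quartic_kernel r v.
have mf n : measurable_fun (`[0, +oo[%classic : set R) (EFin \o f n).
  apply/measurable_EFinP; apply: measurable_funTS; apply: measurable_funM => //.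
  apply: measurable_funM; last exact: measurable_cst.
  apply: measurableT_comp => //; apply: measurable_funM => //.
have f_cvg v : (`[0, +oo[%classic : set R) v -> (EFin \o f n) v @[n --> \oo] --> (EFin \o f0) v.
  rewrite /= in_itv/= andbT => v0; apply: cvg_EFin; first by near=> n.
  rewrite /f; move: v0; rewrite le_eqVlt => /predU1P[<-|v0].
    rewrite /quartic_kernel /f0 expr0n /= !(mulr0, mul0r).
    by under eq_fun do rewrite mul0r; exact: cvg_cst.
  have v20 : 0 < v ^+ 2 by rewrite exprn_gt0.
  have h := (cvg_pinftyP _ _).1 (b_rv v20) _ u'oo.
  have -> : f0 v = quartic_kernel r v * (v ^+ 2)^-1.
    by rewrite /f0 /quartic_kernel; field; rewrite gt_eqF.
  apply: cvgM; first exact: cvg_cst.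
  rewrite (_ : (fun n => _) = (fun n => b (v ^+ 2 * u' n) / b (u' n))); first exact: h.
  by apply/funext => n; rewrite [u' n * _]mulrC.
have g_int : mu.-integrable (`[0, +oo[%classic : set R) (EFin \o g).
  have i1 : mu.-integrable (`[0, +oo[%classic : set R)
      (fun v => (4 * r * C)%:E * (\1_(`[0, 1]%classic : set R) v)%:E)%E.
    apply: integrableZl => //.
    by apply: integrableS (@integrable_indic_itv R 0 1 true false).
  have i2 : mu.-integrable (`[0, +oo[%classic : set R) (EFin \o quartic_kernel r).
    apply/integrableP; split; first by apply/measurable_EFinP; exact: measurable_funTS.
    have -> : (\int[mu]_(v in `[0%R, +oo[) `|(EFin \o quartic_kernel r) v| =
        \int[mu]_(v in `[0%R, +oo[) (quartic_kernel r v)%:E)%E.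
      apply: eq_integral => v; rewrite inE /= in_itv/= andbT => v0.
      by rewrite ger0_norm// k0.
    rewrite (@ge0_continuous_FTC2y R _ (fun v : R => - expR (- (r * v ^+ 4))) 0 (- 0)).
    - by rewrite ltry.
    - exact: k0.
    - apply: continuous_subspaceT; exact: continuous_quartic_kernel.
    - apply: cvgN.
      have h : r * v ^+ 4 @[v --> +oo] --> (+oo : set_system R).
        apply: gt0_cvgMry => //.
        have -> : (fun v : R => v ^+ 4) = (fun v => (v ^+ 2) ^+ 2).
          by apply/funext => v; rewrite -exprM.
        exact: (cvg_comp _ _ (@cvgr_expr2 R) (@cvgr_expr2 R)).
      exact: (cvg_comp _ _ h (@cvgr_expR R)).
    - by move=> v _; case: (is_derive_quartic r v).
    - have cF : {for (0 : R), continuous (fun v : R => - expR (- (r * v ^+ 4)))}.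
        apply: differentiable_continuous; apply/derivable1_diffP.
        by case: (is_derive_quartic r 0).
      exact: cvg_at_right_filter cF.
    - by move=> v _; rewrite derive1E; case: (is_derive_quartic r v).
  exact: (integrableD _ i1 i2).
have f_dom n v : (`[0, +oo[%classic : set R) v -> (`|(EFin \o f n) v| <= (EFin \o g) v)%E.
  rewrite /= in_itv/= andbT lee_fin => v0; have kv := k0 v v0.
  have q0 : 0 <= b (u' n * v ^+ 2) / b (u' n) by rewrite divr_ge0// tail_ge0.
  rewrite ger0_norm; last exact: mulr_ge0.
  rewrite /g /f indicE.
  have [v1|v1] := leP v 1; last first.
    rewrite memNset ?mulr0 ?add0r; last by rewrite /= in_itv/= v0 leNgt v1.
    rewrite ler_piMr// ler_pdivrMr// mul1r; apply: noninc.
    by rewrite ler_peMr ?(ltW (u'0 n))// exprn_ege1// ltW.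
  rewrite mem_set ?mulr1; last by rewrite /= in_itv/= v0 v1.
  apply: (@le_trans _ _ (4 * r * C)); last by rewrite lerDl.
  move: v0; rewrite le_eqVlt => /predU1P[v0|v0].
    rewrite /quartic_kernel -v0 expr0n /= !(mulr0, mul0r).
    by rewrite !mulr_ge0 ?(ltW r0) ?(ltW C0).
  have v20 : 0 < v ^+ 2 by rewrite exprn_gt0.
  have ux : u' n * v ^+ 2 <= u' n by rewrite ler_piMr ?(ltW (u'0 n))// exprn_ile1// ltW.
  have h0 := hC _ _ (mulr_gt0 (u'0 n) v20) ux (u'x n).
  have v3 : (v ^+ 2) `^ (3 / 2) = v ^+ 3.
    rewrite -!powR_mulrn ?(ltW v0)// -powRrM; congr (_ `^ _); lra.
  have h : v ^+ 3 * b (u' n * v ^+ 2) <= C * b (u' n).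
    rewrite -(ler_pM2l (powR_gt0 (3 / 2) (u'0 n))) [leRHS]mulrCA [leLHS]mulrA -v3.
    by rewrite -powRM ?(ltW (u'0 n)) ?(ltW v20).
  have h2 : v ^+ 3 * (b (u' n * v ^+ 2) / b (u' n)) <= C by rewrite mulrA ler_pdivrMr.
  have e1 : expR (- (r * v ^+ 4)) <= 1.
    by rewrite -expR0 ler_expR oppr_le0 mulr_ge0 ?(ltW r0)// exprn_ge0// ltW.
  rewrite /quartic_kernel.
  have -> : 4 * r * v ^+ 3 * expR (- (r * v ^+ 4)) * (b (u' n * v ^+ 2) / b (u' n)) =
     4 * r * (expR (- (r * v ^+ 4)) * (v ^+ 3 * (b (u' n * v ^+ 2) / b (u' n)))) by ring.
  rewrite ler_wpM2l ?mulr_ge0 ?(ltW r0)//; apply: le_trans h2.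
  by rewrite ler_piMl// mulr_ge0// exprn_ge0// ltW.
have := @dominated_cvg _ _ _ mu (`[0, +oo[%classic : set R) (measurable_itv _) (fun n => EFin \o f n)
  (EFin \o f0) (EFin \o g) mf f_cvg (fun _ _ => isT) g_int f_dom.
rewrite integral_quartic_gauss// => /fine_cvgP[_] h.
apply: (cvg_near_eq _ _ h); near=> n => /=.
have un : u' n = u n.
  have : x0 <= u n by near: n; apply: (uoo [set y | x0 <= y]); apply: nbhs_pinfty_ge; exact: num_real.
  by rewrite /u' => /max_idPl.
have -> : (fun v => (f n v)%:E) =
    (fun v => ((b (u n))^-1)%:E * (quartic_kernel r v * b (u n * v ^+ 2))%:E)%E.
  by apply/funext => v; rewrite -EFinM /f un; congr EFin; ring.
rewrite ge0_integralZl//.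
- by rewrite -cake -?un// mulrC.
- apply/measurable_EFinP; apply: measurable_funTS; apply: measurable_funM => //.
  by apply: measurableT_comp => //; apply: measurable_funM => //.
- move=> v; rewrite /= in_itv/= andbT => v0.
  by rewrite lee_fin mulr_ge0 ?tail_ge0// k0.
- by rewrite lee_fin invr_ge0 tail_ge0.
Unshelve. all: by end_near. Qed.

Lemma laplace_square (I : Type) (F : set_system I) (n alpha : I -> R) (r : R) :
  Filter F -> 0 < r -> alpha i @[i --> F] --> +oo ->
  n i * b (alpha i) @[i --> F] --> (1 : R) ->
  n i * (1 - mean P (fun w => expR (- (r * (Z w / alpha i) ^+ 2)))) @[i --> F] -->
  Num.sqrt (r * pi).
Proof.
move=> FF r0 aoo nb.
have h := cvg_comp _ _ aoo (laplace_square_tail r0).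
have := @cvgM _ _ F FF _ _ _ _ nb h; rewrite mul1r.
apply: cvg_near_eq; apply: nearW => i /=.
by field; rewrite gt_eqF.
Qed.

End tail_laplace.

(** * Limits of n-th powers of quantities close to 1 *)

Section power_limit.
Context {R : realType}.

(** Take inverses: 1 / (1 - u) = 1 + u / (1 - u) <= e^(u / (1 - u)). *)
Lemma onem_ge_expR (u : R) : 0 <= u < 1 -> expR (- (u / (1 - u))) <= 1 - u.
Proof.
move=> /andP[u0 u1]; have v0 : 0 < 1 - u by lra.
rewrite expRN -[leLHS]mul1r ler_pdivrMr ?expR_gt0//.
have h := expR_ge1Dx (u / (1 - u)).
apply: (@le_trans _ _ ((1 - u) * (1 + u / (1 - u)))); last by rewrite ler_wpM2l// ltW.
by rewrite mulrDr mulr1 mulrCA mulfV ?gt_eqF// mulr1 subrK.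
Qed.

Lemma cvg_inv0 (I : Type) (F : set_system I) (f : I -> R) : Filter F ->
  f i @[i --> F] --> +oo -> (f i)^-1 @[i --> F] --> (0 : R).
Proof.
move=> FF foo; apply: near_cvg => e e0.
have h x : \forall i \near F, x < f i.
  by apply: (foo [set y | x < y]); apply: nbhs_pinfty_gt; exact: num_real.
near=> i.
have f0 : 0 < f i by near: i; exact: h.
have fe : e^-1 < f i by near: i; exact: h.
rewrite sub0r add0r (le_trans (_ : - e <= 0)) ?invr_ge0 ?(ltW f0) ?oppr_le0 ?(ltW e0)//=.
by rewrite -[leRHS]invrK lef_pV2 ?posrE ?invr_gt0// ltW.
Unshelve. all: by end_near. Qed.

(** With u = 1 - p, which tends to 0, p^n is squeezed between e^(-n u / (1 - u)) and e^(-n u). *)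
Lemma cvg_pow_expR (I : Type) (F : set_system I) (n : I -> nat) (p : I -> R) (a : R) :
  Filter F -> (forall i, 0 <= p i <= 1) ->
  (n i)%:R @[i --> F] --> (+oo : set_system R) ->
  (n i)%:R * (1 - p i) @[i --> F] --> a -> p i ^+ n i @[i --> F] --> expR (- a).
Proof.
move=> FF p01 noo np.
have nV : ((n i)%:R)^-1 @[i --> F] --> (0 : R) by exact: cvg_inv0.
have pc : 1 - p i @[i --> F] --> (0 : R).
  have h := @cvgM _ _ F FF _ _ _ _ np nV; rewrite mulr0 in h.
  apply: (cvg_near_eq _ _ h).
  have h0 : \forall i \near F, 0 < (n i)%:R :> R.
    by apply: (noo [set y | 0 < y]); apply: nbhs_pinfty_gt.
  near=> i.
  have ni : 0 < (n i)%:R :> R by near: i; exact: h0.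
  by rewrite /=; field; rewrite gt_eqF.
have cE (z : R) : (fun x => expR (- x)) x @[x --> z] --> expR (- z).
  apply: (@continuous_comp _ _ _ (fun x : R => - x) expR); last exact: continuous_expR.
  by apply: cvgN; exact: cvg_id.
have up : expR (- ((n i)%:R * (1 - p i))) @[i --> F] --> expR (- a).
  exact: (cvg_comp _ _ np (cE a)).
have lo1 : (n i)%:R * (1 - p i) / (1 - (1 - p i)) @[i --> F] --> a.
  have h : (1 - (1 - p i))^-1 @[i --> F] --> (1 : R).
    rewrite -[X in _ --> X]invr1; apply: cvgV => //.
    by rewrite -[X in _ --> X]subr0; apply: cvgB => //; exact: cvg_cst.
  by rewrite -[X in _ --> X]mulr1; apply: cvgM.
have lo : expR (- ((n i)%:R * (1 - p i) / (1 - (1 - p i)))) @[i --> F] --> expR (- a).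
  exact: (cvg_comp _ _ lo1 (cE a)).
apply: near_cvg => e e0.
have hu := cvg_near _ up e0; have hl := cvg_near _ lo e0; have hp := cvg_near _ pc (@ltr01 R).
near=> i.
have /andP[_ h1] : expR (- a) - e < expR (- ((n i)%:R * (1 - p i))) < expR (- a) + e.
  by near: i; exact: hu.
have /andP[h2 _] : expR (- a) - e < expR (- ((n i)%:R * (1 - p i) / (1 - (1 - p i))))
  < expR (- a) + e by near: i; exact: hl.
have /andP[_ h3] : 0 - 1 < 1 - p i < 0 + 1 by near: i; exact: hp.
have /andP[p0 p1] := p01 i.
apply/andP; split.
  apply: le_trans (ltW h2) _.
  rewrite -mulrA -mulrN expRM_natl; rewrite lerXn2r ?nnegrE ?expR_ge0//.
  rewrite -[leRHS](subKr 1); apply: onem_ge_expR; apply/andP; split; lra.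
apply: le_trans (ltW h1).
rewrite -mulrN expRM_natl lerXn2r ?nnegrE ?expR_ge0//.
by apply: le_trans (expR_ge1Dx _); lra.
Unshelve. all: by end_near. Qed.

End power_limit.

(** * Algebra and measurability of the sample coefficient of variation *)

Section sample_covar_algebra.
Context {R : realType}.

Lemma sample_covar_ge0 (n : nat) (x : nat -> R) : (forall i, 0 <= x i) ->
  0 <= sample_covar n x / Num.sqrt n%:R.
Proof.
move=> x0; rewrite /sample_covar /sample_std /sample_mean !divr_ge0 ?sqrtr_ge0//.
by rewrite mulr_ge0 ?invr_ge0// sumr_ge0.
Qed.

(** The centred squares sum to the sum of squares minus n times the squared mean. After
    normalization this correction is exactly 1 / n, whatever the sample. *)
Lemma sample_covar_sqr (n : nat) (x : nat -> R) : (0 < n)%N ->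
  \sum_(i < n) x i != 0 ->
  (sample_covar n x / Num.sqrt n%:R) ^+ 2 =
  (\sum_(i < n) x i ^+ 2) / (\sum_(i < n) x i) ^+ 2 - n%:R^-1.
Proof.
move=> n0 S0; have nR : n%:R != 0 :> R by rewrite pnatr_eq0 -lt0n.
have nR0 : 0 <= n%:R^-1 :> R by rewrite invr_ge0.
rewrite /sample_covar /sample_std !expr_div_n !sqr_sqrtr//; last first.
  by rewrite mulr_ge0// sumr_ge0// => i _; exact: sqr_ge0.
set m := sample_mean n x.
have -> : \sum_(i < n) (x i - m) ^+ 2 =
    \sum_(i < n) x i ^+ 2 - 2 * m * (\sum_(i < n) x i) + n%:R * m ^+ 2.
  transitivity (\sum_(i < n) (x i ^+ 2 - 2 * m * x i + m ^+ 2)).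
    by apply: eq_bigr => i _; ring.
  rewrite big_split sumrB/= -mulr_sumr; congr (_ + _).
  by rewrite sumr_const card_ord mulr_natl.
rewrite /m /sample_mean; set S := \sum_(i < n) x i in S0 *; set Q := \sum_(i < n) _.
by field; rewrite nR S0.
Qed.

End sample_covar_algebra.

(** 1 / f = f * (f^2)^(-1), where the power is a measurable real function; the factor f makes the
    identity respect the convention 0^-1 = 0. *)
Lemma measurable_fun_inv {R : realType} d (T : measurableType d) (f : T -> R) :
  measurable_fun [set: T] f -> measurable_fun [set: T] (fun w => (f w)^-1).
Proof.
move=> mf.
have -> : (fun w => (f w)^-1) = (fun w => f w * (f w ^+ 2) `^ (-1)).
  apply/funext => w; rewrite powR_inv1 ?sqr_ge0//.
  have [->|f0] := eqVneq (f w) 0; first by rewrite invr0 mul0r.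
  by field.
apply: measurable_funM => //.
apply: (measurableT_comp (f := fun x : R => x `^ (-1))); first exact: measurable_powR.
exact: measurable_funX.
Qed.

Lemma measurable_sample_covar {R : realType} d (T : measurableType d) (n : nat)
  (x : nat -> T -> R) : (forall i, measurable_fun [set: T] (x i)) ->
  measurable_fun [set: T] (fun w => sample_covar n (fun i => x i w)).
Proof.
move=> mx.
have mm : measurable_fun [set: T] (fun w => sample_mean n (fun i => x i w)).
  by apply: measurable_funM => //; exact: measurable_sum.
apply: measurable_funM; last exact: measurable_fun_inv.
apply: measurableT_comp; first by apply: continuous_measurable_fun; exact: sqrt_continuous.
apply: measurable_funM => //; apply: measurable_sum => i.
by apply: measurable_funX; exact: measurable_funB.
Qed.

(** * The limit along deterministic sample sizes, over an arbitrary filter *)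

Section fixed_sample.
Context {R : realType} {d d' : measure_display} {T : measurableType d}
  {T' : measurableType d'}.
Variables (P : probability T R) (P' : probability T' R).
Variables (Z : nat -> {RV P >-> R}) (V : T' -> R).
Local Notation b := (tail P (Z 0%N)).
Local Notation G := (tail_integral b).
Hypothesis Z_ge0 : forall i w, 0 <= Z i w.
Hypothesis Z_iid : iid Z.
Hypothesis b_gt0 : forall x, 0 < b x.
Hypothesis b_rv : forall c, 0 < c -> b (c * x) / b x @[x --> +oo] --> c^-1.
Hypothesis mV : measurable_fun [set: T'] V.
Hypothesis V_ge0 : forall w, 0 <= V w.
Hypothesis V_laplace : forall r : R, 0 < r ->
  mean P' (fun w => expR (- (r * V w))) = expR (- Num.sqrt (r * pi)).

Variables (I : Type) (F : set_system I) (n : I -> nat) (alpha beta : I -> R).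
Hypothesis FF : Filter F.
Hypothesis n_infty : (n i)%:R @[i --> F] --> (+oo : set_system R).
Hypothesis alpha_infty : alpha i @[i --> F] --> +oo.
Hypothesis beta_infty : beta i @[i --> F] --> +oo.
Hypothesis n_alpha : (n i)%:R * b (alpha i) @[i --> F] --> (1 : R).
Hypothesis n_beta : (n i)%:R * G (beta i) / beta i @[i --> F] --> (1 : R).

Let mZ i : measurable_fun [set: T] (Z i).
Proof. exact: measurable_funPT. Qed.

Definition scaled_squares i w : R := \sum_(j < n i) (Z j w / alpha i) ^+ 2.
Definition scaled_sum i w : R := \sum_(j < n i) Z j w / beta i.

Lemma measurable_scaled_squares i : measurable_fun [set: T] (scaled_squares i).
Proof.
apply: measurable_sum => j; apply: measurable_funX; apply: measurable_funM => //.
Qed.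

Lemma measurable_scaled_sum i : measurable_fun [set: T] (scaled_sum i).
Proof. by apply: measurable_sum => j; apply: measurable_funM => //. Qed.

Lemma scaled_squares_ge0 i w : 0 <= scaled_squares i w.
Proof. by apply: sumr_ge0 => j _; exact: sqr_ge0. Qed.

(** By independence the transform is p^n, with p the transform of one squared summand, and n (1 - p)
    -> sqrt(pi r). *)
Lemma laplace_scaled_squares (r : R) : 0 < r ->
  mean P (fun w => expR (- (r * scaled_squares i w))) @[i --> F] -->
  mean P' (fun w => expR (- (r * V w))).
Proof.
move=> r0; rewrite V_laplace//.
pose f i x : R := expR (- (r * (x / alpha i) ^+ 2)).
have f01 i x : 0 <= f i x <= 1.
  by rewrite /f expR_ge0 -expR0 ler_expR oppr_le0 mulr_ge0 ?(ltW r0) ?sqr_ge0.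
have mf i : measurable_fun [set: R] (f i).
  apply: measurableT_comp => //; apply: measurableT_comp => //; apply: measurable_funM => //.
  by apply: measurable_funX; apply: measurable_funM.
have -> : (fun i => mean P (fun w => expR (- (r * scaled_squares i w)))) =
    (fun i => mean P (fun w => f i (Z 0%N w)) ^+ n i).
  apply/funext => i; rewrite -(iid_mean_prod (n i) Z_iid (mf i) (f01 i)).
  apply: eq_mean => w; rewrite /scaled_squares mulr_sumr -sumrN expR_sum.
  exact: eq_bigr.
apply: cvg_pow_expR => //.
  move=> i; rewrite mean_ge0/=; last by move=> w; case/andP: (f01 i (Z 0%N w)).
  rewrite -(mean_cst P 1); apply: le_mean.
  - by apply: bounded_rv01 => [|w]; [apply: measurableT_comp|exact: f01].
  - exact: bounded_rv_cst.
  - by move=> w; case/andP: (f01 i (Z 0%N w)).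
exact: (laplace_square (mZ 0) (Z_ge0 0) b_gt0 b_rv).
Qed.

Lemma laplace_scaled_sum (s : R) : 0 < s ->
  mean P (fun w => expR (- (s * scaled_sum i w))) @[i --> F] --> expR (- s).
Proof.
move=> s0.
(* [beta i] is positive only eventually, while f has to take values in [0, 1] for every i and every
   real x; hence the absolute values. *)
pose f i (x : R) : R := expR (- (s * (`|x| / `|beta i|))).
have f01 i x : 0 <= f i x <= 1.
  by rewrite /f expR_ge0 -expR0 ler_expR oppr_le0 mulr_ge0 ?(ltW s0) ?divr_ge0.
have mf i : measurable_fun [set: R] (f i).
  apply: measurableT_comp => //; apply: measurableT_comp => //; apply: measurable_funM => //.
  by apply: measurable_funM => //.
have bgt : \forall i \near F, 0 < beta i.
  by apply: (@beta_infty [set y : R | 0 < y]); apply: nbhs_pinfty_gt.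
have h : mean P (fun w => f i (Z 0%N w)) ^+ n i @[i --> F] --> expR (- s).
  apply: cvg_pow_expR => //.
    move=> i; rewrite mean_ge0/=; last by move=> w; case/andP: (f01 i (Z 0%N w)).
    rewrite -(mean_cst P 1); apply: le_mean.
    - by apply: bounded_rv01 => [|w]; [apply: measurableT_comp|exact: f01].
    - exact: bounded_rv_cst.
    - by move=> w; case/andP: (f01 i (Z 0%N w)).
  have := laplace_relative_stability (mZ 0) (Z_ge0 0) b_gt0 b_rv FF (fun i => ler0n _ (n i)) s0
    beta_infty n_beta.
  apply: cvg_near_eq; near=> i.
  have bi : 0 < beta i by near: i; exact: bgt.
  congr (_ * (_ - _)); apply: eq_mean => w.
  by rewrite /f !ger0_norm// ltW.
apply: (cvg_near_eq _ _ h); near=> i.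
have bi : 0 < beta i by near: i; exact: bgt.
rewrite -(iid_mean_prod (n i) Z_iid (mf i) (f01 i)).
apply: eq_mean => w; rewrite /scaled_sum mulr_sumr -sumrN expR_sum.
by apply: eq_bigr => j _; rewrite /f !ger0_norm// ltW.
Unshelve. all: by end_near. Qed.

(* E (e^-B - e^-1)^2 -> 0 is a combination of Laplace transforms at 1 and 2. *)
Lemma scaled_sum_cvg1 (delta eps : R) : 0 < delta -> 0 < eps ->
  \forall i \near F, prob P [set w | delta <= `|scaled_sum i w - 1|] <= eps.
Proof.
move=> d0 e0.
have m2 := laplace_scaled_sum (ltr0n _ 2). have m1 := laplace_scaled_sum (@ltr01 R).
(* A lower bound for |e^(-B) - e^(-1)| on the event |B - 1| >= delta, so that Markov's inequality
   applies with c^2. The case B < 1 uses e^delta - 1 >= delta >= 1 - e^(-delta). *)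
pose c : R := expR (- 1) * (1 - expR (- delta)).
have c0 : 0 < c.
  by rewrite mulr_gt0 ?expR_gt0// subr_gt0 -[ltRHS]expR0 ltr_expR oppr_lt0.
have m : mean P (fun w => expR (- (2 * scaled_sum i w))) -
    2 * expR (- 1) * mean P (fun w => expR (- (1 * scaled_sum i w))) + expR (- 1) ^+ 2
    @[i --> F] --> (0 : R).
  have -> : (0 : R) = expR (- 2) - 2 * expR (- 1) * expR (- 1) + expR (- 1) ^+ 2.
    rewrite (_ : - 2 = 2%:R * - 1); last by ring.
    by rewrite expRM_natl; ring.
  apply: cvgD; last exact: cvg_cst.
  by apply: cvgB => //; apply: cvgM => //; exact: cvg_cst.
have ce0 : 0 < c ^+ 2 * eps by rewrite mulr_gt0// exprn_gt0.
have hm := cvg_near _ m ce0.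
have bgt : \forall i \near F, 0 < beta i.
  by apply: (@beta_infty [set y : R | 0 < y]); apply: nbhs_pinfty_gt.
near=> i.
have bi : 0 < beta i by near: i; exact: bgt.
have /andP[_ h] : 0 - c ^+ 2 * eps < mean P (fun w => expR (- (2 * scaled_sum i w))) -
    2 * expR (- 1) * mean P (fun w => expR (- (1 * scaled_sum i w))) + expR (- 1) ^+ 2
    < 0 + c ^+ 2 * eps by near: i; exact: hm.
have S0 w : 0 <= scaled_sum i w.
  by apply: sumr_ge0 => j _; rewrite divr_ge0// ltW.
have mS := measurable_scaled_sum i.
have bE s : 0 <= s -> bounded_rv (fun w => expR (- (s * scaled_sum i w))).
  by move=> s0; exact: bounded_rv_expRN.
have b2 := bE 2 (ler0n _ _); have b1 := bE 1 ler01.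
have b1c : bounded_rv (fun w => 2 * expR (- 1) * expR (- (1 * scaled_sum i w))).
  by apply: bounded_rvM => //; exact: bounded_rv_cst.
have b2c := bounded_rvB b2 b1c.
rewrite -(ler_pM2l (exprn_gt0 2 c0)).
move: h; rewrite add0r => /ltW; apply: le_trans.
have -> : mean P (fun w => expR (- (2 * scaled_sum i w))) -
    2 * expR (- 1) * mean P (fun w => expR (- (1 * scaled_sum i w))) + expR (- 1) ^+ 2 =
    mean P (fun w => expR (- (2 * scaled_sum i w)) -
      2 * expR (- 1) * expR (- (1 * scaled_sum i w)) + expR (- 1) ^+ 2).
  rewrite meanD//; last exact: bounded_rv_cst.
  by rewrite mean_cst meanB// meanZ.
have sqE w : expR (- (2 * scaled_sum i w)) -
      2 * expR (- 1) * expR (- (1 * scaled_sum i w)) + expR (- 1) ^+ 2 =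
      (expR (- scaled_sum i w) - expR (- 1)) ^+ 2.
  by rewrite -mulrN expRM_natl mul1r; ring.
apply: markov_mean.
- by apply: bounded_rvD => //; exact: bounded_rv_cst.
- rewrite -[X in measurable X]setTI; apply: measurable_fun_le => //.
  apply: measurableT_comp; first by apply: continuous_measurable_fun; exact: norm_continuous.
  by apply: measurable_funB => //; exact: measurable_cst.
- by move=> w; rewrite sqE sqr_ge0.
move=> w /= dB; rewrite sqE -[leRHS]real_normK ?num_real//.
rewrite lerXn2r ?nnegrE ?(ltW c0)//.
have : expR (- 1) * (1 - expR (- delta)) <= `|expR (- 1) * (expR (1 - scaled_sum i w) - 1)|.
  rewrite normrM ger0_norm ?expR_ge0// ler_wpM2l ?expR_ge0//.
  have [B1|B1] := leP 1 (scaled_sum i w).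
    rewrite ler0_norm; last by rewrite subr_le0 -[leRHS]expR0 ler_expR subr_le0.
    rewrite opprB lerD2l lerN2 ler_expR.
    by rewrite ger0_norm ?subr_ge0// in dB; lra.
  rewrite ltr0_norm ?subr_lt0// in dB.
  have e1 : 1 + (1 - scaled_sum i w) <= expR (1 - scaled_sum i w) by exact: expR_ge1Dx.
  have e2 := expR_ge1Dx (- delta).
  rewrite ger0_norm; lra.
rewrite (_ : expR (- scaled_sum i w) - expR (- 1) = expR (- 1) * (expR (1 - scaled_sum i w) - 1))//.
by rewrite mulrBr mulr1 -expRD; congr (expR _ - _); ring.
Unshelve. all: by end_near. Qed.


Definition covar_ratio i w : R :=
  beta i / alpha i * (sample_covar (n i) (fun j => Z j w) / Num.sqrt (n i)%:R).

Lemma measurable_covar_ratio i : measurable_fun [set: T] (covar_ratio i).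
Proof.
apply: measurable_funM => //; apply: measurable_funM => //.
exact: measurable_sample_covar.
Qed.

Lemma covar_ratio_sqr i w : 0 < alpha i -> 0 < beta i -> (0 < n i)%N ->
  scaled_sum i w != 0 ->
  covar_ratio i w ^+ 2 =
  scaled_squares i w / scaled_sum i w ^+ 2 - (beta i / alpha i) ^+ 2 / (n i)%:R.
Proof.
move=> a0 b0 n0 S0.
have sE : scaled_sum i w = (\sum_(j < n i) Z j w) / beta i by rewrite /scaled_sum mulr_suml.
have qE : scaled_squares i w = (\sum_(j < n i) Z j w ^+ 2) / alpha i ^+ 2.
  by rewrite /scaled_squares mulr_suml; apply: eq_bigr => j _; rewrite expr_div_n.
rewrite sE qE in S0 *; have S1 : \sum_(j < n i) Z j w != 0.
  by apply: contraNneq S0 => ->; rewrite mul0r.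
rewrite /covar_ratio exprMn sample_covar_sqr//.
by field; rewrite S1 !gt_eqF// ltr0n.
Qed.

(** Here c stands for [covar_ratio], A for [scaled_squares], S for [scaled_sum] and rho for the
    vanishing (beta / alpha)^2 / n. This lemma and the next convert bounds on c into bounds on A and
    back, at a point where S is close to 1. *)
Lemma scaled_squares_le (de x rho c A S : R) : 0 < de -> 0 < S < 1 + de ->
  0 <= c <= x -> rho < de -> c ^+ 2 = A / S ^+ 2 - rho ->
  A <= (1 + de) ^+ 2 * (x ^+ 2 + de).
Proof.
move=> d0 /andP[S0 S1] /andP[c0 cx] rd cE.
have cx2 : c ^+ 2 <= x ^+ 2 by rewrite lerXn2r ?nnegrE//; exact: le_trans cx.
have h : A / S ^+ 2 <= x ^+ 2 + de by lra.
rewrite ler_pdivrMr ?exprn_gt0// mulrC in h; apply: le_trans h _.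
apply: ler_wpM2r; first by rewrite addr_ge0 ?sqr_ge0 ?(ltW d0).
by rewrite lerXn2r ?nnegrE ?(ltW S0) ?(ltW S1)// addr_ge0 ?(ltW d0).
Qed.

Lemma covar_ratio_le (de x rho c A S : R) : de < 1 -> 1 - de < S -> 0 <= x ->
  0 <= c -> 0 <= rho -> c ^+ 2 = A / S ^+ 2 - rho -> A <= (1 - de) ^+ 2 * x ^+ 2 ->
  c <= x.
Proof.
move=> d1 S1 x0 c0 r0 cE hA.
have d2 : 0 < 1 - de by rewrite subr_gt0.
have S0 := lt_trans d2 S1.
rewrite -(ler_pXn2r (ltn0Sn 1)) ?nnegrE// cE.
apply: (@le_trans _ _ (A / S ^+ 2)); first by rewrite gerBl.
rewrite ler_pdivrMr ?exprn_gt0//; apply: le_trans hA _.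
rewrite mulrC ler_wpM2l ?sqr_ge0//.
by rewrite lerXn2r ?nnegrE ?(ltW S0) ?(ltW d2)// ltW.
Qed.

(** Outside the event |S - 1| >= de, of probability at most eps / 2, a bound on the ratio and a
    bound on the scaled squares imply one another with slightly changed levels. The scaled squares
    are compared with V by Laplace continuity. *)
Lemma covar_ratio_limit (x x' eps : R) : 0 < x -> x < x' -> 0 < eps ->
  \forall i \near F,
    prob P [set w | covar_ratio i w <= x] <= prob P' [set w | V w <= x' ^+ 2] + eps /\
    prob P' [set w | V w <= x ^+ 2] <= prob P [set w | covar_ratio i w <= x'] + eps.
Proof.
move=> x0 xx' e0.
have xsq : x ^+ 2 < x' ^+ 2 by rewrite ltr_pXn2r ?nnegrE//; lra.
(* Both distorted levels tend to the undistorted ones as de -> 0, so for small de they stay on the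
   proper side of x'^2 and x^2; this leaves Laplace continuity the strict gap it needs. *)
have [de [d0 [d1 [du dl]]]] : exists de : R, 0 < de /\ de < 1 /\
    (1 + de) ^+ 2 * (x ^+ 2 + de) < x' ^+ 2 /\ x ^+ 2 < (1 - de) ^+ 2 * x' ^+ 2.
  have c1 : (1 + h) ^+ 2 * (x ^+ 2 + h) @[h --> (0 : R)] --> (1 + 0) ^+ 2 * (x ^+ 2 + 0).
    apply: cvgM; last by apply: cvgD; [exact: cvg_cst|exact: cvg_id].
    by apply: cvgM; apply: cvgD; try exact: cvg_cst; exact: cvg_id.
  have c2 : (1 - h) ^+ 2 * x' ^+ 2 @[h --> (0 : R)] --> (1 - 0) ^+ 2 * x' ^+ 2.
    apply: cvgM; last exact: cvg_cst.
    by apply: cvgM; apply: cvgB; try exact: cvg_cst; exact: cvg_id.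
  rewrite subr0 expr1n mul1r in c2; rewrite !addr0 expr1n mul1r in c1.
  have D0 : 0 < x' ^+ 2 - x ^+ 2 by rewrite subr_gt0.
  near (0 : R)^'+ => h; exists h; split; first by near: h; exact: nbhs_right_gt.
  split; first by near: h; exact: nbhs_right_lt.
  have /andP[_ h1] : x ^+ 2 - (x' ^+ 2 - x ^+ 2) < (1 + h) ^+ 2 * (x ^+ 2 + h)
      < x ^+ 2 + (x' ^+ 2 - x ^+ 2).
    by near: h; apply: (cvg_near _ (cvg_at_right_filter c1) D0).
  have /andP[h2 _] : x' ^+ 2 - (x' ^+ 2 - x ^+ 2) < (1 - h) ^+ 2 * x' ^+ 2
      < x' ^+ 2 + (x' ^+ 2 - x ^+ 2).
    by near: h; apply: (cvg_near _ (cvg_at_right_filter c2) D0).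
  by split; lra.
have e2 : 0 < eps / 2 by rewrite divr_gt0.
have x20 : 0 < x ^+ 2 by rewrite exprn_gt0.
have u0 : 0 <= (1 + de) ^+ 2 * (x ^+ 2 + de) by rewrite mulr_ge0 ?sqr_ge0//; lra.
have lapA := laplace_continuity FF measurable_scaled_squares scaled_squares_ge0 mV V_ge0
  laplace_scaled_squares.
have A1 := lapA _ _ _ u0 du e2.
have A2 := lapA _ _ _ (ltW x20) dl e2.
have B1 := scaled_sum_cvg1 d0 e2.
have rho := normalization_ratio b_gt0 (@tail_le1 _ _ _ P _ (mZ 0)) (fun x y => @tail_noninc _ _ _ P _ (mZ 0) x y)
  b_rv FF (fun i => ler0n _ (n i)) n_infty alpha_infty beta_infty n_alpha n_beta.
have rho1 := cvg_near FF rho d0.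
have bgt : \forall i \near F, 0 < beta i.
  by apply: (@beta_infty [set y : R | 0 < y]); apply: nbhs_pinfty_gt.
have agt : \forall i \near F, 0 < alpha i.
  by apply: (@alpha_infty [set y : R | 0 < y]); apply: nbhs_pinfty_gt.
have ngt : \forall i \near F, 0 < (n i)%:R :> R.
  by apply: (@n_infty [set y : R | 0 < y]); apply: nbhs_pinfty_gt.
near=> i.
have bi : 0 < beta i by near: i; exact: bgt.
have ai : 0 < alpha i by near: i; exact: agt.
have ni : (0 < n i)%N by rewrite -(ltr0n R); near: i; exact: ngt.
have [P1 _] : prob P [set w | scaled_squares i w <= (1 + de) ^+ 2 * (x ^+ 2 + de)] <=
   prob P' [set w | V w <= x' ^+ 2] + eps / 2 /\
   prob P' [set w | V w <= (1 + de) ^+ 2 * (x ^+ 2 + de)] <=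
   prob P [set w | scaled_squares i w <= x' ^+ 2] + eps / 2 by near: i; exact: A1.
have [_ P2] : prob P [set w | scaled_squares i w <= x ^+ 2] <=
   prob P' [set w | V w <= (1 - de) ^+ 2 * x' ^+ 2] + eps / 2 /\
   prob P' [set w | V w <= x ^+ 2] <=
   prob P [set w | scaled_squares i w <= (1 - de) ^+ 2 * x' ^+ 2] + eps / 2.
  by near: i; exact: A2.
have P3 : prob P [set w | de <= `|scaled_sum i w - 1|] <= eps / 2 by near: i; exact: B1.
have /andP[_ rho2] : 0 - de < (beta i / alpha i) ^+ 2 / (n i)%:R < 0 + de by near: i; exact: rho1.
rewrite add0r in rho2.
have rho3 : 0 <= (beta i / alpha i) ^+ 2 / (n i)%:R by rewrite divr_ge0// sqr_ge0.
have mD : measurable [set w | de <= `|scaled_sum i w - 1|].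
  rewrite -[X in measurable X]setTI; apply: measurable_fun_le => //.
  apply: measurableT_comp => //; apply: measurable_funB => //; exact: measurable_scaled_sum.
have mC y := measurable_le_cst y (measurable_covar_ratio i).
have mA y := measurable_le_cst y (measurable_scaled_squares i).
have r0 w : 0 <= covar_ratio i w.
  apply: mulr_ge0; first by rewrite divr_ge0 ?(ltW ai) ?(ltW bi).
  exact: sample_covar_ge0.
have d2 : 0 < 1 - de by rewrite subr_gt0.
have good w : ~ (de <= `|scaled_sum i w - 1|) -> 1 - de < scaled_sum i w < 1 + de.
  by move=> /negP; rewrite -ltNge ltr_norml ltrBlDl ltrBrDl.
split.
  have sub : [set w | covar_ratio i w <= x] `<=`
      [set w | scaled_squares i w <= (1 + de) ^+ 2 * (x ^+ 2 + de)] `|`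
      [set w | de <= `|scaled_sum i w - 1|].
    move=> w /= Rx; have [dS|/good /andP[S1 S2]] := pselect (de <= `|scaled_sum i w - 1|).
      by right.
    left; have S0 := lt_trans d2 S1.
    apply: (scaled_squares_le d0 _ _ rho2 (covar_ratio_sqr ai bi ni (lt0r_neq0 S0))).
      by rewrite S0.
    by rewrite r0.
  apply: le_trans (le_prob P (mC x) (measurableU _ _ (mA _) mD) sub) _.
  by apply: le_trans (probU P (mA _) mD) _; rewrite {1}(splitr eps) addrA lerD.
have sub : [set w | scaled_squares i w <= (1 - de) ^+ 2 * x' ^+ 2] `<=`
    [set w | covar_ratio i w <= x'] `|` [set w | de <= `|scaled_sum i w - 1|].
  move=> w /= Aw; have [dS|/good /andP[S1 S2]] := pselect (de <= `|scaled_sum i w - 1|).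
    by right.
  left; have S0 := lt_trans d2 S1.
  exact: (covar_ratio_le d1 S1 (ltW (lt_trans x0 xx')) (r0 w) rho3
    (covar_ratio_sqr ai bi ni (lt0r_neq0 S0)) Aw).
have := le_prob P (mA _) (measurableU _ _ (mC x') mD) sub.
have := probU P (mC x') mD; lra.
Unshelve. all: by end_near. Qed.

End fixed_sample.

(** * Laws determined by lower rays and lower quadrants *)

Section joint_law.
Context {R : realType}.

Definition lower_rays : set (set R) := [set A | exists x, A = `]-oo, x]%classic].

Lemma measurable_lower_rays : @measurable _ R = <<s lower_rays >>.
Proof.
rewrite eqEsubset; split => A; last first.
  by apply: smallest_sub; [exact: sigma_algebra_measurable|move=> _ [x ->]].
have : (@ocitv R).-sigma.-measurable `<=` <<s lower_rays >>.
  rewrite RGenOInfty.measurableE; apply: smallest_sub; first exact: smallest_sigma_algebra.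
  move=> _ [x ->]; rewrite -setCitvl.
  have [_ sC _] := smallest_sigma_algebra [set: R] lower_rays.
  by rewrite -setTD; apply: sC; apply: sub_sigma_algebra; exists x.
exact.
Qed.

(** Lower rays form a generating pi-system, and those ending at natural numbers exhaust the line. *)
Lemma finite_measure_ray_unique (m1 m2 : {measure set R -> \bar R}) :
  (forall x : R, m1 `]-oo, x]%classic = m2 `]-oo, x]%classic) ->
  (forall x : R, m1 `]-oo, x]%classic < +oo)%E ->
  forall A, measurable A -> m1 A = m2 A.
Proof.
move=> m12 m1oo; apply: (@measure_unique _ _ _ lower_rays (fun k => `]-oo, k%:R]%classic)).
- exact: measurable_lower_rays.
- move=> _ _ [x ->] [y ->]; exists (Num.min x y); apply/seteqP; split => z /=;
    by rewrite !in_itv/= le_min => /andP.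
- by move=> k; exists k%:R.
- apply/seteqP; split => // z _; exists (Num.trunc z).+1 => //=.
  by rewrite in_itv/=; exact/ltW/truncnS_gt.
- by move=> _ [x ->]; exact: m12.
- by move=> k; exact: m1oo.
Qed.

(** For a fixed D, A |-> Q(U in A, D) is a finite measure on the line, the push-forward by U of Q
    restricted to D, so rays determine it. *)
Lemma slice_unique d1 (T1 : measurableType d1) d2 (T2 : measurableType d2)
  (Q1 : probability T1 R) (Q2 : probability T2 R) (U1 : T1 -> R) (U2 : T2 -> R)
  (D1 : set T1) (D2 : set T2) :
  measurable_fun [set: T1] U1 -> measurable_fun [set: T2] U2 ->
  measurable D1 -> measurable D2 ->
  (forall u, Q1 ([set w | U1 w <= u] `&` D1) = Q2 ([set w | U2 w <= u] `&` D2)) ->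
  forall A, measurable A -> Q1 (U1 @^-1` A `&` D1) = Q2 (U2 @^-1` A `&` D2).
Proof.
move=> mU1 mU2 mD1 mD2 h A mA.
pose restr d (T : measurableType d) (Q : probability T R) (D : set T) (mD : measurable D) :=
  measure_function_mrestr__canonical__measure_function_Measure Q mD.
pose m1 := measure_function_pushforward__canonical__measure_function_Measure
  (restr _ _ Q1 _ mD1) mU1.
pose m2 := measure_function_pushforward__canonical__measure_function_Measure
  (restr _ _ Q2 _ mD2) mU2.
have m12 x : m1 `]-oo, x]%classic = m2 `]-oo, x]%classic by exact: h.
have m1oo x : (m1 `]-oo, x]%classic < +oo)%E.
  rewrite (le_lt_trans _ (ltry 1))//; apply: probability_le1.
  apply: measurableI => //; by rewrite -[X in measurable X]setTI; apply: (mU1).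
exact: (finite_measure_ray_unique m12 m1oo mA).
Qed.

(** Two uses of [slice_unique] extend the equality from quadrants to measurable rectangles, one
    coordinate at a time; rectangles are a generating pi-system of the product. *)
Lemma joint_law_unique d1 (T1 : measurableType d1) d2 (T2 : measurableType d2)
  (Q1 : probability T1 R) (Q2 : probability T2 R) (U1 L1 : T1 -> R) (U2 L2 : T2 -> R) :
  measurable_fun [set: T1] U1 -> measurable_fun [set: T2] U2 ->
  measurable_fun [set: T1] L1 -> measurable_fun [set: T2] L2 ->
  (forall u l, Q1 ([set w | U1 w <= u] `&` [set w | L1 w <= l]) =
               Q2 ([set w | U2 w <= u] `&` [set w | L2 w <= l])) ->
  forall A : set (R * R), measurable A ->
    Q1 [set w | A (U1 w, L1 w)] = Q2 [set w | A (U2 w, L2 w)].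
Proof.
move=> mU1 mU2 mL1 mL2 h A mA.
have pre d0 (T0 : measurableType d0) (f : T0 -> R) (B : set R) :
    measurable_fun [set: T0] f -> measurable B -> measurable (f @^-1` B).
  by move=> mf mB; rewrite -[X in measurable X]setTI; exact: mf.
have rect B C : measurable B -> measurable C ->
    Q1 (U1 @^-1` B `&` L1 @^-1` C) = Q2 (U2 @^-1` B `&` L2 @^-1` C).
  move=> mB mC; rewrite setIC [in RHS]setIC; apply: slice_unique => //; try exact: pre.
  move=> l; rewrite setIC [in RHS]setIC; apply: slice_unique => //.
  - by apply: (pre _ _ _ `]-oo, l]%classic).
  - by apply: (pre _ _ _ `]-oo, l]%classic).
have mp1 : measurable_fun [set: T1] (fun w => (U1 w, L1 w)) by exact: measurable_fun_pair.
have mp2 : measurable_fun [set: T2] (fun w => (U2 w, L2 w)) by exact: measurable_fun_pair.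
pose m1 := measure_function_pushforward__canonical__measure_function_Measure Q1 mp1.
pose m2 := measure_function_pushforward__canonical__measure_function_Measure Q2 mp2.
suff e12 : m1 A = m2 A by exact: e12.
apply: (@measure_unique _ _ _ [set B `*` C | B in @measurable _ R & C in @measurable _ R]
  (fun=> setT)) => //.
- exact: measurable_prod_measurableType.
- move=> _ _ [B1 mB1 [C1 mC1 <-]] [B2 mB2 [C2 mC2 <-]].
  exists (B1 `&` B2); first exact: measurableI.
  by exists (C1 `&` C2); [exact: measurableI|rewrite setXI].
- by move=> i; exists setT => //; exists setT => //; rewrite setXTT.
- by apply/seteqP; split => // x _; exists 0%N.
- by move=> _ [B mB [C mC <-]]; exact: rect.
- by move=> k; apply: le_lt_trans (probability_le1 Q1 measurableT) (ltry 1).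
Qed.

End joint_law.

(** * Uniqueness for the bivariate Laplace transform *)

Section joint_laplace.
Context {R : realType}.

(** The leading 1 of the step is absorbed into the coefficient of index 0, which thereby vanishes.
    Without a separate constant, products of two steps expand into double sums. *)
Definition laplace_coef (m i : nat) : R := (i == 0%N)%:R - (-1) ^+ i *+ 'C(m, i).

Lemma laplace_step_sum (k m : nat) (y : R) : laplace_step k m y =
  \sum_(i < m.+1) laplace_coef m i * expR (- ((k * i)%N%:R * y)).
Proof.
rewrite laplace_stepE /laplace_coef.
under [RHS]eq_bigr do rewrite mulrBl.
rewrite sumrB; congr (_ - _).
rewrite big_ord_recl/= muln0 mul0r oppr0 expR0 mulr1 big1 ?addr0// => i _.
by rewrite mul0r.
Qed.

Section transforms.
Context {d1 d2 : measure_display} {T1 : measurableType d1} {T2 : measurableType d2}.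
Variables (Q1 : probability T1 R) (Q2 : probability T2 R).
Variables (U1 L1 : T1 -> R) (U2 L2 : T2 -> R).
Hypotheses (mU1 : measurable_fun [set: T1] U1) (mL1 : measurable_fun [set: T1] L1).
Hypotheses (mU2 : measurable_fun [set: T2] U2) (mL2 : measurable_fun [set: T2] L2).
Hypotheses (U1_ge0 : forall w, 0 <= U1 w) (L1_ge0 : forall w, 0 <= L1 w).
Hypotheses (U2_ge0 : forall w, 0 <= U2 w) (L2_ge0 : forall w, 0 <= L2 w).
Hypothesis same_laplace : forall i j : nat,
  mean Q1 (fun w => expR (- (i%:R * U1 w)) * expR (- (j%:R * L1 w))) =
  mean Q2 (fun w => expR (- (i%:R * U2 w)) * expR (- (j%:R * L2 w))).

Lemma mean_laplace_step2 (k m k' m' : nat) :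
  mean Q1 (fun w => laplace_step k m (U1 w) * laplace_step k' m' (L1 w)) =
  mean Q2 (fun w => laplace_step k m (U2 w) * laplace_step k' m' (L2 w)).
Proof.
have expand d0 (T0 : measurableType d0) (Q : probability T0 R) (U L : T0 -> R) :
    measurable_fun [set: T0] U -> measurable_fun [set: T0] L ->
    (forall w, 0 <= U w) -> (forall w, 0 <= L w) ->
    mean Q (fun w => laplace_step k m (U w) * laplace_step k' m' (L w)) =
    \sum_(i < m.+1) \sum_(j < m'.+1) (laplace_coef m i * laplace_coef m' j *
      mean Q (fun w => expR (- ((k * i)%N%:R * U w)) * expR (- ((k' * j)%N%:R * L w)))).
  move=> mU mL U0 L0.
  have be (i : 'I_m.+1) (j : 'I_m'.+1) : bounded_rv (fun w =>
      expR (- ((k * i)%N%:R * U w)) * expR (- ((k' * j)%N%:R * L w))).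
    by apply: bounded_rvM; exact: bounded_rv_expRN.
  have bce (i : 'I_m.+1) (j : 'I_m'.+1) : bounded_rv (fun w => laplace_coef m i * laplace_coef m' j *
      (expR (- ((k * i)%N%:R * U w)) * expR (- ((k' * j)%N%:R * L w)))).
    by apply: bounded_rvM => //; exact: bounded_rv_cst.
  transitivity (mean Q (fun w => \sum_(i < m.+1) \sum_(j < m'.+1) (laplace_coef m i * laplace_coef m' j *
      (expR (- ((k * i)%N%:R * U w)) * expR (- ((k' * j)%N%:R * L w)))))).
    apply: eq_mean => w; rewrite !laplace_step_sum big_distrlr/=.
    by apply: eq_bigr => i _; apply: eq_bigr => j _; ring.
  rewrite mean_sum; last by move=> i; exact: bounded_rv_sum.
  apply: eq_bigr => i _; rewrite mean_sum//; apply: eq_bigr => j _.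
  by rewrite meanZ.
rewrite !expand//; apply: eq_bigr => i _; apply: eq_bigr => j _.
by rewrite same_laplace.
Qed.

(** A product of two steps is, up to a small error, above the indicator of the smaller quadrant and
    below that of the larger one, and its mean is the same under both laws. *)
Lemma joint_ray_le (u l de : R) : 0 <= u -> 0 <= l -> 0 < de ->
  prob Q1 ([set w | U1 w <= u] `&` [set w | L1 w <= l]) <=
  prob Q2 ([set w | U2 w <= u + de] `&` [set w | L2 w <= l + de]).
Proof.
move=> u0 l0 d0; apply/ler_addgt0Pr => e e0.
have dh : 0 < de / 2 by rewrite divr_gt0.
(* The two sides cost 2 e' and e', together at most e. The cap at 1 keeps 1 - e' nonnegative, as
   multiplying the two lower bounds requires. *)
have e3 : 0 < Num.min (e / 3) 1 by rewrite lt_min divr_gt0//=.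
set e' := Num.min (e / 3) 1 in e3.
have e'e : e' <= e / 3 by rewrite ge_min lexx.
have e'1 : e' <= 1 by rewrite ge_min lexx orbT.
have cu : 0 <= u + de / 2 by lra.
have cl : 0 <= l + de / 2 by lra.
have [k [m st1]] := laplace_stepP cu dh e3.
have [k' [m' st2]] := laplace_stepP cl dh e3.
have bU1 := bounded_laplace_step k m mU1 U1_ge0.
have bL1 := bounded_laplace_step k' m' mL1 L1_ge0.
have bU2 := bounded_laplace_step k m mU2 U2_ge0.
have bL2 := bounded_laplace_step k' m' mL2 L2_ge0.
have h1 : prob Q1 ([set w | U1 w <= u] `&` [set w | L1 w <= l]) <=
    mean Q1 (fun w => laplace_step k m (U1 w) * laplace_step k' m' (L1 w)) + 2 * e'.
  apply: mean_indic_le; first exact: bounded_rvM.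
    by apply: measurableI; exact: measurable_le_cst.
  move=> w; have /andP[a0 a1] := laplace_step01 k m (U1_ge0 w).
  have /andP[b0 b1] := laplace_step01 k' m' (L1_ge0 w).
  rewrite indicE; case: (boolP (w \in _)) => [|_] /=; last first.
    by rewrite addr_ge0 ?mulr_ge0// ltW.
  rewrite inE /= => -[Uu Ll].
  have [s1 _] := st1 _ (U1_ge0 w); have [s2 _] := st2 _ (L1_ge0 w).
  have {}s1 : 1 - e' <= laplace_step k m (U1 w) by apply: s1; lra.
  have {}s2 : 1 - e' <= laplace_step k' m' (L1 w) by apply: s2; lra.
  have s3 : (1 - e') * (1 - e') <= laplace_step k m (U1 w) * laplace_step k' m' (L1 w).
    by apply: ler_pM => //; rewrite subr_ge0.
  have e2 : 0 <= e' * e' by rewrite mulr_ge0// ltW.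
  rewrite /= in s3 *; lra.
have h2 : mean Q2 (fun w => laplace_step k m (U2 w) * laplace_step k' m' (L2 w)) <=
    prob Q2 ([set w | U2 w <= u + de] `&` [set w | L2 w <= l + de]) + e'.
  apply: le_mean_indic; first exact: bounded_rvM.
    by apply: measurableI; exact: measurable_le_cst.
  move=> w; have /andP[a0 a1] := laplace_step01 k m (U2_ge0 w).
  have /andP[b0 b1] := laplace_step01 k' m' (L2_ge0 w).
  have ab1 : laplace_step k m (U2 w) * laplace_step k' m' (L2 w) <= 1 by rewrite mulr_ile1.
  rewrite indicE; case: (boolP (w \in _)) => [_|] /=; first lra.
  have [_ s1] := st1 _ (U2_ge0 w); have [_ s2] := st2 _ (L2_ge0 w).
  rewrite notin_setE /= add0r => /not_andP[|] /negP; rewrite -ltNge => h.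
    by apply: le_trans (_ : laplace_step k m (U2 w) <= _); [rewrite ler_piMr|apply: s1; lra].
  by apply: le_trans (_ : laplace_step k' m' (L2 w) <= _); [rewrite ler_piMl|apply: s2; lra].
rewrite mean_laplace_step2 in h1; lra.
Qed.

(** The larger quadrants decrease to the closed one as the enlargement 1 / (n + 1) tends to 0, and
    Q2 is continuous from above. *)
Lemma joint_ray_le0 (u l : R) : 0 <= u -> 0 <= l ->
  (Q1 ([set w | U1 w <= u]%R `&` [set w | L1 w <= l]%R) <=
   Q2 ([set w | U2 w <= u]%R `&` [set w | L2 w <= l]%R))%E.
Proof.
move=> u0 l0.
pose F n := [set w | U2 w <= u + n.+1%:R^-1] `&` [set w | L2 w <= l + n.+1%:R^-1].
have mF n : measurable (F n) by apply: measurableI; exact: measurable_le_cst.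
have mR : measurable ([set w | U1 w <= u] `&` [set w | L1 w <= l]).
  by apply: measurableI; exact: measurable_le_cst.
have capF : \bigcap_n F n = [set w | U2 w <= u] `&` [set w | L2 w <= l].
  apply/seteqP; split => w /=; last first.
    move=> [wu wl] n _; split => /=; [apply: le_trans wu _|apply: le_trans wl _];
      by rewrite lerDl invr_ge0.
  move=> h; split; apply/ler_addgt0Pr => e e0.
    have [n ne] : exists n, n.+1%:R^-1 <= e.
      exists (Num.trunc e^-1); rewrite -[leRHS]invrK lef_pV2 ?posrE ?invr_gt0//.
      exact/ltW/truncnS_gt.
    by have [/= h1 _] := h n I; apply: le_trans h1 _; rewrite lerD2l.
  have [n ne] : exists n, n.+1%:R^-1 <= e.
    exists (Num.trunc e^-1); rewrite -[leRHS]invrK lef_pV2 ?posrE ?invr_gt0//.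
    exact/ltW/truncnS_gt.
  by have [_ /= h1] := h n I; apply: le_trans h1 _; rewrite lerD2l.
have cvgF : (Q2 \o F) x @[x --> \oo] --> Q2 (\bigcap_n F n).
  apply: nonincreasing_cvg_mu => //.
  - by rewrite (le_lt_trans (probability_le1 Q2 (mF 0%N)))// ltry.
  - by rewrite capF; apply: measurableI; exact: measurable_le_cst.
  - move=> n m nm; apply/subsetPset => w [/= h1 h2].
    have nmR : m.+1%:R^-1 <= n.+1%:R^-1 :> R by rewrite lef_pV2 ?posrE// ler_nat ltnS.
    by split => /=; [apply: le_trans h1 _|apply: le_trans h2 _]; rewrite lerD2l.
rewrite -capF; apply: (cvge_ge _ cvgF); apply: nearW => n /=.
rewrite (probE Q1 mR) (probE Q2 (mF n)) lee_fin; apply: joint_ray_le => //.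
Qed.

End transforms.

(** Integer arguments suffice because the steps are polynomials in e^(-u) and e^(-l). Quadrants with
    a negative corner coordinate are empty events; on the others the one-sided bound is used in both
    directions. *)
Lemma joint_laplace_unique d1 (T1 : measurableType d1) d2 (T2 : measurableType d2)
  (Q1 : probability T1 R) (Q2 : probability T2 R) (U1 L1 : T1 -> R) (U2 L2 : T2 -> R) :
  measurable_fun [set: T1] U1 -> measurable_fun [set: T1] L1 ->
  measurable_fun [set: T2] U2 -> measurable_fun [set: T2] L2 ->
  (forall w, 0 <= U1 w) -> (forall w, 0 <= L1 w) ->
  (forall w, 0 <= U2 w) -> (forall w, 0 <= L2 w) ->
  (forall i j : nat,
    mean Q1 (fun w => expR (- (i%:R * U1 w)) * expR (- (j%:R * L1 w))) =
    mean Q2 (fun w => expR (- (i%:R * U2 w)) * expR (- (j%:R * L2 w)))) ->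
  forall A : set (R * R), measurable A ->
    Q1 [set w | A (U1 w, L1 w)] = Q2 [set w | A (U2 w, L2 w)].
Proof.
move=> mU1 mL1 mU2 mL2 U10 L10 U20 L20 h; apply: joint_law_unique => // u l.
have empty d0 (T0 : measurableType d0) (U L : T0 -> R) : (forall w, 0 <= U w) ->
    (forall w, 0 <= L w) -> (u < 0) || (l < 0) ->
    [set w | U w <= u] `&` [set w | L w <= l] = set0.
  move=> U0 L0 ul; apply/seteqP; split => // w [/= Uu Ll].
  by case/orP: ul; apply/negP; rewrite -leNgt; [exact: le_trans Uu|exact: le_trans Ll].
have [u0|u0] := ltP u 0; first by rewrite !empty ?u0// !measure0.
have [l0|l0] := ltP l 0; first by rewrite !empty ?l0 ?orbT// !measure0.
apply/eqP; rewrite eq_le; apply/andP; split; first exact: joint_ray_le0.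
by apply: joint_ray_le0.
Qed.

End joint_laplace.

(** * Laplace transform of the inverse square of a Gaussian variable *)

Section levy.
Context {R : realType}.
Local Notation mu := (@lebesgue_measure R).
Local Notation phi := (@normal_pdf R 0 1).
Local Notation Phi := (@gauss_cdf R).

(** The Radon-Nikodym derivative of the normal law agrees with phi almost everywhere, since both
    integrate to the same value on every measurable set. *)
Lemma integral_std_normal (f : R -> \bar R) :
  measurable_fun [set: R] f -> (forall x, 0 <= f x)%E ->
  (normal_prob 0 1).-integrable [set: R] f ->
  (\int[normal_prob 0 1]_x f x = \int[mu]_x (f x * (phi x)%:E))%E.
Proof.
move=> mf f0 intf.
rewrite -(Radon_Nikodym_change_of_variables (normal_prob_dominates 0 1))//=.
have mphi : measurable_fun [set: R] (fun x => (phi x)%:E).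
  by apply/measurable_EFinP; exact: measurable_normal_pdf.
apply: ae_eq_integral => //.
- apply: emeasurable_funM => //; apply: (measurable_int mu).
  by apply: Radon_Nikodym_integrable; exact: normal_prob_dominates.
- exact: emeasurable_funM.
- apply: ae_eqe_mul2l => /=; rewrite Radon_NikodymE//=; first exact: normal_prob_dominates.
  move=> dom; case: cid => /= h [h1 h2 h3].
  apply: integral_ae_eq => //=.
  by move=> E _ mE; rewrite -h3.
Qed.

Section transform.
Variable q : R.
Hypothesis q0 : 0 < q.

(** The value at 0 is the limit of the formula there, which makes g continuous; the convention 0^-1
    = 0 would instead give phi(0). *)
Let g (z : R) : R := if z == 0 then 0 else phi z * expR (- (q ^+ 2 / (2 * z ^+ 2))).

Let g_ge0 z : 0 <= g z.
Proof. by rewrite /g; case: eqP => // _; rewrite mulr_ge0 ?normal_pdf_ge0 ?expR_ge0. Qed.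

(** From e^(-y) <= 1 / y with y = q^2 / (2 z^2) and the bound of phi by its peak. It yields the
    continuity of g at 0. *)
Let g_le z : g z <= normal_peak 1 * (2 * z ^+ 2 / q ^+ 2).
Proof.
have pk : 0 <= normal_peak (1 : R) by exact: normal_peak_ge0.
rewrite /g; case: eqP => [_|/eqP z0]; first by rewrite mulr_ge0// divr_ge0 ?sqr_ge0// mulr_ge0// sqr_ge0.
have z20 : 0 < z ^+ 2 by rewrite exprn_even_gt0.
have y0 : 0 < q ^+ 2 / (2 * z ^+ 2) by rewrite divr_gt0 ?exprn_gt0// mulr_gt0.
have -> : 2 * z ^+ 2 / q ^+ 2 = (q ^+ 2 / (2 * z ^+ 2))^-1 by rewrite invf_div.
set y := q ^+ 2 / _ in y0 *.
apply: ler_pM; [exact: normal_pdf_ge0|exact: expR_ge0| |].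
  by apply: normal_pdf_ub; rewrite oner_eq0.
rewrite expRN lef_pV2 ?posrE ?expR_gt0//; apply: le_trans (expR_ge1Dx _).
by rewrite lerDr.
Qed.

Let nbhs_neq0 (z : R) : z != 0 -> \forall x \near z, x != 0.
Proof. by move=> z0; exact: (@cvgr_neq0 R _ R (nbhs z) _ id z (@cvg_id _ (nbhs z)) z0). Qed.

Let continuous_g : continuous g.
Proof.
move=> z; have [->|z0] := eqVneq z 0; last first.
  have cg : phi x * expR (- (q ^+ 2 / (2 * x ^+ 2))) @[x --> z] -->
      phi z * expR (- (q ^+ 2 / (2 * z ^+ 2))).
    apply: cvgM; first by apply: continuous_normal_pdf; rewrite oner_eq0.
    apply: (@continuous_comp _ _ _ (fun x : R => - (q ^+ 2 / (2 * x ^+ 2))) expR).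
      apply: cvgN; apply: cvgM; first exact: cvg_cst.
      apply: cvgV; first by rewrite mulf_neq0 ?expf_neq0.
      by apply: cvgM; [exact: cvg_cst|exact: exprn_continuous].
    exact: continuous_expR.
  rewrite /continuous_at [g z]/g (negbTE z0); apply: (cvg_near_eq _ _ cg).
  have nz := nbhs_neq0 z0.
  near=> x; have x0 : x != 0 by near: x.
  by rewrite /g (negbTE x0).
rewrite /continuous_at [g 0]/g eqxx.
have up : normal_peak 1 * (2 * x ^+ 2 / q ^+ 2) @[x --> (0 : R)] --> (0 : R).
  have e : normal_peak 1 * (2 * 0 ^+ 2 / q ^+ 2) = 0 :> R by rewrite expr0n /=; ring.
  rewrite -[X in _ --> X]e.
  apply: cvgM; first exact: cvg_cst; apply: cvgM; last exact: cvg_cst.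
  by apply: cvgM; [exact: cvg_cst|exact: exprn_continuous].
apply: near_cvg => e e0; have h := cvg_near _ up e0; near=> x.
have /andP[_ hx] : 0 - e < normal_peak 1 * (2 * x ^+ 2 / q ^+ 2) < 0 + e by near: x; exact: h.
by apply/andP; split; [rewrite sub0r (le_trans _ (g_ge0 x))// oppr_le0 ltW|
  exact: le_trans (g_le x) (ltW hx)].
Unshelve. all: by end_near. Qed.

(** A closed primitive of g on z > 0. Completing the square, e^(-q) phi(z - q / z) and e^q phi(z + q
    / z) both equal phi(z) e^(-q^2 / (2 z^2)), and the chain-rule factors 1 + q / z^2 and 1 - q /
    z^2 add up to 2. H extends E1 by its right limit e^q / 2 at 0; at infinity the limit is (e^q +
    e^(-q)) / 2. *)
Let E1 (z : R) : R := 2^-1 * (expR (- q) * Phi (z - q / z) + expR q * Phi (z + q / z)).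
Let H (z : R) : R := if z == 0 then 2^-1 * expR q else E1 z.

Let is_derive_E1 (z : R) : 0 < z -> is_derive z (1 : R) E1 (g z).
Proof.
move=> z0; have zN0 : z != 0 by rewrite gt_eqF.
have dV : is_derive z (1 : R) (fun x : R => q / x) (- (q / z ^+ 2)).
  have h := is_deriveV zN0 (is_derive_id z (1 : R)).
  have h2 := @is_deriveZ _ _ _ _ q z 1 _ h.
  by apply: (is_derive_eq h2); rewrite /GRing.scale /=; field.
have dm : is_derive z (1 : R) (fun x : R => x - q / x) (1 + q / z ^+ 2).
  have h := is_deriveB (is_derive_id z (1 : R)) dV.
  by apply: (is_derive_eq h); rewrite opprK.
have dp : is_derive z (1 : R) (fun x : R => x + q / x) (1 - q / z ^+ 2).
  have h := is_deriveD (is_derive_id z (1 : R)) dV.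
  by apply: (is_derive_eq h).
have dPm := @is_derive1_comp R Phi (fun x : R => x - q / x) z _ _ (is_derive_gauss_cdf _) dm.
have dPp := @is_derive1_comp R Phi (fun x : R => x + q / x) z _ _ (is_derive_gauss_cdf _) dp.
have dA := @is_deriveZ _ _ _ _ (expR (- q)) z 1 _ dPm.
have dB := @is_deriveZ _ _ _ _ (expR q) z 1 _ dPp.
have dS := @is_deriveZ _ _ _ _ 2^-1 z 1 _ (is_deriveD dA dB).
apply: (is_derive_eq dS).
rewrite /GRing.scale /= /g (negbTE zN0) !std_normal_pdfE.
set p := normal_peak 1.
have e1 : expR (- q) * expR (- ((z - q / z) ^+ 2 / 2)) =
    expR (- (z ^+ 2 / 2)) * expR (- (q ^+ 2 / (2 * z ^+ 2))).
  by rewrite -!expRD; congr expR; field.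
have e2 : expR q * expR (- ((z + q / z) ^+ 2 / 2)) =
    expR (- (z ^+ 2 / 2)) * expR (- (q ^+ 2 / (2 * z ^+ 2))).
  by rewrite -!expRD; congr expR; field.
transitivity (2^-1 * (p * (expR (- q) * expR (- ((z - q / z) ^+ 2 / 2))) * (1 + q / z ^+ 2) +
   p * (expR q * expR (- ((z + q / z) ^+ 2 / 2))) * (1 - q / z ^+ 2))); first by ring.
by rewrite e1 e2; field.
Qed.

Let integral_g_half : (\int[mu]_(z in `[0%R, +oo[) (g z)%:E = (2^-1 * expR (- q))%:E)%E.
Proof.
have near0 (z : R) : 0 < z -> \forall x \near z, E1 x = H x.
  move=> z0; have nz := nbhs_neq0 (lt0r_neq0 z0); near=> x.
  by rewrite /H ifF//; apply/negbTE; near: x.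
have dH (z : R) : 0 < z -> is_derive z (1 : R) H (g z).
  by move=> z0; apply: near_eq_is_derive (near0 _ z0) (is_derive_E1 z0).
have Vy : q / z @[z --> +oo] --> (0 : R).
  by rewrite -(mulr0 q); apply: cvgM; [exact: cvg_cst|exact: cvg_inv0].
have L1 : z - q / z @[z --> +oo] --> (+oo : set_system R).
  apply/cvgryPgt => A; have h := cvg_near _ Vy (@ltr01 R); near=> z.
  have /andP[_ h1] : 0 - 1 < q / z < 0 + 1 by near: z; exact: h.
  have : A + 1 < z by near: z; apply: nbhs_pinfty_gt; exact: num_real.
  lra.
have L2 : z + q / z @[z --> +oo] --> (+oo : set_system R).
  apply/cvgryPgt => A; have h := cvg_near _ Vy (@ltr01 R); near=> z.
  have /andP[h1 _] : 0 - 1 < q / z < 0 + 1 by near: z; exact: h.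
  have : A + 1 < z by near: z; apply: nbhs_pinfty_gt; exact: num_real.
  lra.
have big A : \forall z \near (0 : R)^'+, A < q / z.
  have A1 : 0 < q / (`|A| + 1) by rewrite divr_gt0// ltr_wpDl.
  near=> z.
  have z0 : 0 < z by near: z; exact: nbhs_right_gt.
  have : z < q / (`|A| + 1) by near: z; exact: nbhs_right_lt.
  rewrite ltr_pdivlMr ?ltr_wpDl// mulrC -ltr_pdivlMr//; apply: lt_trans.
  by have := ler_norm A; lra.
have L3 : z - q / z @[z --> (0 : R)^'+] --> (-oo : set_system R).
  apply/cvgrNyPlt => A; have h := big (1 - A); near=> z.
  have h1 : 1 - A < q / z by near: z; exact: h.
  have : z < 1 by near: z; exact: nbhs_right_lt.
  lra.
have L4 : z + q / z @[z --> (0 : R)^'+] --> (+oo : set_system R).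
  apply/cvgryPgt => A; have h := big A; near=> z.
  have h1 : A < q / z by near: z; exact: h.
  have : 0 < z by near: z; exact: nbhs_right_gt.
  lra.
have lim_y : H z @[z --> +oo] --> 2^-1 * (expR (- q) * 1 + expR q * 1).
  have cE : E1 z @[z --> +oo] --> 2^-1 * (expR (- q) * 1 + expR q * 1).
    apply: cvgM; first exact: cvg_cst.
    apply: cvgD; apply: cvgM; try exact: cvg_cst.
      exact: (cvg_comp _ _ L1 gauss_cdf_cvgy).
    exact: (cvg_comp _ _ L2 gauss_cdf_cvgy).
  apply: (cvg_near_eq _ _ cE); near=> z.
  have z0 : 0 < z by near: z; exact: nbhs_pinfty_gt.
  by rewrite /H gt_eqF.
have lim_0 : H z @[z --> (0 : R)^'+] --> H 0.
  have cE : E1 z @[z --> (0 : R)^'+] --> 2^-1 * (expR (- q) * 0 + expR q * 1).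
    apply: cvgM; first exact: cvg_cst.
    apply: cvgD; apply: cvgM; try exact: cvg_cst.
      exact: (cvg_comp _ _ L3 gauss_cdf_cvgNy).
    exact: (cvg_comp _ _ L4 gauss_cdf_cvgy).
  rewrite mulr0 add0r mulr1 in cE.
  rewrite {2}/H eqxx; apply: (cvg_near_eq _ _ cE); near=> z.
  have z0 : 0 < z by near: z; exact: nbhs_right_gt.
  by rewrite /H gt_eqF.
rewrite (@ge0_continuous_FTC2y R g H 0 (2^-1 * (expR (- q) * 1 + expR q * 1))).
- by rewrite /H eqxx -EFinB; congr EFin; ring.
- by move=> z _; exact: g_ge0.
- by apply: continuous_subspaceT; exact: continuous_g.
- exact: lim_y.
- by move=> z z0; case: (dH z z0).
- exact: lim_0.
- by move=> z; rewrite in_itv/= andbT => z0; rewrite derive1E; case: (dH z z0).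
Unshelve. all: by end_near. Qed.

Lemma levy_laplace :
  mean (normal_prob 0 1) (fun z : R => expR (- (q ^+ 2 / 2 / z ^+ 2))) = expR (- q).
Proof.
have mf : measurable_fun [set: R] (fun z : R => expR (- (q ^+ 2 / 2 / z ^+ 2))).
  apply: measurableT_comp => //; apply: measurableT_comp => //; apply: measurable_funM => //.
  by apply: measurable_fun_inv; exact: measurable_funX.
have bf : bounded_rv (fun z : R => expR (- (q ^+ 2 / 2 / z ^+ 2))).
  apply: bounded_rv01 => // z; rewrite expR_ge0 -[leRHS]expR0 ler_expR oppr_le0.
  by rewrite !divr_ge0 ?sqr_ge0.
apply: EFin_inj; rewrite /mean /Rintegral fineK; last first.
  exact/integrable_fin_num/bounded_rv_integrable.
rewrite integral_std_normal; [|exact/measurable_EFinP|by move=> z; rewrite lee_fin expR_ge0|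
  exact: bounded_rv_integrable].
transitivity (\int[mu]_z (g z)%:E)%E.
  apply: ae_eq_integral => //.
  - apply/measurable_EFinP; apply: measurable_funM => //; exact: measurable_normal_pdf.
  - by apply/measurable_EFinP; apply: continuous_measurable_fun; exact: continuous_g.
  (* The two integrands differ only at z = 0, where the division convention gives the exponential
     the value 1. *)
  - exists [set 0]; split; [exact: measurable_set1|exact: lebesgue_measure_set1|].
    move=> z /= hz; apply/eqP/negPn/negP => z0; apply: hz => _.
    rewrite /g (negbTE z0) -EFinM mulrC; congr (_ * expR (- _))%:E.
    by field.
rewrite ge0_symfun_integralT//.
- rewrite (_ : [set x | 0 <= x] = `[0, +oo[%classic); last first.
    by apply/seteqP; split => x/=; rewrite in_itv/= andbT.
  by rewrite integral_g_half -EFinM mulrA mulfV// mul1r.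
- by move=> z; rewrite /g /= oppr_eq0 sqrrN !std_normal_pdfE sqrrN.
Qed.

End transform.
End levy.

(** * Construction of a limiting vector on a product space *)

Section limit_vectors.
Context {R : realType}.
Local Notation N01 := (@normal_prob R 0 1).

(* With z standard normal, (pi / 2) / z^2 is one-sided 1/2-stable. *)
Definition levy (z : R) : R := pi / 2 / z ^+ 2.

Lemma measurable_levy : measurable_fun [set: R] levy.
Proof. by apply: measurable_funM => //; apply: measurable_fun_inv; exact: measurable_funX. Qed.

Lemma levy_ge0 z : 0 <= levy z.
Proof. by rewrite /levy !divr_ge0 ?sqr_ge0 ?pi_ge0. Qed.

Lemma mean_levy (r : R) : 0 < r ->
  mean N01 (fun z => expR (- (r * levy z))) = expR (- Num.sqrt (r * pi)).
Proof.
move=> r0; have rpi : 0 < r * pi by rewrite mulr_gt0// pi_gt0.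
transitivity (mean N01 (fun z => expR (- (Num.sqrt (r * pi) ^+ 2 / 2 / z ^+ 2)))).
  apply: eq_mean => z; rewrite sqr_sqrtr ?(ltW rpi)//; congr (expR (- _)).
  by rewrite /levy; ring.
by apply: levy_laplace; rewrite sqrtr_gt0.
Qed.

Section existence.
Context {d : measure_display} {T : measurableType d}.
Variables (P : probability T R) (Lambda : {RV P >-> R}).
Hypothesis Lambda_gt0 : P [set w | 0 < Lambda w] = 1%E.
Local Notation TR := (T * measurableTypeR R)%type.
Local Notation P2 := (P \x N01)%E.

Definition limit_U (p : TR) : R := Lambda p.1 ^+ 2 * levy p.2.
Definition limit_L (p : TR) : R := Lambda p.1.

Lemma measurable_limit_L : measurable_fun [set: TR] limit_L.
Proof. by apply: measurableT_comp => //; exact: measurable_fst. Qed.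

Lemma measurable_limit_U : measurable_fun [set: TR] limit_U.
Proof.
apply: measurable_funM; first by apply: measurable_funX; exact: measurable_limit_L.
by apply: (measurableT_comp measurable_levy); exact: measurable_snd.
Qed.

HB.instance Definition _ := @isMeasurableFun.Build _ _ _ _ limit_L measurable_limit_L.
HB.instance Definition _ := @isMeasurableFun.Build _ _ _ _ limit_U measurable_limit_U.

(** Integrating over z at a fixed value of Lambda turns e^(-r Lambda^2 V) into e^(-sqrt(pi r
    Lambda^2)), and the root equals sqrt(pi r) Lambda because Lambda is positive almost surely. *)
Lemma limit_vector_exists : limit_vector Lambda
  (limit_U : {RV P2 >-> R}) (limit_L : {RV P2 >-> R}).
Proof.
split.
- rewrite (_ : [set w | _] = setT) ?probability_setT//.
  by apply/seteqP; split => // p _ /=; rewrite mulr_ge0 ?sqr_ge0// levy_ge0.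
- move=> A mA; rewrite /distribution /pushforward.
  have -> : limit_L @^-1` A = (Lambda @^-1` A) `*` [set: measurableTypeR R].
    by apply/seteqP; split => [p|p []].
  transitivity (P (Lambda @^-1` A) * N01 [set: measurableTypeR R])%E.
    by apply: product_measure1E => //; exact: measurable_funPTI.
  by have -> := probability_setT N01; rewrite mule1.
move=> r s r0 s0; rewrite unlock.
have m1 : measurable_fun [set: TR] (fun p => (expR (- r * limit_U p - s * limit_L p))%:E).
  apply/measurable_EFinP; apply: measurableT_comp => //; apply: measurable_funB.
    by apply: measurable_funM => //; exact: measurable_limit_U.
  by apply: measurable_funM => //; exact: measurable_limit_L.
have m2 : measurable_fun [set: TR] (fun p => (expR (- (s + Num.sqrt (r * pi)) * limit_L p))%:E).
  apply/measurable_EFinP; apply: measurableT_comp => //.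
  by apply: measurable_funM => //; exact: measurable_limit_L.
have ge1 p : (0 <= (expR (- r * limit_U p - s * limit_L p))%:E)%E.
  by rewrite lee_fin expR_ge0.
have ge2 p : (0 <= (expR (- (s + Num.sqrt (r * pi)) * limit_L p))%:E)%E.
  by rewrite lee_fin expR_ge0.
apply: (etrans (@fubini_tonelli1 _ _ _ _ _ P N01 _ m1 ge1)).
apply: (etrans _ (esym (@fubini_tonelli1 _ _ _ _ _ P N01 _ m2 ge2))).
have mF1 := @measurable_fun_fubini_tonelli_F _ _ _ _ _ N01 _ m1 ge1.
have mF2 := @measurable_fun_fubini_tonelli_F _ _ _ _ _ N01 _ m2 ge2.
apply: ae_eq_integral; [exact: measurableT|exact: mF1|exact: mF2|].
have mL : measurable [set w | 0 < Lambda w] by exact: measurable_set_lt.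
exists (~` [set w | 0 < Lambda w]); split; first exact: measurableC.
  by have /= -> := probability_setC P mL; rewrite Lambda_gt0 subee.
move=> w /= hw Lw; apply: hw => _; rewrite /fubini_F /= /limit_U /limit_L /=.
have be (t : R) : 0 <= t -> bounded_rv (fun z : measurableTypeR R => expR (- (t * levy z))).
  by move=> t0; apply: bounded_rv_expRN => //; [exact: measurable_levy|exact: levy_ge0].
transitivity (expR (- s * Lambda w) * mean N01 (fun z => expR (- (r * Lambda w ^+ 2 * levy z))))%:E.
  have t0 : 0 <= r * Lambda w ^+ 2 by rewrite mulr_ge0 ?sqr_ge0 ?(ltW r0).
  have bb := bounded_rvM (bounded_rv_cst (expR (- s * Lambda w))) (be _ t0).
  rewrite -meanZ; last exact: be.
  rewrite /mean /Rintegral fineK; last exact/integrable_fin_num/bounded_rv_integrable.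
  apply: eq_integral => z _; rewrite -expRD; congr (expR _)%:E; ring.
rewrite mean_levy; last by rewrite mulr_gt0// exprn_gt0.
rewrite integral_cst//= probability_setT mule1; congr EFin.
rewrite -expRD; congr expR.
have -> : r * Lambda w ^+ 2 * pi = r * pi * Lambda w ^+ 2 by ring.
rewrite sqrtrM ?mulr_ge0 ?(ltW r0) ?pi_ge0// sqrtr_sqr gtr0_norm//; ring.
Qed.

Lemma prob_limit_ratio (x : R) : 0 < x ->
  P2 [set p | Num.sqrt (limit_U p) / limit_L p <= x] =
  N01 [set z | levy z <= x ^+ 2].
Proof.
move=> x0.
have mL : measurable [set w | 0 < Lambda w] by exact: measurable_set_lt.
have mV : measurable [set z : measurableTypeR R | levy z <= x ^+ 2].
  by apply: measurable_le_cst; exact: measurable_levy.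
have mRat : measurable [set p | Num.sqrt (limit_U p) / limit_L p <= x].
  apply: measurable_le_cst; apply: measurable_funM.
    apply: measurableT_comp; last exact: measurable_limit_U.
    by apply: continuous_measurable_fun; exact: sqrt_continuous.
  by apply: measurable_fun_inv; exact: measurable_limit_L.
have mLp : measurable ([set w | 0 < Lambda w] `*` [set: measurableTypeR R]) by exact: measurableX.
have PL : P2 ([set w | 0 < Lambda w] `*` [set: measurableTypeR R]) = 1%E.
  transitivity (P [set w | 0 < Lambda w]%R * N01 [set: measurableTypeR R])%E.
    exact: product_measure1E.
  by have -> := probability_setT N01; rewrite mule1.
have key p : 0 < Lambda p.1 ->
    (Num.sqrt (limit_U p) / limit_L p <= x) = (levy p.2 <= x ^+ 2).
  move=> Lp; rewrite /limit_U sqrtrM ?sqr_ge0// sqrtr_sqr gtr0_norm// /limit_L.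
  rewrite mulrAC mulfV ?gt_eqF// mul1r.
  rewrite -{2}(sqr_sqrtr (levy_ge0 p.2)) ler_pXn2r// nnegrE ?sqrtr_ge0//; exact: ltW.
transitivity (P2 ([set: T] `*` [set z | levy z <= x ^+ 2]%R)).
  apply: (prob_ae_iff (P := P2) mRat _ mLp PL); first exact: measurableX.
  by move=> p [/= Lp _]; split; [move=> h; split => //; rewrite -key|move=> [_ h]; rewrite key].
transitivity (P [set: T] * N01 [set z | levy z <= x ^+ 2]%R)%E.
  exact: product_measure1E.
by rewrite probability_setT mul1e.
Qed.

End existence.
End limit_vectors.

(** * Uniqueness of the law of the limiting vector *)

Section limit_vector_law.
Context {R : realType}.
Local Notation N01 := (@normal_prob R 0 1).
Context {d : measure_display} {T : measurableType d}.
Variables (P : probability T R) (Lambda : {RV P >-> R}).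
Hypothesis Lambda_gt0 : P [set w | 0 < Lambda w] = 1%E.

Lemma limit_vector_gt0 d' (T' : measurableType d') (Q : probability T' R)
  (U L : {RV Q >-> R}) : limit_vector Lambda U L -> Q [set w | 0 < L w] = 1%E.
Proof.
move=> [_ LL _]; have := LL `]0, +oo[%classic (measurable_itv _).
rewrite /distribution /pushforward.
have e d0 (T0 : measurableType d0) (W : T0 -> R) :
    W @^-1` `]0, +oo[ = [set w | 0 < W w].
  by apply/seteqP; split => w /=; rewrite in_itv/= andbT.
by rewrite !e Lambda_gt0.
Qed.

(** The right-hand side involves Lambda alone, so any two versions of the vector share these
    transforms. Absolute values provide signs at every point and change nothing almost surely. *)
Lemma limit_vector_laplace d' (T' : measurableType d') (Q : probability T' R)
  (U L : {RV Q >-> R}) (i j : nat) : limit_vector Lambda U L ->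
  mean Q (fun w => expR (- (i%:R * `|U w|)) * expR (- (j%:R * `|L w|))) =
  mean P (fun w => expR (- ((j%:R + Num.sqrt (i%:R * pi)) * `|Lambda w|))).
Proof.
move=> lv; have L0 := limit_vector_gt0 lv; case: lv => U0 LL lap.
have mU : measurable_fun [set: T'] (fun w => `|U w|) by exact: measurableT_comp.
have mL : measurable_fun [set: T'] (fun w => `|L w|) by exact: measurableT_comp.
have sq0 : 0 <= Num.sqrt (i%:R * pi) :> R by exact: sqrtr_ge0.
have mLaw : mean Q (fun w => expR (- ((j%:R + Num.sqrt (i%:R * pi)) * `|L w|))) =
    mean P (fun w => expR (- ((j%:R + Num.sqrt (i%:R * pi)) * `|Lambda w|))).
  apply: (@identically_distributed_mean _ _ _ _ _ _ _ _ _
    (fun x => expR (- ((j%:R + Num.sqrt (i%:R * pi)) * `|x|)))) => //.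
  apply: measurableT_comp => //; apply: measurableT_comp => //.
  by apply: measurable_funM.
(* The prescribed identity is for r > 0; at i = 0 both sides reduce to the transform of |L|. *)
rewrite -mLaw; case: i sq0 {mLaw} => [|i] sq0.
  by apply: eq_mean => w; rewrite !mul0r oppr0 expR0 mul1r sqrtr0 addr0.
have bUL : bounded_rv (fun w => expR (- (i.+1%:R * `|U w|)) * expR (- (j%:R * `|L w|))).
  by apply: bounded_rvM; exact: bounded_rv_expRN.
have bL : bounded_rv (fun w => expR (- ((j%:R + Num.sqrt (i.+1%:R * pi)) * `|L w|))).
  by apply: bounded_rv_expRN => //; rewrite addr_ge0.
apply: EFin_inj; rewrite -!expectation_mean//.
have := lap i.+1%:R j%:R (ltr0Sn _ _) (ler0n _ _).
pose D := [set w | 0 <= U w] `&` [set w | 0 < L w].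
have mUge : measurable [set w | 0 <= U w].
  by rewrite -[X in measurable X]setTI; apply: measurable_fun_le.
have mLgt : measurable [set w | 0 < L w] by exact: measurable_set_lt.
have mD : measurable D by exact: measurableI.
have PD : Q D = 1%E by exact: prob_setI1.
have ae (f g : T' -> R) : measurable_fun [set: T'] f -> measurable_fun [set: T'] g ->
    (forall w, D w -> f w = g w) -> ('E_Q[f] = 'E_Q[g])%E.
  move=> mf mg fg; rewrite unlock; apply: ae_eq_integral => //; try exact/measurable_EFinP.
  exists (~` D); split; first exact: measurableC.
    by have /= -> := probability_setC Q mD; rewrite PD subee.
  by move=> w /= h Dw; apply: h => _; rewrite fg.
rewrite (ae _ (fun w => expR (- (i.+1%:R * `|U w|)) * expR (- (j%:R * `|L w|)))).
- move=> ->; apply: ae.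
  + by apply: measurableT_comp => //; apply: measurable_funM.
  + by case: bL.
  + by move=> w [/= U0w L0w]; rewrite (gtr0_norm L0w) mulNr.
- apply: measurableT_comp => //; apply: measurable_funB; exact: measurable_funM.
- by case: bUL.
- by move=> w [/= U0w L0w]; rewrite (gtr0_norm L0w) (ger0_norm U0w) -expRD mulNr.
Qed.

(** The pair (|U|, |L|) has the same joint law as in the explicit construction, and the event is a
    Borel condition on this pair; in the construction Lambda cancels from the ratio. *)
Lemma limit_vector_ratio d' (T' : measurableType d') (Q : probability T' R)
  (U L : {RV Q >-> R}) (x : R) : limit_vector Lambda U L -> 0 < x ->
  Q [set w | Num.sqrt (U w) / L w <= x] = N01 [set z | levy z <= x ^+ 2].
Proof.
move=> lv x0; have lv' := limit_vector_exists Lambda_gt0.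
rewrite -(prob_limit_ratio Lambda_gt0 x0).
have msq : measurable_fun [set: R] (@Num.sqrt R).
  by apply: continuous_measurable_fun; exact: sqrt_continuous.
pose A := [set p : R * R | Num.sqrt p.1 / p.2 <= x].
have mA : measurable A.
  apply: measurable_le_cst; apply: measurable_funM.
    by apply: measurableT_comp => //; exact: measurable_fst.
  by apply: measurable_fun_inv; exact: measurable_snd.
have absE d0 (T0 : measurableType d0) (Q0 : probability T0 R) (U0 L0 : {RV Q0 >-> R}) :
    limit_vector Lambda U0 L0 ->
    Q0 [set w | Num.sqrt (U0 w) / L0 w <= x] = Q0 [set w | A (`|U0 w|, `|L0 w|)].
  move=> lv0; have L0gt := limit_vector_gt0 lv0; case: lv0 => U0ge _ _.
  have mUge : measurable [set w | 0 <= U0 w].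
    by rewrite -[X in measurable X]setTI; apply: measurable_fun_le.
  have mLgt : measurable [set w | 0 < L0 w] by exact: measurable_set_lt.
  have mU0 : measurable_fun [set: T0] (fun w => `|U0 w|) by exact: measurableT_comp.
  have mL0 : measurable_fun [set: T0] (fun w => `|L0 w|) by exact: measurableT_comp.
  apply: (prob_ae_iff _ _ (measurableI _ _ mUge mLgt) (prob_setI1 mUge mLgt U0ge L0gt)).
  - apply: measurable_le_cst; apply: measurable_funM; first exact: measurableT_comp.
    exact: measurable_fun_inv.
  - apply: measurable_le_cst; apply: measurable_funM.
      exact: (measurableT_comp msq mU0).
    exact: (measurable_fun_inv mL0).
  - by move=> w [/= u l]; rewrite /A /= (gtr0_norm l) (ger0_norm u).
rewrite (absE _ _ _ _ _ lv) [RHS](absE _ _ _ _ _ lv').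
apply: joint_laplace_unique => //; try by apply: measurableT_comp.
by move=> i j; rewrite !limit_vector_laplace.
Qed.

End limit_vector_law.

(** * Equivalence of the integrated slowly varying function with the integrated tail *)

Section integrated_tail.
Context {R : realType}.
Local Notation mu := (@lebesgue_measure R).
Variables (b l : R -> R).
Hypothesis b_gt0 : forall x, 0 < b x.
Hypothesis b_le1 : forall x, b x <= 1.
Hypothesis b_noninc : forall x y, x <= y -> b y <= b x.
Hypothesis b_rv : forall c, 0 < c -> b (c * x) / b x @[x --> +oo] --> c^-1.
Local Notation G := (tail_integral b).
Hypothesis G_infty : G x @[x --> +oo] --> +oo.
Hypothesis b_l : b x / (x^-1 * l x) @[x --> +oo] --> (1 : R).
Hypothesis l_int : forall x : R, 0 < x ->
  mu.-integrable `]0, x] (fun u : R => (l u / u)%:E).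

Lemma l_tilde_diff (x y : R) : 0 < x -> x <= y ->
  l_tilde l y - l_tilde l x = \int[mu]_(u in `]x, y]) (l u / u).
Proof.
move=> x0 xy; have := @Rintegral_itvB R (fun u => l u / u) (BRight 0) (BRight y) x
  (l_int (lt_le_trans x0 xy)).
by rewrite !bnd_simp => /(_ (ltW x0) xy).
Qed.

(** Beyond x0 the integrands l(u) / u and b(u) agree up to a factor within e / 2 of 1, hence so do
    the increments of the integrals. The part over ]0, x0] is a fixed number, negligible because G
    tends to infinity. *)
Lemma l_tilde_tail_integral : l_tilde l x / G x @[x --> +oo] --> (1 : R).
Proof.
apply: near_cvg => e e0.
have e20 : 0 < e / 2 by rewrite divr_gt0.
have r1 : x^-1 * l x / b x @[x --> +oo] --> (1 : R).
  have h : (b x / (x^-1 * l x))^-1 @[x --> +oo] --> (1 : R).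
    by rewrite -[X in _ --> X]invr1; apply: cvgV.
  by apply: (cvg_near_eq _ _ h); apply: nearW => x; rewrite invf_div.
have [x1 [_ h1]] := cvg_near _ r1 e20.
pose x0 := Num.max (x1 + 1) 1.
have x00 : 0 < x0 by rewrite lt_max ltr01 orbT.
have x01 : x1 < x0 by rewrite lt_max ltrDl ltr01.
have lb u : x0 <= u -> (1 - e / 2) * b u <= l u / u <= (1 + e / 2) * b u.
  move=> u0; have /h1 /andP[h2 h3] : x1 < u by exact: lt_le_trans u0.
  rewrite [l u / u]mulrC; move: h2 h3; rewrite ltr_pdivlMr// ltr_pdivrMr// => /ltW h2 /ltW h3.
  by apply/andP.
(* K bounds all contributions frozen at x0; asking G(x) > 2 K / e lets them consume the remaining e
   / 2. *)
pose K := `|l_tilde l x0| + (1 + e / 2) * G x0.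
have Kgt : \forall x \near +oo, K / (e / 2) < G x.
  by apply: (@G_infty [set y : R | K / (e / 2) < y]); apply: nbhs_pinfty_gt; exact: num_real.
have Gx0 : 0 < G x0 by exact: tail_integral_gt0.
have K0 : 0 <= K by rewrite addr_ge0// mulr_ge0 ?(ltW Gx0)//; lra.
near=> x.
have x0x : x0 <= x by near: x; apply: nbhs_pinfty_ge; exact: num_real.
have Gx : K / (e / 2) < G x by near: x; exact: Kgt.
have Gx_gt0 : 0 < G x by apply: tail_integral_gt0 => //; exact: lt_le_trans x0x.
have ib : mu.-integrable `]x0, x] (EFin \o b).
  apply: integrableS (integrable_tail b_gt0 b_le1 b_noninc x) => //.
  by apply: subset_itvr; rewrite bnd_simp ltW.
have il : mu.-integrable `]x0, x] (EFin \o (fun u => l u / u)).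
  apply: integrableS (l_int (lt_le_trans x00 x0x)) => //.
  by apply: subset_itvr; rewrite bnd_simp ltW.
have ibc c : mu.-integrable `]x0, x] (EFin \o (fun u => c * b u)).
  exact: (integrableZl _ _ ib).
have Gd : G x - G x0 = \int[mu]_(u in `]x0, x]) b u.
  have := @Rintegral_itvB R b (BRight 0) (BRight x) x0
    (integrable_tail b_gt0 b_le1 b_noninc x).
  by rewrite !bnd_simp => /(_ (ltW x00) x0x).
have up : l_tilde l x - l_tilde l x0 <= (1 + e / 2) * (G x - G x0).
  rewrite l_tilde_diff// Gd -RintegralZl//; apply: le_Rintegral => // u.
  by rewrite /= in_itv/= => /andP[/ltW /lb /andP[]].
have lo : (1 - e / 2) * (G x - G x0) <= l_tilde l x - l_tilde l x0.
  rewrite l_tilde_diff// Gd -RintegralZl//; apply: le_Rintegral => // u.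
  by rewrite /= in_itv/= => /andP[/ltW /lb /andP[]].
have KG : K <= e / 2 * G x by rewrite mulrC -ler_pdivrMr//; exact: ltW.
have a1 := ler_norm (l_tilde l x0); have a2 := ler_norm (- l_tilde l x0); rewrite normrN in a2.
have eG : 0 <= e / 2 * G x0 by rewrite mulr_ge0 ?ltW.
move: KG; rewrite /K => KG.
by rewrite ler_pdivlMr// ler_pdivrMr//; apply/andP; split; lra.
Unshelve. all: by end_near. Qed.

(** Continuity supplies the measurability contained in slow variation. Around x the integral is
    started at x / 2, away from the endpoint 0. *)
Lemma continuous_l_tilde : {in `]0, +oo[%classic, continuous (l_tilde l)}.
Proof.
move=> x; rewrite inE /= in_itv/= andbT => x0.
have xh : 0 < x / 2 by rewrite divr_gt0.
have xx : x / 2 <= x + 1 by lra.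
have int : mu.-integrable `[(x / 2), (x + 1)] (EFin \o (fun u => l u / u)).
  have x10 : 0 < x + 1 by lra.
  apply: integrableS (l_int x10) => //.
  by move=> u /=; rewrite !in_itv/= => /andP[h1 ->]; rewrite andbT; lra.
have [] := (continuous_within_itvP _ _).1 (parameterized_integral_continuous xx int); first lra.
move=> cin _ _.
have xin : x \in `](x / 2), (x + 1)[ by rewrite in_itv/=; apply/andP; split; lra.
have cx := cin x xin.
have cE : l_tilde l (x / 2) + \int[mu]_(u in `[x / 2, y]) (l u / u) @[y --> x] -->
    l_tilde l (x / 2) + \int[mu]_(u in `[x / 2, x]) (l u / u).
  by apply: cvgD; [exact: cvg_cst|exact: cx].
have key y : x / 2 <= y -> y <= x + 1 ->
    l_tilde l (x / 2) + \int[mu]_(u in `[x / 2, y]) (l u / u) = l_tilde l y.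
  move=> y1 y2; rewrite -Rintegral_itv_obnd_cbnd.
    by rewrite -l_tilde_diff// addrC subrK.
  apply: integrableS int => //; move=> u /=; rewrite !in_itv/= => /andP[h1 h2].
  by rewrite (ltW h1) (le_trans h2).
rewrite /continuous_at -(key x); [|lra|lra].
apply: (cvg_near_eq _ _ cE); near=> y; apply: key.
  by apply/ltW; near: y; apply: lt_nbhsr; lra.
by apply/ltW; near: y; apply: lt_nbhsl; lra.
Unshelve. all: by end_near. Qed.

Lemma l_tilde_slowly_varying : slowly_varying (l_tilde l).
Proof.
have posG : \forall x \near +oo, 0 < G x.
  by near=> x; apply: tail_integral_gt0 => //; near: x; exact: nbhs_pinfty_gt.
have h := l_tilde_tail_integral.
split.
- by apply: open_continuous_measurable_fun; [exact: interval_open|exact: continuous_l_tilde].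
- have h1 := cvg_near _ h (@ltr01 R); near=> x.
  have /andP[h2 _] : 1 - 1 < l_tilde l x / G x < 1 + 1 by near: x; exact: h1.
  have Gx : 0 < G x by near: x; exact: posG.
  by move: h2; rewrite subrr ltr_pdivlMr// mul0r.
move=> c c0.
have cy : c * x @[x --> +oo] --> (+oo : set_system R) by apply: gt0_cvgMry.
have h1 := cvg_comp _ _ cy h.
have h2 := tail_integral_slow b_gt0 b_le1 b_noninc b_rv c0.
have h3 : (l_tilde l x / G x)^-1 @[x --> +oo] --> (1 : R).
  by rewrite -[X in _ --> X]invr1; apply: cvgV.
have h4 : l_tilde l (c * x) / G (c * x) * (G (c * x) / G x) * (l_tilde l x / G x)^-1
    @[x --> +oo] --> (1 * 1 * 1 : R).
  by apply: cvgM => //; apply: cvgM.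
rewrite !mulr1 in h4.
have cGpos : \forall x \near +oo, 0 < G (c * x) by exact: (cy _ posG).
apply: (cvg_near_eq _ _ h4); near=> x => /=.
have Gx : 0 < G x by near: x; exact: posG.
have Gcx : 0 < G (c * x) by near: x; exact: cGpos.
by rewrite invf_div mulrA divfK ?gt_eqF// mulrA divfK ?gt_eqF.
Unshelve. all: by end_near. Qed.

End integrated_tail.

(** * Continuity points and tightness of N(t) / t *)

Section tightness.
Context {R : realType} {d : measure_display} {T : measurableType d}.
Variables (P : probability T R) (Y : {RV P >-> R}).

(** The oscillation of the distribution function around x is at most the mass of a shrinking
    interval ]x - 1 / (n + 1), x + 1 / (n + 1)], which tends to the mass of x by continuity from
    above. *)
Lemma cdf_continuity_point (x : R) : pmf Y x = 0 ->
  P [set w | Y w <= y] @[y --> x] --> P [set w | Y w <= x].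
Proof.
move=> px.
have mle y : measurable [set w | Y w <= y] by exact: measurable_le_cst.
have mlt y : measurable [set w | y < Y w] by exact: measurable_set_lt.
pose F n := [set w | x - n.+1%:R^-1 < Y w] `&` [set w | Y w <= x + n.+1%:R^-1].
have mF n : measurable (F n) by exact: measurableI.
have capF : \bigcap_n F n = Y @^-1` [set x].
  apply/seteqP; split => w /=; last first.
    move=> Yx n _; split => /=; rewrite Yx; first by rewrite ltrBlDr ltrDl invr_gt0.
    by rewrite lerDl invr_ge0.
  move=> h; have small (e : R) : 0 < e -> exists n, n.+1%:R^-1 <= e.
    move=> e0; exists (Num.trunc e^-1); rewrite -[leRHS]invrK lef_pV2 ?posrE ?invr_gt0//.
    exact/ltW/truncnS_gt.
  apply/eqP; rewrite eq_le; apply/andP; split; apply/ler_addgt0Pr => e /small[n ne].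
    by have [_ /= h1] := h n I; apply: le_trans h1 _; rewrite lerD2l.
  by have [/= h1 _] := h n I; rewrite -lerBlDr; apply: le_trans (ltW h1); rewrite lerB.
have cvgF : (P \o F) n @[n --> \oo] --> P (\bigcap_n F n).
  apply: nonincreasing_cvg_mu => //.
  - by rewrite (le_lt_trans (probability_le1 P (mF 0%N)))// ltry.
  - by rewrite capF; exact: measurable_funPTI.
  - move=> n m nm; apply/subsetPset => w [/= h1 h2].
    have nmR : m.+1%:R^-1 <= n.+1%:R^-1 :> R by rewrite lef_pV2 ?posrE// ler_nat ltnS.
    by split => /=; [apply: le_lt_trans h1; rewrite lerB|apply: le_trans h2 _; rewrite lerD2l].
have PF0 : P (\bigcap_n F n) = 0%E.
  rewrite capF; have mx : measurable (Y @^-1` [set x]) by exact: measurable_funPTI.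
  by rewrite (probE P mx); congr EFin; exact: px.
rewrite PF0 in cvgF.
have cvgF' : prob P (F n) @[n --> \oo] --> (0 : R).
  by have /fine_cvgP[] := cvgF.
rewrite (probE P (mle x)); under eq_fun do rewrite (probE P (mle _)).
apply: cvg_EFin; first exact: nearW.
apply/cvgrPdist_le => e e0.
have /cvgrPdist_le /(_ _ e0) [n0 _ /(_ n0 (leqnn n0)) /= he] := cvgF'.
rewrite sub0r normrN ger0_norm ?prob_ge0// in he.
have n1 : 0 < n0.+1%:R^-1 :> R by rewrite invr_gt0.
near=> y => /=.
have xy : `|x - y| < n0.+1%:R^-1 by near: y; exact: (cvgr_dist_lt _ _ (@cvg_id _ (nbhs x))).
apply: le_trans he.
move: xy; rewrite ltr_norml => /andP[xy1 xy2].
have diff u v : x - n0.+1%:R^-1 < u -> u <= v -> v <= x + n0.+1%:R^-1 ->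
    prob P [set w | Y w <= v] - prob P [set w | Y w <= u] <= prob P (F n0).
  move=> u1 uv v1; rewrite lerBlDl; apply: le_trans (probU P (mle u) (mF n0)).
  apply: le_prob => //; first exact: measurableU.
  move=> w /= Yv; have [Yu|Yu] := leP (Y w) u; [by left|right; split => /=].
    exact: lt_trans Yu.
  exact: le_trans v1.
have mono u v : u <= v -> prob P [set w | Y w <= u] <= prob P [set w | Y w <= v].
  by move=> uv; apply: le_prob => // w /= /le_trans; apply.
have [yx|yx] := leP y x.
  rewrite ger0_norm ?subr_ge0 ?mono//; apply: diff => //.
    by rewrite ltrBlDr -ltrBlDl.
  by rewrite lerDl ltW.
rewrite distrC ger0_norm ?subr_ge0 ?mono ?(ltW yx)//; apply: diff.
- by rewrite ltrBlDr ltrDl.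
- exact: ltW.
- by rewrite -lerBlDl -opprB lerNl ltW.
Unshelve. all: by end_near. Qed.

(** The atoms form a countable set, of Lebesgue measure 0, which cannot cover an interval. *)
Lemma exists_continuity_point (u v : R) : u < v -> exists2 x, u < x < v & pmf Y x = 0.
Proof.
move=> uv; apply: contrapT => h.
have sub : `]u, v[%classic `<=` [set r | 0 < pmf Y r].
  move=> r /=; rewrite in_itv/= => uvr; rewrite lt_neqAle pmf_ge0 andbT.
  by apply/eqP => pr; apply: h; exists r.
have c0 := countable_lebesgue_measure0 (pmf_gt0_countable Y).
have ms : measurable [set r | 0 < pmf Y r].
  by apply: countable_measurable => //; exact: (pmf_gt0_countable Y).
have : (@lebesgue_measure R `]u, v[%classic <= @lebesgue_measure R [set r | (0 < pmf Y r)%R])%E.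
  by apply: le_measure; rewrite ?inE.
rewrite c0 lebesgue_measure_itv /= lte_fin uv -EFinB lee_fin leNgt subr_gt0 uv//.
Qed.

End tightness.

(** Positivity of Lambda gives the lower end: P(Lambda <= m) is small for small m by right
    continuity of the cdf at 0. Both m and M avoid the atoms of Lambda, so that convergence holds
    there; two tails and two convergence errors account for four times eps / 4. *)
Lemma D_averages_tight {R : realType} d (T : measurableType d) d' (T' : measurableType d')
  (P : probability T R) (N : R -> {RV P >-> nat}) (P' : probability T' R)
  (Lambda : {RV P' >-> R}) (eps : R) : D_averages_in_time N Lambda -> 0 < eps ->
  exists m M : R, 0 < m /\ m < M /\ \forall t \near +oo,
    1 - eps <= prob P [set w | m * t <= (N t w)%:R <= M * t].
Proof.
move=> [L0 cvgN] e0.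
have e4 : 0 < eps / 4 by rewrite divr_gt0.
have mle y : measurable [set w | Lambda w <= y] by exact: measurable_le_cst.
have mN t : measurable_fun [set: T] (fun w => (N t w)%:R / t : R).
  apply: measurable_funM => //.
  by apply: (measurableT_comp (f := fun n : nat => n%:R : R)) => //.
have mNle t y : measurable [set w | (N t w)%:R / t <= y] by exact: measurable_le_cst.
have cdfE y : cdf Lambda y = P' [set w | Lambda w <= y].
  suff -> : [set w | Lambda w <= y] = Lambda @^-1` `]-oo, y]%classic by [].
  by apply/seteqP; split => w /=; rewrite in_itv.
have cdf0 : cdf Lambda 0 = 0%E.
  rewrite cdfE (_ : [set w | _] = ~` [set w | 0 < Lambda w]); last first.
    by apply/seteqP; split => w /=; rewrite leNgt => /negP.
  have mL : measurable [set w | 0 < Lambda w] by exact: measurable_set_lt.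
  have mcL := measurableC mL; rewrite (probE P' mcL) (probC P' mL) /prob; congr EFin.
  by rewrite [P' _]L0 subrr.
have pc x : pmf Lambda x = 0 -> prob P [set w | (N t w)%:R / t <= x] @[t --> +oo] -->
    prob P' [set w | Lambda w <= x].
  move=> px; have := cvgN x (cdf_continuity_point px).
  rewrite (probE P' (mle x)).
  by move=> /fine_cvgP[].
have [m [m0 [pm Pm]]] : exists m, 0 < m /\ pmf Lambda m = 0 /\
    prob P' [set w | Lambda w <= m] < eps / 4.
  have rc := @cdf_right_continuous _ _ _ _ Lambda 0.
  have rc' : prob P' [set w | Lambda w <= y] @[y --> (0 : R)^'+] --> (0 : R).
    move: rc; rewrite cdf0 => rc.
    have : P' [set w | Lambda w <= y] @[y --> (0 : R)^'+] --> 0%:E.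
      by rewrite -(funext cdfE : cdf Lambda = _).
    by move=> /fine_cvgP[].
  have h := cvg_near _ rc' e4.
  near (0 : R)^'+ => y.
  have y0 : 0 < y by near: y; exact: nbhs_right_gt.
  have /andP[_ Py] : 0 - eps / 4 < prob P' [set w | Lambda w <= y] < 0 + eps / 4.
    by near: y; exact: h.
  have [m /andP[m0 my] pm] := exists_continuity_point Lambda y0.
  exists m; split => //; split => //; rewrite add0r in Py; apply: le_lt_trans Py.
  by apply: le_prob => // w /= /le_trans; apply; exact: ltW.
have [M [mM [pM PM]]] : exists M, m < M /\ pmf Lambda M = 0 /\
    1 - eps / 4 < prob P' [set w | Lambda w <= M].
  have c1 := @cvg_cdfy1 _ _ _ _ Lambda.
  have c1' : prob P' [set w | Lambda w <= y] @[y --> +oo] --> (1 : R).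
    have : P' [set w | Lambda w <= y] @[y --> +oo] --> 1%:E.
      by rewrite -(funext cdfE : cdf Lambda = _).
    by move=> /fine_cvgP[].
  have h := cvg_near _ c1' e4.
  near (+oo : set_system R) => y.
  have /andP[Py _] : 1 - eps / 4 < prob P' [set w | Lambda w <= y] < 1 + eps / 4.
    by near: y; exact: h.
  have ym : m < y by near: y; apply: nbhs_pinfty_gt; exact: num_real.
  have yy : y < y + 1 by rewrite ltrDl.
  have [M /andP[yM _] pM] := exists_continuity_point Lambda yy.
  exists M; split; first exact: lt_trans yM.
  split => //; apply: lt_le_trans Py _.
  by apply: le_prob => // w /= /le_trans; apply; exact: ltW.
exists m, M; split => //; split => //.
have hm := cvg_near _ (pc _ pm) e4; have hM := cvg_near _ (pc _ pM) e4.
near=> t.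
have t0 : 0 < t by near: t; exact: nbhs_pinfty_gt.
have /andP[_ h1] : prob P' [set w | Lambda w <= m] - eps / 4 <
  prob P [set w | (N t w)%:R / t <= m] < prob P' [set w | Lambda w <= m] + eps / 4.
  by near: t; exact: hm.
have /andP[h2 _] : prob P' [set w | Lambda w <= M] - eps / 4 <
  prob P [set w | (N t w)%:R / t <= M] < prob P' [set w | Lambda w <= M] + eps / 4.
  by near: t; exact: hM.
have mB : measurable [set w | m * t <= (N t w)%:R <= M * t].
  rewrite (_ : [set w | _] = (fun w => (N t w)) @^-1` [set n | m * t <= n%:R <= M * t]);
    first exact: measurable_funPTI.
  by apply/seteqP; split.
have sub : [set w | (N t w)%:R / t <= M] `<=`
    [set w | (N t w)%:R / t <= m] `|` [set w | m * t <= (N t w)%:R <= M * t].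
  move=> w /= NM; have [Nm|Nm] := leP ((N t w)%:R / t) m; [by left|right].
  by rewrite -ler_pdivlMr// (ltW Nm)/= -ler_pdivrMr.
have := le_prob P (mNle t M) (measurableU _ _ (mNle t m) mB) sub.
have := probU P (mNle t m) mB; lra.
Unshelve. all: by end_near. Qed.

(** The expectation is the integral of the tail over the half-line, hence the increasing limit of
    the integrals over [0, n + 1]. *)
Lemma tail_integral_infty {R : realType} d (T : measurableType d) (P : probability T R)
  (Z : {RV P >-> R}) : (forall w, 0 <= Z w) -> (forall x, 0 < tail P Z x) ->
  ('E_P[Z] = +oo)%E ->
  tail_integral (tail P Z) x @[x --> +oo] --> +oo.
Proof.
move=> Z0 b0; rewrite ge0_expectation_ccdf// => EZ.
have mZ : measurable_fun [set: T] Z by exact: measurable_funPT.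
have noninc := fun x y => @tail_noninc R d T P Z mZ x y.
have mb := measurable_tail noninc.
have ccdfE r : ccdf Z r = (tail P Z r)%:E.
  rewrite -(probE P (measurable_gt_cst mZ r)) /ccdf /distribution /pushforward.
  suff -> : [set w | r < Z w] = Z @^-1` `]r, +oo[%classic by [].
  by apply/seteqP; split => w /=; rewrite in_itv/= andbT.
have h := @ge0_nondecreasing_set_cvg_integral _ (measurableTypeR R) R
  (fun n => `[0, n.+1%:R]%classic)
  (EFin \o tail P Z) (@lebesgue_measure R).
have /cvgeyPge c : (\int[@lebesgue_measure R]_(x in `[0%R, n.+1%:R%R]) (tail P Z x)%:E)%E
    @[n --> \oo] --> +oo%E.
  rewrite -EZ itv0y_bigcup0S; under [X in _ --> X]eq_integral do rewrite ccdfE.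
  apply: h => //.
  - move=> n m nm; apply/subsetPset => x /=; rewrite !in_itv/= => /andP[-> /le_trans]; apply.
    by rewrite ler_nat.
  - by move=> n; apply: measurable_funTS; exact: measurableT_comp.
  - by move=> n x _; rewrite /= lee_fin tail_ge0.
apply/cvgryPge => A; have [n _ /(_ n (leqnn n)) /= hn] := c A.
near=> x.
have nx : n.+1%:R <= x by near: x; apply: nbhs_pinfty_ge; exact: num_real.
have le1 y := tail_le1 P mZ y.
apply: le_trans (tail_integral_homo b0 le1 noninc _ nx) => //.
rewrite -lee_fin; apply: le_trans hn _.
rewrite -integral_itv_obnd_cbnd; last by apply: measurable_funTS; exact: measurableT_comp.
rewrite /tail_integral /Rintegral fineK//; apply: integrable_fin_num => //.
exact: integrable_tail.
Unshelve. all: by end_near. Qed.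

(** * Passage to |X_i| and the tail of a Pareto-type variable of index 1 *)

Section absolute_values.
Context {R : realType} {d : measure_display} {T : measurableType d}.
Variables (P : probability T R) (X : nat -> {RV P >-> R}).
Hypothesis X_pos : P [set w | 0 < X 0%N w] = 1%E.
Hypothesis X_iid : iid X.

Definition abs_rv (i : nat) (w : T) : R := `|X i w|.

Lemma measurable_abs_rv i : measurable_fun [set: T] (abs_rv i).
Proof. exact: measurableT_comp. Qed.

HB.instance Definition _ i :=
  @isMeasurableFun.Build _ _ _ _ (abs_rv i) (measurable_abs_rv i).

Local Notation Z i := (abs_rv i : {RV P >-> R}).
Local Notation b := (tail P (Z 0%N)).
Local Notation G := (tail_integral b).

Lemma abs_rv_iid : iid (fun i => Z i).
Proof.
have mabs (A : set R) : measurable A -> measurable ((fun x : R => `|x|) @^-1` A).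
  move=> mA; rewrite -[_ @^-1` _]setTI.
  have h : measurable_fun [set: R] (fun x : R => `|x|) by [].
  exact: h.
have [ind id] := X_iid; split.
  by move=> J A mA; apply: (ind J (fun j => (fun x : R => `|x|) @^-1` A j)) => j; exact: mabs.
by move=> i A mA; apply: (id i _ (mabs _ mA)).
Qed.

Lemma iid_gt0 i : P [set w | 0 < X i w] = 1%E.
Proof.
have := X_iid.2 i `]0, +oo[%classic (measurable_itv _).
have e j : distribution P (X j) `]0, +oo[%classic = P [set w | 0 < X j w].
  rewrite /distribution /pushforward.
  suff -> : [set w | 0 < X j w] = X j @^-1` `]0, +oo[%classic by [].
  by apply/seteqP; split => w /=; rewrite in_itv/= andbT.
by rewrite !e X_pos.
Qed.

Lemma tail_cdf (x : R) : 0 <= x -> 1 - fine (cdf (X 0%N) x) = b x.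
Proof.
move=> x0; have -> : cdf (X 0%N) x = P [set w | X 0%N w <= x].
  rewrite /cdf /distribution /pushforward.
  suff -> : [set w | X 0%N w <= x] = X 0%N @^-1` `]-oo, x]%classic by [].
  by apply/seteqP; split => w /=; rewrite in_itv.
have mle : measurable [set w | X 0%N w <= x] by exact: measurable_le_cst.
have mlt : measurable [set w | x < X 0%N w] by exact: measurable_set_lt.
have m0 : measurable [set w | 0 < X 0%N w] by exact: measurable_set_lt.
rewrite -/(prob P _) -(probC P mle) /tail /prob; congr fine.
rewrite (_ : ~` _ = [set w | x < X 0%N w]); last first.
  by apply/seteqP; split => w /=; rewrite ltNge => /negP.
apply: (prob_ae_iff mlt _ m0 X_pos); first exact: (measurable_gt_cst (measurable_abs_rv 0%N)).
by move=> w /= Xw; rewrite /abs_rv gtr0_norm.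
Qed.

Lemma expectation_abs_rv : ('E_P[X 0%N] = 'E_P[Z 0%N])%E.
Proof.
have m0 : measurable [set w | 0 < X 0%N w] by exact: measurable_set_lt.
rewrite unlock; apply: ae_eq_integral => //; try exact/measurable_EFinP.
exists (~` [set w | 0 < X 0%N w]); split; first exact: measurableC.
  by have /= -> := probability_setC P m0; rewrite [P _]X_pos subee.
by move=> w /= h Xw; apply: h => _; rewrite /abs_rv gtr0_norm.
Qed.

Variable l : R -> R.
Hypothesis X_pareto : pareto_type (X 0%N) 1 l.

Lemma pareto_tail : b x / (x^-1 * l x) @[x --> +oo] --> (1 : R).
Proof.
have [_ h] := X_pareto; apply: (cvg_near_eq _ _ h); near=> x.
have x0 : 0 < x by near: x; exact: nbhs_pinfty_gt.
by rewrite tail_cdf ?(ltW x0)// powR_inv1// (ltW x0).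
Unshelve. all: by end_near. Qed.

(** By monotonicity, a zero of b would make b vanish from there on, and its quotient by l(x) / x
    would be 0 instead of tending to 1. *)
Lemma pareto_tail_gt0 (x : R) : 0 < b x.
Proof.
have e0 : 0 < 1 / 2 :> R by [].
have h := cvg_near _ pareto_tail e0.
near (+oo : set_system R) => y.
have xy : x <= y by near: y; apply: nbhs_pinfty_ge; exact: num_real.
have /andP[hy _] : 1 - 1 / 2 < b y / (y^-1 * l y) < 1 + 1 / 2 by near: y; exact: h.
apply: lt_le_trans (tail_noninc P (measurable_abs_rv 0%N) xy).
rewrite lt_neqAle tail_ge0 andbT; apply/eqP => by0.
by move: hy; rewrite -by0 mul0r; lra.
Unshelve. all: by end_near. Qed.

(** Replace b by the equivalent l(x) / x at both points: slow variation removes the ratio of l, and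
    the power leaves 1 / c. *)
Lemma pareto_tail_rv (c : R) : 0 < c -> b (c * x) / b x @[x --> +oo] --> c^-1.
Proof.
move=> c0.
have cy : c * x @[x --> +oo] --> (+oo : set_system R) by apply: gt0_cvgMry.
have [[_ lpos lsv] _] := X_pareto.
have h1 := cvg_comp _ _ cy pareto_tail.
have h2 := lsv c c0.
have h3 : (b x / (x^-1 * l x))^-1 @[x --> +oo] --> (1 : R).
  by rewrite -[X in _ --> X]invr1; apply: cvgV => //; exact: pareto_tail.
have h4 : b (c * x) / ((c * x)^-1 * l (c * x)) * (l (c * x) / l x) * (b x / (x^-1 * l x))^-1
    * c^-1 @[x --> +oo] --> (1 * 1 * 1 * c^-1 : R).
  by apply: cvgM; [apply: cvgM => //; apply: cvgM|exact: cvg_cst].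
rewrite !mul1r in h4.
have clpos : \forall x \near +oo, 0 < l (c * x) by exact: (cy _ lpos).
apply: (cvg_near_eq _ _ h4); near=> x => /=.
have lx : 0 < l x by near: x; exact: lpos.
have lcx : 0 < l (c * x) by near: x; exact: clpos.
have x0 : 0 < x by near: x; exact: nbhs_pinfty_gt.
have bx := pareto_tail_gt0 x.
have bcx := pareto_tail_gt0 (c * x).
by field; rewrite ?gt_eqF.
Unshelve. all: by end_near. Qed.

Lemma pareto_tail_integral_infty : ('E_P[X 0%N] = +oo)%E -> G x @[x --> +oo] --> +oo.
Proof.
move=> mu1; apply: tail_integral_infty; first by move=> w; exact: normr_ge0.
  exact: pareto_tail_gt0.
by rewrite -expectation_abs_rv.
Qed.

End absolute_values.

(** * A filter expressing uniformity over counts of order t *)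

Section time_window.
Context {R : realType}.
Variables (m M : R).

(* The counts n to be considered at time t are those in [m t, M t]; statements uniform in
   n become limits along this filter on pairs (t, n). *)
Definition time_window : set_system (R * nat) :=
  [set A | \forall t \near +oo, forall n : nat, m * t <= n%:R <= M * t -> A (t, n)].

#[global] Instance time_window_filter : Filter time_window.
Proof.
split.
- by apply: nearW.
- move=> A B hA hB; rewrite /time_window /=; near=> t => n nt; split.
    by move: n nt; near: t; exact: hA.
  by move: n nt; near: t; exact: hB.
- move=> A B AB hA; rewrite /time_window /=; near=> t => n nt; apply: AB.
  by move: n nt; near: t; exact: hA.
Unshelve. all: by end_near. Qed.

Lemma near_time_window (A : set (R * nat)) :
  (\forall t \near +oo, forall n : nat, m * t <= n%:R <= M * t -> A (t, n)) ->
  \forall p \near time_window, A p.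
Proof. by []. Qed.

Lemma time_window_near (A : set (R * nat)) : (\forall p \near time_window, A p) ->
  \forall t \near +oo, forall n : nat, m * t <= n%:R <= M * t -> A (t, n).
Proof. by []. Qed.

End time_window.

(** * The limit for |X_i|, uniformly over counts of order t *)

Section uniform_limit.
Context {R : realType} {d : measure_display} {T : measurableType d}.
Variables (P : probability T R) (X : nat -> {RV P >-> R}) (l a a' : R -> R).
Hypothesis X_pos : P [set w | 0 < X 0%N w] = 1%E.
Hypothesis X_iid : iid X.
Hypothesis X_pareto : pareto_type (X 0%N) 1 l.
Hypothesis mu1 : ('E_P[X 0%N] = +oo)%E.
Hypothesis l_tilde_fin : forall x : R, 0 < x ->
  lebesgue_measure.-integrable `]0, x] (fun u : R => (l u / u)%:E).
Hypothesis a_infty : a t @[t --> +oo] --> +oo.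
Hypothesis a_def : t * (a t)^-1 * l (a t) @[t --> +oo] --> (1 : R).
Hypothesis a'_infty : a' t @[t --> +oo] --> +oo.
Hypothesis a'_def : t * (a' t)^-1 * l_tilde l (a' t) @[t --> +oo] --> (1 : R).

Local Notation Z i := (abs_rv X i : {RV P >-> R}).
Local Notation b := (tail P (Z 0%N)).
Local Notation G := (tail_integral b).
Local Notation N01 := (@normal_prob R 0 1).

Let b_gt0 := pareto_tail_gt0 X_pos X_pareto.
Let b_le1 := tail_le1 P (measurable_abs_rv X 0%N).
Let b_noninc := fun x y => @tail_noninc R d T P _ (measurable_abs_rv X 0%N) x y.
Let b_rv := pareto_tail_rv X_pos X_pareto.

Let a_gt0 : \forall t \near +oo, 0 < a t.
Proof. by apply: (@a_infty [set y : R | 0 < y]); exact: nbhs_pinfty_gt. Qed.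

Let a'_gt0 : \forall t \near +oo, 0 < a' t.
Proof. by apply: (@a'_infty [set y : R | 0 < y]); exact: nbhs_pinfty_gt. Qed.

Lemma normalization_tail : t * b (a t) @[t --> +oo] --> (1 : R).
Proof.
have [[_ lpos _] _] := X_pareto.
have h := cvg_comp _ _ a_infty (pareto_tail X_pos X_pareto).
have h1 : b (a t) / ((a t)^-1 * l (a t)) * (t * (a t)^-1 * l (a t)) @[t --> +oo]
    --> (1 * 1 : R) by apply: cvgM.
rewrite mulr1 in h1.
have la : \forall t \near +oo, 0 < l (a t) by exact: (a_infty lpos).
apply: (cvg_near_eq _ _ h1); near=> t.
have l0 : 0 < l (a t) by near: t; exact: la.
have a0 : 0 < a t by near: t; exact: a_gt0.
by field; rewrite ?gt_eqF.
Unshelve. all: by end_near. Qed.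

Let G_infty := pareto_tail_integral_infty X_pos X_pareto mu1.

Lemma normalization_tail_integral : t * G (a' t) / a' t @[t --> +oo] --> (1 : R).
Proof.
have h0 := l_tilde_tail_integral b_gt0 b_le1 b_noninc G_infty
  (pareto_tail X_pos X_pareto) l_tilde_fin.
have h1 : (l_tilde l x / G x)^-1 @[x --> +oo] --> (1 : R).
  by rewrite -[X in _ --> X]invr1; apply: cvgV.
have h2 := cvg_comp _ _ a'_infty h1.
have h3 : t * (a' t)^-1 * l_tilde l (a' t) * (l_tilde l (a' t) / G (a' t))^-1 @[t --> +oo]
    --> (1 * 1 : R) by apply: cvgM.
rewrite mulr1 in h3.
have [_ lpos _] := l_tilde_slowly_varying b_gt0 b_le1 b_noninc b_rv G_infty
  (pareto_tail X_pos X_pareto) l_tilde_fin.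
have la : \forall t \near +oo, 0 < l_tilde l (a' t) by exact: (a'_infty lpos).
apply: (cvg_near_eq _ _ h3); near=> t.
have l0 : 0 < l_tilde l (a' t) by near: t; exact: la.
have a0 : 0 < a' t by near: t; exact: a'_gt0.
have G0 : 0 < G (a' t) by exact: tail_integral_gt0.
by field; rewrite ?gt_eqF.
Unshelve. all: by end_near. Qed.

Variables (m M : R).
Hypothesis m0 : 0 < m.
Hypothesis mM : m < M.
Local Notation W := (time_window m M).

Let window_scale (f : R -> R) : f t @[t --> +oo] --> +oo ->
  f p.1 * (p.2%:R / p.1) @[p --> W] --> +oo.
Proof.
move=> foo; apply/cvgryPge => A.
have f1 : \forall t \near +oo, `|A| / m <= f t.
  by apply: (@foo [set y : R | `|A| / m <= y]); apply: nbhs_pinfty_ge; exact: num_real.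
apply: near_time_window; near=> t => n /andP[nt _] /=.
have t0 : 0 < t by near: t; exact: nbhs_pinfty_gt.
have ft : `|A| / m <= f t by near: t; exact: f1.
have ge : m <= n%:R / t by rewrite ler_pdivlMr.
apply: le_trans (ler_norm A) _; move: ft; rewrite ler_pdivrMr// => /le_trans; apply.
apply: ler_wpM2l => //.
have : `|A| / m <= f t by near: t; exact: f1.
by apply: le_trans; rewrite divr_ge0// ltW.
Unshelve. all: by end_near. Qed.

Let window_count : (p.2)%:R @[p --> W] --> (+oo : set_system R).
Proof.
apply/cvgryPge => A; apply: near_time_window; near=> t => n /andP[nt _] /=.
have tA : A / m <= t by near: t; apply: nbhs_pinfty_ge; exact: num_real.
by apply: le_trans nt; rewrite mulrC -ler_pdivrMr.
Unshelve. all: by end_near. Qed.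

(** With f = min(1, e / 3), f^2 <= f gives (1 + f)^2 <= 1 + 3 f <= 1 + e; the lower side is
    similar. *)
Let prod_close (u v e : R) : 0 < e -> 1 - Num.min 1 (e / 3) <= u <= 1 + Num.min 1 (e / 3) ->
  1 - Num.min 1 (e / 3) <= v <= 1 + Num.min 1 (e / 3) -> 1 - e <= u * v <= 1 + e.
Proof.
move=> e0; set f := Num.min _ _ => /andP[u1 u2] /andP[v1 v2].
have f1 : f <= 1 by rewrite ge_min lexx.
have f2 : f <= e / 3 by rewrite ge_min lexx orbT.
have f0 : 0 < f by rewrite lt_min ltr01 divr_gt0.
apply/andP; split.
  by apply: (@le_trans _ _ ((1 - f) * (1 - f))); [nra|apply: ler_pM => //; lra].
by apply: (@le_trans _ _ ((1 + f) * (1 + f))); [apply: ler_pM => //; lra|nra].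
Qed.

(** With c = n / t in [m, M], the quantity is c b(c a_t) / b(a_t) times t b(a_t). The first factor
    tends to 1 uniformly in c, the second by the choice of a_t. *)
Let window_alpha : (p.2)%:R * b (a p.1 * (p.2%:R / p.1)) @[p --> W] --> (1 : R).
Proof.
apply: near_cvg => e e0.
have f0 : 0 < Num.min 1 (e / 3) by rewrite lt_min ltr01 divr_gt0.
have u := uniform_tail_ratio b_gt0 b_noninc b_rv M m0 f0.
have u' := a_infty u.
have h := cvg_near _ normalization_tail f0.
apply: near_time_window; near=> t => n /andP[nt1 nt2] /=.
have t0 : 0 < t by near: t; exact: nbhs_pinfty_gt.
have /andP[h1 h2] : 1 - Num.min 1 (e / 3) < t * b (a t) < 1 + Num.min 1 (e / 3).
  by near: t; exact: h.
have ut : forall c, m <= c <= M -> 1 - Num.min 1 (e / 3) <=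
    c * (b (c * a t) / b (a t)) <= 1 + Num.min 1 (e / 3) by near: t; exact: u'.
have cm : m <= n%:R / t <= M by rewrite ler_pdivlMr// ler_pdivrMr// nt1.
have h3 : 1 - Num.min 1 (e / 3) <= t * b (a t) <= 1 + Num.min 1 (e / 3).
  by rewrite (ltW h1) (ltW h2).
have := prod_close e0 (ut _ cm) h3.
suff -> : n%:R / t * (b (n%:R / t * a t) / b (a t)) * (t * b (a t)) =
  n%:R * b (a t * (n%:R / t)) by [].
have := b_gt0 (a t); rewrite [a t * _]mulrC => b0.
by field; rewrite ?gt_eqF.
Unshelve. all: by end_near. Qed.

(** With c = n / t, the quantity is G(c a'_t) / G(a'_t) times t G(a'_t) / a'_t. As G is monotone,
    slow variation at the two ends m and M controls all c between them. *)
Let window_beta :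
  (p.2)%:R * G (a' p.1 * (p.2%:R / p.1)) / (a' p.1 * (p.2%:R / p.1)) @[p --> W] --> (1 : R).
Proof.
apply: near_cvg => e e0.
have f0 : 0 < Num.min 1 (e / 3) by rewrite lt_min ltr01 divr_gt0.
have M0 : 0 < M by exact: lt_trans mM.
have slow c : 0 < c -> \forall t \near +oo, 1 - Num.min 1 (e / 3) < G (c * a' t) / G (a' t)
    < 1 + Num.min 1 (e / 3).
  move=> c0; exact: (cvg_near _ (cvg_comp _ _ a'_infty
    (tail_integral_slow b_gt0 b_le1 b_noninc b_rv c0)) f0).
have sm := slow _ m0; have sM := slow _ M0.
have h := cvg_near _ normalization_tail_integral f0.
apply: near_time_window; near=> t => n /andP[nt1 nt2] /=.
have t0 : 0 < t by near: t; exact: nbhs_pinfty_gt.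
have a'0 : 0 < a' t by near: t; exact: a'_gt0.
have G0 : 0 < G (a' t) by exact: tail_integral_gt0.
have /andP[h1 h2] : 1 - Num.min 1 (e / 3) < t * G (a' t) / a' t < 1 + Num.min 1 (e / 3).
  by near: t; exact: h.
have /andP[s1 _] : 1 - Num.min 1 (e / 3) < G (m * a' t) / G (a' t) < 1 + Num.min 1 (e / 3).
  by near: t; exact: sm.
have /andP[_ s2] : 1 - Num.min 1 (e / 3) < G (M * a' t) / G (a' t) < 1 + Num.min 1 (e / 3).
  by near: t; exact: sM.
have mn : m <= n%:R / t by rewrite ler_pdivlMr.
have nM : n%:R / t <= M by rewrite ler_pdivrMr.
have nt0 : 0 < n%:R / t by exact: lt_le_trans mn.
have h3 : 1 - Num.min 1 (e / 3) <= t * G (a' t) / a' t <= 1 + Num.min 1 (e / 3).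
  by rewrite (ltW h1) (ltW h2).
have h4 : 1 - Num.min 1 (e / 3) <= G (n%:R / t * a' t) / G (a' t) <= 1 + Num.min 1 (e / 3).
  apply/andP; split.
    apply: le_trans (ltW s1) _; rewrite ler_pM2r ?invr_gt0//.
    apply: tail_integral_homo => //; first by rewrite mulr_ge0// ltW.
    by rewrite ler_pM2r.
  apply: le_trans (ltW s2); rewrite ler_pM2r ?invr_gt0//.
  apply: tail_integral_homo => //; first by rewrite mulr_ge0// ltW.
  by rewrite ler_pM2r.
have := prod_close e0 h4 h3.
suff -> : G (n%:R / t * a' t) / G (a' t) * (t * G (a' t) / a' t) =
  n%:R * G (a' t * (n%:R / t)) / (a' t * (n%:R / t)) by [].
have n0 : 0 < n%:R :> R by move: nt0; rewrite pmulr_lgt0// invr_gt0.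
rewrite [a' t * _]mulrC.
by field; rewrite ?gt_eqF.
Unshelve. all: by end_near. Qed.

Definition normalized_covar (t : R) (n : nat) (x : nat -> R) : R :=
  a' t / a t * (sample_covar n x / Num.sqrt n%:R).

(** The fixed-sample limit is taken along [time_window]; a property near this filter unfolds to one
    valid for all large t and all counts of the window at once. *)
Lemma abs_covar_limit (x x' eps : R) : 0 < x -> x < x' -> 0 < eps ->
  \forall t \near +oo, forall n : nat, m * t <= n%:R <= M * t ->
    prob P [set w | normalized_covar t n (fun i => Z i w) <= x] <=
      prob N01 [set z | levy z <= x' ^+ 2] + eps /\
    prob N01 [set z | levy z <= x ^+ 2] <=
      prob P [set w | normalized_covar t n (fun i => Z i w) <= x'] + eps.
Proof.
move=> x0 xx' e0.
have h := time_window_near (@covar_ratio_limit R _ _ _ _ P N01 (fun i => Z i) levy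
  (fun i w => normr_ge0 _) (abs_rv_iid X_iid) b_gt0 b_rv (@measurable_levy R) (@levy_ge0 R)
  (@mean_levy R) _ W (fun p => p.2) (fun p => a p.1 * (p.2%:R / p.1))
  (fun p => a' p.1 * (p.2%:R / p.1)) _ window_count (window_scale a_infty)
  (window_scale a'_infty) window_alpha window_beta x x' eps x0 xx' e0).
near=> t; move=> n nt.
have t0 : 0 < t by near: t; exact: nbhs_pinfty_gt.
have a0 : 0 < a t by near: t; exact: a_gt0.
have YE w : normalized_covar t n (fun i => Z i w) =
    covar_ratio (fun i => Z i) (fun p => p.2) (fun p => a p.1 * (p.2%:R / p.1))
      (fun p => a' p.1 * (p.2%:R / p.1)) (t, n) w.
  rewrite /normalized_covar /covar_ratio/=; congr (_ * _).
  have n0 : 0 < n%:R :> R.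
    by case/andP: nt => nt _; apply: lt_le_trans nt; rewrite mulr_gt0.
  by field; rewrite ?gt_eqF.
under eq_set do rewrite YE; under [X in _ /\ _ <= prob _ X + _]eq_set do rewrite YE.
by move: n nt {YE}; near: t; exact: h.
Unshelve. all: by end_near. Qed.

End uniform_limit.

(** * Mixtures over a random index and generated sigma-algebras *)

Section mixture.
Context {R : realType} {d : measure_display} {T : measurableType d}.
Variables (P : probability T R) (N : T -> nat) (E : nat -> set T).
Hypothesis mN : forall n, measurable [set w | N w = n].
Hypothesis mE : forall n, measurable (E n).
Hypothesis indep : forall n, P ([set w | N w = n] `&` E n) = (P [set w | N w = n] * P (E n))%E.

Lemma measurable_mixture : measurable [set w | E (N w) w].
Proof.
rewrite (_ : [set w | _] = \bigcup_n ([set w | N w = n] `&` E n)).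
  by apply: bigcup_measurable => n _; exact: measurableI.
by apply/seteqP; split => [w Ew|w [n _ [/= <-]]//]; exists (N w).
Qed.

(** The cut at K keeps the sum finite. In the application K exceeds every count of the window, so
    nothing is lost. *)
Lemma prob_mixture (K : nat) :
  prob P ([set w | (N w < K)%N] `&` [set w | E (N w) w]) =
  \sum_(n < K) prob P [set w | N w = n] * prob P (E n).
Proof.
have mlt k : measurable [set w | (N w < k)%N].
  rewrite (_ : [set w | _] = \bigcup_(n < k) [set w | N w = n]).
    by apply: bigcup_measurable.
  by apply/seteqP; split => [w /= Nk|w [n /= nk ->]//]; exists (N w).
elim: K => [|K ih].
  rewrite big_ord0 (_ : _ `&` _ = set0) ?/prob ?measure0//.
  by apply/seteqP; split => w // [].
rewrite big_ord_recr/= -ih.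
have mA := measurableI _ _ (mlt K) measurable_mixture.
have mB : measurable ([set w | N w = K] `&` E K) by exact: measurableI.
have -> : prob P [set w | N w = K] * prob P (E K) = prob P ([set w | N w = K] `&` E K).
  apply: EFin_inj; rewrite -(probE P mB) EFinM -(probE P (mN K)) -(probE P (mE K)).
  by rewrite indep.
apply: EFin_inj; rewrite EFinD -(probE P mA) -(probE P mB).
rewrite -measureU//; last first.
  by apply/seteqP; split => w // [[/= + _] [NK _]]; rewrite NK ltnn.
rewrite -probE; last by apply: measurableI => //; exact: measurable_mixture.
congr (P _); apply/seteqP; split => w /=.
  by rewrite ltnS leq_eqVlt => -[/orP[/eqP NK|NK] Ew]; [right; split => //; rewrite -NK|left].
by move=> [[NK Ew]|[NK Ew]]; split => //; [exact: ltnW|rewrite NK|rewrite NK].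
Qed.

End mixture.

Lemma sigma_generated_measurable d (T : measurableType d)
  d' (T' : measurableType d') (I : Type) (D : set I) (Y : I -> {mfun T >-> T'}) (A : set T) :
  sigma_generated D (fun i w => Y i w) A -> measurable A.
Proof.
apply: smallest_sub; first exact: sigma_algebra_measurable.
move=> B [i _ [C mC <-]]; rewrite setTI.
exact: measurable_funPTI.
Qed.

Lemma sigma_generated_preimage d (T : measurableType d) d' (T' : measurableType d')
  (I : Type) (D : set I) (Y : I -> T -> T') (i : I) (A : set T') :
  D i -> measurable A -> sigma_generated D Y (Y i @^-1` A).
Proof.
move=> Di mA; apply: sub_sigma_algebra; exists i => //.
by exists A => //; rewrite setTI.
Qed.

(** Independence is stated for generated sigma-algebras. The carrier is equipped with the one
    generated by X, for which each X_i is measurable by construction, and the general measurability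
    of the sample coefficient is reused there. *)
Lemma sample_covar_sigma_generated {R : realType} d (T : measurableType d) (P : probability T R)
  (X : nat -> {RV P >-> R}) (n : nat) (c x : R) :
  sigma_generated [set: nat] (fun i w => X i w)
    [set w | c * (sample_covar n (fun i => X i w) / Num.sqrt n%:R) <= x].
Proof.
pose G := \bigcup_(i in [set: nat]) preimage_set_system setT (fun w => X i w) (@measurable _ R).
have mX i : measurable_fun [set: g_sigma_algebraType G] (fun w : g_sigma_algebraType G => X i w).
  move=> _ A mA; rewrite setTI.
  exact: (@sigma_generated_preimage _ T _ R nat setT (fun i w => X i w) i A).
have mf : measurable_fun [set: g_sigma_algebraType G]
    (fun w => c * (sample_covar n (fun i => X i w) / Num.sqrt n%:R)).
  by apply: measurable_funM => //; apply: measurable_funM => //; exact: measurable_sample_covar.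
exact: (measurable_le_cst x mf).
Qed.

Lemma eq_sample_covar {R : realType} (n : nat) (x y : nat -> R) :
  (forall i, (i < n)%N -> x i = y i) -> sample_covar n x = sample_covar n y.
Proof.
move=> xy; have e : sample_mean n x = sample_mean n y.
  by rewrite /sample_mean; congr (_ * _); apply: eq_bigr => i _; exact: xy.
rewrite /sample_covar /sample_std e; congr (Num.sqrt (_ * _) / _).
by apply: eq_bigr => i _; rewrite xy.
Qed.

(** * Random sample size *)

Section random_sample_size.
Context {R : realType} {d d' : measure_display} {T : measurableType d} {T' : measurableType d'}.
Variables (P : probability T R) (P' : probability T' R) (X : nat -> {RV P >-> R}).
Variables (N : R -> {RV P >-> nat}) (Lambda : {RV P' >-> R}) (l a a' : R -> R).
Hypothesis X_pos : P [set w | 0 < X 0%N w] = 1%E.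
Hypothesis X_iid : iid X.
Hypothesis N_indep : process_independent N X.
Hypothesis X_pareto : pareto_type (X 0%N) 1 l.
Hypothesis mu1 : ('E_P[X 0%N] = +oo)%E.
Hypothesis N_averages : D_averages_in_time N Lambda.
Hypothesis l_tilde_fin : forall x : R, 0 < x ->
  lebesgue_measure.-integrable `]0, x] (fun u : R => (l u / u)%:E).
Hypothesis a_infty : a t @[t --> +oo] --> +oo.
Hypothesis a_def : t * (a t)^-1 * l (a t) @[t --> +oo] --> (1 : R).
Hypothesis a'_infty : a' t @[t --> +oo] --> +oo.
Hypothesis a'_def : t * (a' t)^-1 * l_tilde l (a' t) @[t --> +oo] --> (1 : R).

Local Notation N01 := (@normal_prob R 0 1).
Local Notation Z i := (abs_rv X i : {RV P >-> R}).

Lemma iid_all_gt0 n : measurable [set w | forall i, (i < n)%N -> 0 < X i w] /\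
  P [set w | forall i, (i < n)%N -> 0 < X i w] = 1%E.
Proof.
elim: n => [|n [mn Pn]].
  by rewrite (_ : [set w | _] = setT) ?probability_setT//; apply/seteqP; split.
have mn1 : measurable [set w | 0 < X n w] by exact: measurable_set_lt.
rewrite (_ : [set w | _] = [set w | forall i, (i < n)%N -> 0 < X i w] `&` [set w | 0 < X n w]).
  split; first exact: measurableI.
  by apply: prob_setI1 => //; exact: iid_gt0.
apply/seteqP; split => w /=.
  by move=> h; split => [i ni|]; apply: h => //; exact: ltnW.
by move=> [h Xn] i; rewrite ltnS leq_eqVlt => /orP[/eqP ->//|]; exact: h.
Qed.

(** At a fixed n only the first n variables matter, and they are simultaneously positive with
    probability one. *)
Lemma prob_covar_abs (t x : R) (n : nat) :
  prob P [set w | normalized_covar a a' t n (fun i => X i w) <= x] =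
  prob P [set w | normalized_covar a a' t n (fun i => Z i w) <= x].
Proof.
have [mD PD] := iid_all_gt0 n.
have m1 (W : nat -> {RV P >-> R}) :
    measurable [set w | normalized_covar a a' t n (fun i => W i w) <= x].
  apply: measurable_le_cst; apply: measurable_funM => //; apply: measurable_funM => //.
  by apply: measurable_sample_covar => i; exact: measurable_funPT.
congr fine; apply: (prob_ae_iff (m1 X) (m1 (fun i => Z i)) mD PD) => w /= Xw.
rewrite /normalized_covar (@eq_sample_covar R n (fun i => X i w) (fun i => Z i w))// => i ni.
by rewrite /= /abs_rv gtr0_norm// Xw.
Qed.

Lemma measurable_normalized_covar (t x : R) :
  measurable [set w | normalized_covar a a' t (N t w) (fun i => X i w) <= x].
Proof.
have mN n : measurable [set w | N t w = n].
  rewrite (_ : [set w | _] = (fun w => N t w) @^-1` [set n]); first exact: measurable_funPTI.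
  by apply/seteqP; split.
have mE n : measurable [set w | normalized_covar a a' t n (fun i => X i w) <= x].
  exact: (@sigma_generated_measurable d T _ R nat setT X _
    (@sample_covar_sigma_generated R d T P X n (a' t / a t) x)).
exact: (measurable_mixture mN mE).
Qed.

(** On the window [m t, M t] independence gives a mixture of fixed-count probabilities, all subject
    to the same bounds; the mass outside is at most eps / 2. *)
Lemma normalized_covar_bounds (x x' eps : R) : 0 < x -> x < x' -> 0 < eps ->
  \forall t \near +oo,
    prob P [set w | normalized_covar a a' t (N t w) (fun i => X i w) <= x] <=
      prob N01 [set z | levy z <= x' ^+ 2] + eps /\
    prob N01 [set z | levy z <= x ^+ 2] <=
      prob P [set w | normalized_covar a a' t (N t w) (fun i => X i w) <= x'] + eps.
Proof.
move=> x0 xx' e0; have e20 : 0 < eps / 2 by rewrite divr_gt0.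
have [m [M [m0 [mM tight]]]] := D_averages_tight N_averages e20.
have lim := abs_covar_limit X_pos X_iid X_pareto mu1 l_tilde_fin a_infty a_def a'_infty a'_def
  m0 mM x0 xx' e20.
have mlevy y : measurable [set z : measurableTypeR R | levy z <= y].
  by apply: measurable_le_cst; exact: measurable_levy.
near=> t.
have t0 : 0 <= t by near: t; apply: nbhs_pinfty_ge; exact: num_real.
have tight_t : 1 - eps / 2 <= prob P [set w | m * t <= (N t w)%:R <= M * t].
  by near: t; exact: tight.
have lim_t : forall n : nat, m * t <= n%:R <= M * t -> 
    prob P [set w | normalized_covar a a' t n (fun i => Z i w) <= x] <=
      prob N01 [set z | levy z <= x' ^+ 2] + eps / 2 /\
    prob N01 [set z | levy z <= x ^+ 2] <=
      prob P [set w | normalized_covar a a' t n (fun i => Z i w) <= x'] + eps / 2.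
  by near: t; exact: lim.
pose S (n : nat) := m * t <= n%:R <= M * t.
pose K := (Num.trunc (M * t)).+1.
have SK n : S n -> (n < K)%N.
  by move=> /andP[_ nM]; rewrite /K -(ltr_nat R); exact: le_lt_trans nM (truncnS_gt _).
pose p n := prob P [set w | N t w = n].
pose E y n := [set w | normalized_covar a a' t n (fun i => X i w) <= y].
have sigX := @sigma_generated_measurable d T _ R nat setT X.
have sigN n : sigma_generated [set t : R | 0 <= t] (fun t w => N t w) [set w | N t w = n].
  exact: (@sigma_generated_preimage _ T _ nat R [set t | 0 <= t] (fun t w => N t w) t [set n]).
have sE y n : sigma_generated [set: nat] (fun i w => X i w) (E y n).
  exact: sample_covar_sigma_generated.
have s1 : sigma_generated [set: nat] (fun i w => X i w) setT.
  exact: (@sigma_generated_preimage _ T _ R nat setT (fun i w => X i w) 0%N setT).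
have mN n : measurable [set w | N t w = n] by exact: (@sigma_generated_measurable d T _ nat R _ N _ (sigN n)).
(* Counts outside the window receive the empty event, so that the mixture formula picks out the
   window by itself; F constantly the whole space gives the mass of the window. *)
pose only (F : nat -> set T) n := if S n then F n else set0.
have mix F : (forall n, sigma_generated [set: nat] (fun i w => X i w) (F n)) ->
    measurable [set w | only F (N t w) w] /\ prob P [set w | only F (N t w) w] =
    \sum_(n < K) p n * (if S n then prob P (F n) else 0).
  move=> sF; have mF n : measurable (F n) by exact: sigX.
  have mo n : measurable (only F n) by rewrite /only; case: ifP.
  have io n : P ([set w | N t w = n] `&` only F n) = (P [set w | N t w = n] * P (only F n))%E.
    rewrite /only; case: ifP => _; first exact: N_indep.
    by rewrite setI0 measure0 mule0.
  split; first exact: measurable_mixture.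
  transitivity (prob P ([set w | (N t w < K)%N] `&` [set w | only F (N t w) w])).
    congr prob; apply/seteqP; split => [w Fw|w []//]; split => //.
    by move: Fw; rewrite /= /only; case: ifP => // /SK.
  rewrite (prob_mixture mN mo io); apply: eq_bigr => n _; congr (_ * _).
  by rewrite /only; case: ifP => //; rewrite /prob measure0.
have [mS pS] := mix (fun=> setT) (fun=> s1).
have Sset : [set w | only (fun=> setT) (N t w) w] = [set w | m * t <= (N t w)%:R <= M * t].
  by apply/seteqP; split => w; rewrite /= /only /S; case: ifP.
rewrite Sset in mS pS; rewrite pS in tight_t.
have p0 n : 0 <= p n by exact: prob_ge0.
have mE := measurable_normalized_covar t.
have PT : prob P setT = 1 by rewrite /prob probability_setT.
rewrite PT in tight_t pS.
(* s is the mass of the window, between 1 - eps / 2 and 1; this and 0 <= q <= 1 make the replacement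
   of q s by q cost at most eps / 2. *)
set s := \sum_(n < K) _ in tight_t pS.
have s_le1 : s <= 1 by rewrite -pS prob_le1.
split.
  have [mx px] := mix _ (sE x).
  set q := prob N01 _.
  have q0 : 0 <= q by exact: prob_ge0.
  have up : prob P [set w | only (E x) (N t w) w] <= (q + eps / 2) * s.
    rewrite px mulr_sumr; apply: ler_sum => n _; rewrite mulrCA; apply: ler_wpM2l => //.
    case: ifP => [Sn|_]; rewrite ?mulr1 ?mulr0//.
    by rewrite prob_covar_abs; have [] := lim_t n Sn.
  have mC := measurableC mS.
  have : prob P [set w | normalized_covar a a' t (N t w) (fun i => X i w) <= x] <=
      prob P ([set w | only (E x) (N t w) w] `|` ~` [set w | m * t <= (N t w)%:R <= M * t]).
    apply: le_prob => //; first exact: measurableU.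
    move=> w /= Yw; have [Sw|Sw] := boolP (S (N t w)); [left|right].
      by rewrite /only Sw.
    exact/negP.
  have := probU P mx mC; rewrite probC// pS; nra.
have [mx px] := mix _ (sE x').
have q1 : prob N01 [set z | levy z <= x ^+ 2] <= 1 by exact: prob_le1.
set q := prob N01 _ in q1 *.
have up : (q - eps / 2) * s <= prob P [set w | only (E x') (N t w) w].
  rewrite px mulr_sumr; apply: ler_sum => n _; rewrite mulrCA; apply: ler_wpM2l => //.
  case: ifP => [Sn|_]; rewrite ?mulr1 ?mulr0//.
  by rewrite lerBlDr prob_covar_abs; have [] := lim_t n Sn.
have : prob P [set w | only (E x') (N t w) w] <=
    prob P [set w | normalized_covar a a' t (N t w) (fun i => X i w) <= x'].
  apply: le_prob => // w; rewrite /= /only; case: ifP => //.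
nra.
Unshelve. all: by end_near. Qed.

End random_sample_size.

(** Chernoff bound: P(V <= 1 / r) <= e E e^(-r V) = e^(1 - sqrt(pi r)). The choice sqrt(pi r) = k =
    e / eps brings this below eps, since eps e^k >= eps (1 + k) >= e. *)
Lemma levy_small {R : realType} (eps : R) : 0 < eps ->
  exists2 y : R, 0 < y & prob (@normal_prob R 0 1) [set z | levy z <= y ^+ 2] <= eps.
Proof.
move=> e0; pose k : R := expR 1 / eps.
have k0 : 0 < k by rewrite divr_gt0// expR_gt0.
have pi0 : 0 < pi :> R by exact: pi_gt0.
pose r := k ^+ 2 / pi.
have r0 : 0 < r by rewrite divr_gt0// exprn_gt0.
exists (Num.sqrt r^-1); first by rewrite sqrtr_gt0 invr_gt0.
rewrite sqr_sqrtr; last by rewrite invr_ge0 ltW.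
set A := [set z | _].
have mA : measurable (A : set (measurableTypeR R)).
  by apply: measurable_le_cst; exact: measurable_levy.
have bf : bounded_rv (fun z : measurableTypeR R => expR (- (r * levy z))).
  exact: bounded_rv_expRN (@measurable_levy R) (@levy_ge0 R) (ltW r0).
have := @markov_mean R _ _ (normal_prob 0 1) _ A (expR (- 1)) bf mA.
rewrite mean_levy// => /(_ (fun z => ltW (expR_gt0 _))) h.
have {}h := h _.
have : expR (- 1) * prob (@normal_prob R 0 1) A <= expR (- Num.sqrt (r * pi)).
  apply: h => z /= Az; rewrite ler_expR lerN2.
  have {}Az : levy z <= r^-1 by exact: Az.
  by rewrite mulrC -ler_pdivlMr// mul1r.
rewrite divfK ?gt_eqF// sqrtr_sqr gtr0_norm// expRN ler_pdivrMl ?expR_gt0// => /le_trans; apply.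
rewrite expRN ler_pdivrMr ?expR_gt0//.
have := expR_ge1Dx k; rewrite -(ler_pM2l e0); apply: le_trans.
have -> : eps * (1 + k) = eps + expR 1 by rewrite /k; field; rewrite gt_eqF.
by rewrite lerDr ltW.
Qed.

(** By uniqueness of the law of the vector, the two-sided bounds in terms of V are bounds in terms
    of sqrt(U_1) / L at every positive level, and continuity of the limit at x closes the gap
    between levels. *)
Theorem mainTheorem8 (R : realType)
    (d : measure_display) (T : measurableType d) (P : probability T R)
    (X : nat -> {RV P >-> R}) (N : R -> {RV P >-> nat})
    (d' : measure_display) (T' : measurableType d') (P' : probability T' R)
    (Lambda : {RV P' >-> R})
    (l a a' : R -> R)
    (X_pos : P [set w | 0 < X 0%N w] = 1%E)
    (X_iid : iid X)
    (N_counting : counting_process N)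
    (N_indep : process_independent N X)
    (X_pareto : pareto_type (X 0%N) 1 l)
    (mu1 : ('E_P[X 0%N] = +oo)%E)
    (N_averages : D_averages_in_time N Lambda)
    (l_tilde_fin : forall x : R, 0 < x ->
       lebesgue_measure.-integrable `]0, x] (fun u : R => (l u / u)%:E))
    (a_infty : a t @[t --> +oo] --> +oo)
    (a_def : t * (a t)^-1 * l (a t) @[t --> +oo] --> (1 : R))
    (a'_infty : a' t @[t --> +oo] --> +oo)
    (a'_def : t * (a' t)^-1 * l_tilde l (a' t) @[t --> +oo] --> (1 : R)) :
  [/\ slowly_varying (l_tilde l),
      (exists (d2 : measure_display) (T2 : measurableType d2)
          (P2 : probability T2 R) (U1 L : {RV P2 >-> R}),
        limit_vector Lambda U1 L) &
      forall (d2 : measure_display) (T2 : measurableType d2)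
          (P2 : probability T2 R) (U1 L : {RV P2 >-> R}),
        limit_vector Lambda U1 L ->
        cvg_in_distribution P
          (fun t w => a' t / a t *
             (sample_covar (N t w) (fun i => X i w) / Num.sqrt (N t w)%:R))
          P2 (fun w => Num.sqrt (U1 w) / L w)].
Proof.
have L0 := N_averages.1.
split.
- exact: (l_tilde_slowly_varying (pareto_tail_gt0 X_pos X_pareto)
    (tail_le1 P (measurable_abs_rv X 0%N)) (tail_noninc P (measurable_abs_rv X 0%N))
    (pareto_tail_rv X_pos X_pareto) (pareto_tail_integral_infty X_pos X_pareto mu1)
    (pareto_tail X_pos X_pareto) l_tilde_fin).
- do 5!eexists; exact: (limit_vector_exists L0).
move=> d2 T2 P2 U1 L lv x hx.
have bounds := normalized_covar_bounds X_pos X_iid N_indep X_pareto mu1 N_averages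
  l_tilde_fin a_infty a_def a'_infty a'_def.
have mY t y : measurable [set w | normalized_covar a a' t (N t w) (fun i => X i w) <= y].
  exact: measurable_normalized_covar.
have mR y : measurable [set w | Num.sqrt (U1 w) / L w <= y].
  apply: measurable_le_cst; apply: measurable_funM.
    apply: (measurableT_comp (f := @Num.sqrt R)) => //.
    by apply: continuous_measurable_fun; exact: sqrt_continuous.
  exact: measurable_fun_inv.
have probR y : 0 < y -> prob P2 [set w | Num.sqrt (U1 w) / L w <= y] =
    prob (@normal_prob R 0 1) [set z | levy z <= y ^+ 2].
  by move=> y0; rewrite /prob; congr fine; exact: (limit_vector_ratio L0 lv y0).
have mono y1 y2 : y1 <= y2 -> prob P2 [set w | Num.sqrt (U1 w) / L w <= y1] <=
    prob P2 [set w | Num.sqrt (U1 w) / L w <= y2].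
  by move=> y12; apply: le_prob => // w /= /le_trans; apply.
suff : prob P [set w | normalized_covar a a' t (N t w) (fun i => X i w) <= x] @[t --> +oo] -->
    prob P2 [set w | Num.sqrt (U1 w) / L w <= x].
  move=> h; rewrite (probE P2 (mR x)); apply: cvg_EFin; last exact: h.
  by apply: nearW => t; rewrite (probE P (mY t x)).
(* The bounds exist at positive levels only. For x <= 0 both sides are compared with a small
   positive level y, where the law of sqrt V has little mass. *)
have [x0|x0] := ltP 0 x; last first.
  have R0 : prob P2 [set w | Num.sqrt (U1 w) / L w <= x] = 0.
    apply/eqP; rewrite eq_le prob_ge0 andbT; apply/ler_addgt0Pr => e e0; rewrite add0r.
    have [y y0] := levy_small e0; rewrite -probR//; apply: le_trans.
    exact/mono/(le_trans x0)/ltW.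
  rewrite R0; apply: near_cvg => e e0.
  have e20 : 0 < e / 2 by rewrite divr_gt0.
  have [y y0 ye] := levy_small e20.
  have y20 : 0 < y / 2 by rewrite divr_gt0.
  have yy : y / 2 < y by lra.
  have h := bounds _ _ _ y20 yy e20.
  near=> t.
  have [h1 _] : prob P [set w | normalized_covar a a' t (N t w) (fun i => X i w) <= y / 2] <=
      prob (@normal_prob R 0 1) [set z | levy z <= y ^+ 2] + e / 2 /\
    prob (@normal_prob R 0 1) [set z | levy z <= (y / 2) ^+ 2] <=
      prob P [set w | normalized_covar a a' t (N t w) (fun i => X i w) <= y] + e / 2.
    by near: t; exact: h.
  have h2 : prob P [set w | normalized_covar a a' t (N t w) (fun i => X i w) <= x] <=
      prob P [set w | normalized_covar a a' t (N t w) (fun i => X i w) <= y / 2].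
    by apply: le_prob => // w /= /le_trans; apply; exact/(le_trans x0)/ltW.
  have h3 := prob_ge0 P [set w | normalized_covar a a' t (N t w) (fun i => X i w) <= x].
  apply/andP; split; lra.
have {}hx : prob P2 [set w | Num.sqrt (U1 w) / L w <= y] @[y --> x] -->
    prob P2 [set w | Num.sqrt (U1 w) / L w <= x].
  by move: hx; rewrite (probE P2 (mR x)) => /fine_cvgP[].
apply: near_cvg => e e0; have e20 : 0 < e / 2 by rewrite divr_gt0.
have [r /= r0 hr] := cvg_near _ hx e20.
(* s <= x / 2 keeps x - s positive, and s <= r / 2 keeps x - s and x + s in the ball where the limit
   varies by less than e / 2. *)
pose s := Num.min (x / 2) (r / 2).
have s0 : 0 < s by rewrite lt_min !divr_gt0.
have sx : s <= x / 2 by rewrite ge_min lexx.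
have sr : s <= r / 2 by rewrite ge_min lexx orbT.
have /hr /andP[l1 _] : ball x r (x - s) by rewrite /ball/= opprB addrC subrK gtr0_norm//; lra.
have /hr /andP[_ l2] : ball x r (x + s).
  by rewrite /ball/= opprD addrA subrr add0r normrN gtr0_norm//; lra.
have y10 : 0 < x - s by lra.
have y20 : 0 < x + s by lra.
have y1x : x - s < x by lra.
have xy2 : x < x + s by lra.
have h1 := bounds _ _ _ y10 y1x e20.
have h2 := bounds _ _ _ x0 xy2 e20.
rewrite (probR _ y10) in l1; rewrite (probR _ y20) in l2.
near=> t.
have [_ u1] : prob P [set w | normalized_covar a a' t (N t w) (fun i => X i w) <= x - s] <=
      prob (@normal_prob R 0 1) [set z | levy z <= x ^+ 2] + e / 2 /\
    prob (@normal_prob R 0 1) [set z | levy z <= (x - s) ^+ 2] <=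
      prob P [set w | normalized_covar a a' t (N t w) (fun i => X i w) <= x] + e / 2.
  by near: t; exact: h1.
have [u2 _] : prob P [set w | normalized_covar a a' t (N t w) (fun i => X i w) <= x] <=
      prob (@normal_prob R 0 1) [set z | levy z <= (x + s) ^+ 2] + e / 2 /\
    prob (@normal_prob R 0 1) [set z | levy z <= x ^+ 2] <=
      prob P [set w | normalized_covar a a' t (N t w) (fun i => X i w) <= x + s] + e / 2.
  by near: t; exact: h2.
apply/andP; split; lra.
Unshelve. all: by end_near. Qed.
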